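(* Let $n$ be an integer such that $15\leq n\leq 20$, $27\leq n\leq 44$, or $n\geq 51$. Let $p\equiv 11\pmod{12}$ be a prime such that $(n+2)/2\leq p\leq n-4$. Let $s(r-1)\equiv-1\pmod p$ where $\mathbb{F}_p^{*2}=\langle r\rangle$. Let $k:=2p+4-n$, so $6\leq k\leq p$ and $n\equiv k\pmod 2$. Let $\alpha\in\mathbb{F}_p^{*2}$ be such that $\alpha^3=r$ (such an $\alpha$ exists because $\gcd(p-1,3)=1$). Let $A_n=\operatorname{Alt}(\{-p+k-1,\ldots,p+2\})$, and use the representatives $\{1,2,\ldots,p\}$ for $\mathbb{F}_p$. The alternating group $A_n$ has a 3-generator 7-relator presentation with bit-length $O(\log n)$, namely $$\bar J:=\langle a,g,y\mid a^p=b^{(p-1)/2},\ (a^s)^b=a^{s-1},\ (zz^a)^2=1,\ \tilde a=(\tilde ah)^y,\ c=c^y,\ [d,e^y]=1,\ y=w\rangle\cong A_n,$$ for the words $b,z,h,\tilde a,c,d,e,w$ defined below. Here, for a word $f$ in $\{a,g,y\}$ and a permutation $\sigma\in A_n$, $f\equiv\sigma$ means $\bar\varphi(f)=\sigma$, where $\bar\varphi\colon\bar J\to A_n$ is the isomorphism induced by mapping $a,g,y$ to the permutations in (1). (1) An isomorphism $\bar J\cong A_n$ is induced by: - $a\equiv(1,2,\ldots,p)$, - $g\equiv(x\mapsto\alpha x:x\in\mathbb{F}_p^* )(p+2,p+1,p)$, - $y\equiv(-p-1+k,p+2)(-p+k,p+1)\cdots(-1,k+2)(0,k+1)$ if $n$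 is odd, - $y\equiv(-p-1+k,p+2,-p+k,p+1)(-p+1+k,p)\cdots(-1,k+2)(0,k+1)$ if $n$ is even. (2) - $b:=g^3\equiv(x\mapsto rx:x\in\mathbb{F}_p^* )$, - $z:=g^{(p-1)/2}\equiv(p,p+1,p+2)$, - $h:=(b^2z(1)z(-1))^{(p+1)/2}\equiv1$. (3) - $z(i):=z^{a^i}\equiv(i,p+1,p+2)$ for $1\leq i\leq p$, - $d(i,j):=z(i)z(j)^{-1}z(i)\equiv(i,j)(p+1,p+2)$ for $1\leq i,j\leq p$, $i\neq j$. (These remain unchanged when $i,j$ are replaced by equivalent residues mod $p$.) (4) $x:=d(0,1)\equiv(1,p)(p+1,p+2)$, and - $c(i,j):=a^{-j}(ax)^{j-i}a^i$ for $1\leq i\leq j\leq p-1$, - $c(i,p):=z^{(za)^{-2}}c(i,p-2)$ for $1\leq i\leq p-2$, - $c(i,p+1):=z^{(za)^{-1}}c(i,p-1)$ for $1\leq i\leq p-1$, - $c(i,p+2):=z\,c(i,p)$ for $1\leq i\leq p-2$; and $c(i,j)\equiv(i,i+1,\ldots,j)(p+1,p+2)^{j-i}$ where defined. (5) - $\tilde a:=z(3)^{z(2)z(1)}\equiv(1,2,3)$, - $c:=c(1,k)\equiv(1,\ldots,k)$ if $n$ is odd, and $c:=c(2,k)\equiv(2,\ldots,k)$ if $n$ is even, - $d:=c(5,p+2)\equiv(5,\ldots,p+2)$, - $e:=za\,c(2,k+1)^{-1}\equiv(1,k+1,\ldots,p,p+1,p+2)$ if $n$ is odd, and $e:=za\,c(3,k+1)^{-1}\equiv(1,2,k+1,\ldots,p,p+1,p+2)$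 if $n$ is even. (6) The word $w$, a word in $\{a,g\}\cup\{a,g\}^y$, is defined as follows. - If $k=p$, then $w:=z^{yz^{-1}}z^{yz}\equiv(-1,p+2)(0,p+1)\equiv y$. - If $k\leq p-1$, then define $\tilde x:=[d(1,k+2)d(2,k+1)]^{d(1,k+2)^yd(2,k+1)^y}\equiv(-1,k+2)(0,k+1)$, $u:=(za)(za)^y\equiv(1,\ldots,k,k+1,k+2,\ldots,p,p+1,p+2)(1,\ldots,k,0,-1,\ldots,-p-1+k)$, and $w:=(\tilde xu^{-2})^{(p-k)/2}\tilde xu^{p-k}$ if $n$ is odd, $w:=d(1,-1)^{zaya^{-1}z^{-2}a^{-1}}\,z(1)^{-ya^{-1}z^{-1}}\,(\tilde xu^{-2})^{(p-k-3)/2}\,\tilde xu^{p-k-3}$ if $n$ is even; in either case $w\equiv y$.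
   Context: Conventions: $\mathbb{F}_p^*$ is the multiplicative group of the field $\mathbb{F}_p$ with $p$ elements, and $\mathbb{F}_p^{*2}$ is its subgroup of nonzero squares. $g^h=h^{-1}gh$, $g^{-h}=(g^{-1})^h$, and $[g,h]=g^{-1}h^{-1}gh$; square brackets around a single element (as in the definition of $\tilde x$) are just parentheses. $\{a,g\}^y=\{a^y,g^y\}$. Permutations act on the right and are multiplied left to right, e.g. $(1,2)(2,3)=(1,3,2)$. The notation $(x\mapsto\alpha x:x\in\mathbb{F}_p^* )$ denotes the permutation multiplying the elements of $\mathbb{F}_p^*$, represented by $1,\ldots,p-1$, by $\alpha$ and fixing all other points. The bit-length of a finite presentation is the number of symbols required to write it down, where each generator is a single symbol, each relator is a string of symbols, and exponents are written in binary.
   Formalization: For n even the second cycle of u is corrected to end -p+1+k, -p-1+k, -p+k; for k=p-1, where d(1,k+2) is outside its stated range and is read by its formula as z(1), x~ is corrected to (-1,p+2)(0,p). The O(log n) bound is stated for representatives s with |s| at most p. *)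

(* Defs.v *)
(* Built on Mathematical Components; boolp only serves to form the quotient of
   the set of words by equality modulo the relators. *)
From HB Require Import structures.
From mathcomp Require Import all_boot all_order all_fingroup all_algebra.
From mathcomp Require Import all_solvable.
From mathcomp Require Import boolp zify.

Set Implicit Arguments.
Unset Strict Implicit.
Unset Printing Implicit Defensive.

Import Order.TTheory GRing.Theory Num.Theory.

(* A letter (x, false) stands for the generator x and (x, true) for its
   inverse. *)
Definition word (X : Type) := seq (X * bool).

Definition wordV X (u : word X) : word X :=
  rev [seq (l.1, ~~ l.2) | l <- u].

(* A word written with (signed) exponents, as in a presentation on paper. *)
Inductive expr (X : Type) : Type :=
| Gen of X
| One
| Mul of expr X & expr X
| Pow of expr X & int.
Arguments One {X}.

Fixpoint expand X (e : expr X) : word X :=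
  match e with
  | Gen x => [:: (x, false)]
  | One => [::]
  | Mul u v => expand u ++ expand v
  | Pow u (Posz m) => flatten (nseq m (expand u))
  | Pow u (Negz m) => flatten (nseq m.+1 (wordV (expand u)))
  end.

Fixpoint esubst X Y (f : Y -> expr X) (e : expr Y) : expr X :=
  match e with
  | Gen y => f y
  | One => One
  | Mul u v => Mul (esubst f u) (esubst f v)
  | Pow u m => Pow (esubst f u) m
  end.

Definition Conj X (u v : expr X) := Mul (Mul (Pow v (- 1)%R) u) v.

Definition Comm X (u v : expr X) :=
  Mul (Mul (Pow u (- 1)%R) (Pow v (- 1)%R)) (Mul u v).

Declare Scope expr_scope.
Delimit Scope expr_scope with W.
Bind Scope expr_scope with expr.
Arguments Mul {X} u%_W v%_W.
Arguments Pow {X} u%_W m%_R.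
Arguments Conj {X} u%_W v%_W.
Arguments Comm {X} u%_W v%_W.
Notation "1" := One : expr_scope.
Notation "u * v" := (Mul u v) : expr_scope.
Notation "u ^+ m" := (Pow u m) : expr_scope.
Notation "u ^-1" := (Pow u (- 1)) : expr_scope.
Notation "u ^ v" := (Conj u v) : expr_scope.
Notation "[ ~ u , v ]" := (Comm u v) : expr_scope.

(* Equality of u and v in the group generated by X with relators R; for
   R = [::] this is equality in the free group on X. *)
Inductive word_eq (X : eqType) (R : seq (word X)) : word X -> word X -> Prop :=
| word_eq_refl u : word_eq R u u
| word_eq_sym u v : word_eq R u v -> word_eq R v u
| word_eq_trans u v w : word_eq R u v -> word_eq R v w -> word_eq R u w
| word_eq_cat u u' v v' :
    word_eq R u u' -> word_eq R v v' -> word_eq R (u ++ v) (u' ++ v')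
| word_eq_cancel x b : word_eq R [:: (x, b); (x, ~~ b)] [::]
| word_eq_relator u : u \in R -> word_eq R u [::].

(* The pair (u, v) stands for the relation u = v. *)
Record presentation := Presentation {
  ngens : nat;
  rels : seq (expr 'I_ngens * expr 'I_ngens)
}.

Definition relators (P : presentation) : seq (word 'I_(ngens P)) :=
  [seq expand r.1 ++ wordV (expand r.2) | r <- rels P].

(* An exponent is charged one pair of parentheses, its binary digits and, if
   it is negative, a sign. *)
Fixpoint symbol_length X (e : expr X) : nat :=
  match e with
  | Gen _ | One => 1
  | Mul u v => symbol_length u + symbol_length v
  | Pow u m =>
      symbol_length u + 2 + ((m < 0)%R + (trunc_log 2 (absz m)).+1)
  end.

Definition bit_length (P : presentation) : nat :=
  ngens P + \sum_(r <- rels P) (symbol_length r.1 + symbol_length r.2 + 1).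

Section PresentedGroup.
Variable P : presentation.
Local Notation W := (word 'I_(ngens P)).
Local Notation "u ~~> v" := (word_eq (relators P) u v) (at level 70).

Definition pres_rel (u v : W) : bool := `[< u ~~> v >].

Fact pres_rel_equiv : equiv_class_of pres_rel.
Proof.
split=> [u | u v | v u w].
- by apply/asboolP/word_eq_refl.
- by apply/asboolP/asboolP; apply: word_eq_sym.
- by move=> /asboolP uv /asboolP vw; apply/asboolP/(word_eq_trans uv vw).
Qed.

Canonical pres_equiv := EquivRelPack pres_rel_equiv.

Local Open Scope quotient_scope.

Definition presented : Type := {eq_quot pres_equiv}.

HB.instance Definition _ := Choice.on presented.

Definition pclass (u : W) : presented := \pi_({eq_quot pres_equiv}) u.
Definition prepr (x : presented) : W :=
  generic_quotient.repr (x : {eq_quot pres_equiv}).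

Lemma pclassP u v : pclass u = pclass v <-> u ~~> v.
Proof.
split=> [eq_uv | uv]; first by apply/asboolP; move/eqmodP: eq_uv.
by apply/eqmodP/asboolP.
Qed.

Lemma pclass_prepr (x : presented) : pclass (prepr x) = x.
Proof. exact: reprK. Qed.

Lemma prepr_pclass u : prepr (pclass u) ~~> u.
Proof. by apply/pclassP; rewrite pclass_prepr. Qed.

Definition pmul (x y : presented) := pclass (prepr x ++ prepr y).
Definition pone := pclass [::].
Definition pinv (x : presented) := pclass (wordV (prepr x)).

Lemma pclass_cat u v : pclass (u ++ v) = pmul (pclass u) (pclass v).
Proof.
by apply/pclassP/word_eq_sym/word_eq_cat; apply: prepr_pclass.
Qed.

Lemma word_mulVw (X : eqType) (R : seq (word X)) u :
  word_eq R (wordV u ++ u) [::].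
Proof.
elim: u => [|[x b] u IHu]; first exact: word_eq_refl.
rewrite /wordV /= rev_cons -cats1 -catA.
apply: word_eq_trans IHu; apply: (word_eq_cat (word_eq_refl _ _)).
apply: (@word_eq_cat _ _ [:: (x, ~~ b); (x, b)] [::] u u); last first.
  exact: word_eq_refl.
by have := word_eq_cancel R x (~~ b); rewrite negbK.
Qed.

Lemma wordVK (X : Type) : involutive (@wordV X).
Proof.
move=> u; rewrite /wordV map_rev revK -map_comp.
by elim: u => //= -[x b] u ->; rewrite /= negbK.
Qed.

Lemma word_mulwV (X : eqType) (R : seq (word X)) u :
  word_eq R (u ++ wordV u) [::].
Proof. by rewrite -{1}[u]wordVK; apply: word_mulVw. Qed.

Lemma presented_ind (Q : presented -> Prop) :
  (forall u, Q (pclass u)) -> forall x, Q x.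
Proof. by move=> Qu x; rewrite -[x]pclass_prepr. Qed.

Fact pmulA : associative pmul.
Proof.
elim/presented_ind=> u; elim/presented_ind=> v; elim/presented_ind=> w.
by rewrite -!pclass_cat catA.
Qed.

Fact pmul1 : left_id pone pmul.
Proof. by elim/presented_ind=> u; rewrite -pclass_cat. Qed.

Fact pmulr1 : right_id pone pmul.
Proof. by elim/presented_ind=> u; rewrite -pclass_cat cats0. Qed.

Fact pmulV : left_inverse pone pinv pmul.
Proof.
move=> x; rewrite -{2}[x]pclass_prepr -pclass_cat.
by apply/pclassP/word_mulVw.
Qed.

Fact pmulrV : right_inverse pone pinv pmul.
Proof.
move=> x; rewrite -{1}[x]pclass_prepr -pclass_cat.
by apply/pclassP/word_mulwV.
Qed.

HB.instance Definition _ :=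
  isGroup.Build presented pmulA pmul1 pmulr1 pmulV pmulrV.

Definition pelt (e : expr 'I_(ngens P)) : presented := pclass (expand e).

End PresentedGroup.
Arguments pelt : clear implicits.

Local Open Scope ring_scope.

Definition irange (i j : int) : seq int :=
  [seq i + m%:Z | m <- iota 0 (if i <= j then (absz (j - i)).+1 else 0%N)].

Definition Fp_squares (p : nat) : {set {unit 'F_p}} :=
  [set (u ^+ 2)%g | u in [set: {unit 'F_p}]].

Section Words.
Variables (n p : nat).

Definition kpar : nat := (2 * p + 4 - n)%N.
Local Notation k := (kpar%:Z).
Local Notation q := (p%:Z).

(* The points are genuine integers. *)
Definition points : seq int := irange (- q + k - 1) (q + 2).
Definition point : finType := seq_sub points.

(* The permutation of the points that agrees with f, if there is one; see
   perm_byE. *)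
Definition perm_by (f : int -> int) : {perm point} :=
  odflt 1%g [pick t : {perm point} | [forall x, val (t x) == f (val x)]].

Definition cyc (c : seq int) : {perm point} := perm_by (next c).

Definition mulperm (beta : {unit 'F_p}) : {perm point} :=
  perm_by (fun x => if 1 <= x <= q - 1
                    then (val (val beta * x%:~R : 'F_p))%:Z else x).

Definition sigma_a : {perm point} := cyc (irange 1 q).

Definition sigma_g (alpha : {unit 'F_p}) : {perm point} :=
  (mulperm alpha * cyc [:: q + 2; q + 1; q]%R)%g.

Definition sigma_y : {perm point} :=
  if odd n then
    (\prod_(i < (p + 2 - kpar)%N) cyc [:: - i%:Z; k + 1 + i%:Z]%R)%g
  else
    (cyc [:: - q - 1 + k; q + 2; - q + k; q + 1]%R *
     \prod_(i < (p - kpar)%N) cyc [:: - i%:Z; k + 1 + i%:Z]%R)%g.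

Local Open Scope expr_scope.
Local Notation E := (expr 'I_3).

Definition wa : E := Gen (@Ordinal 3 0 isT).
Definition wg : E := Gen (@Ordinal 3 1 isT).
Definition wy : E := Gen (@Ordinal 3 2 isT).

Definition wb : E := wg ^+ 3.
Definition wz : E := wg ^+ (p.-1./2)%:Z.

(* z(i) and d(i,j), extended to all integers i and j by the same formulas. *)
Definition wzi (i : int) : E := wz ^ (wa ^+ i).
Definition wdij (i j : int) : E := wzi i * (wzi j)^-1 * wzi i.

Definition wh : E := (wb ^+ 2 * wzi 1%R * wzi (-1)%R) ^+ (p.+1./2)%:Z.
Definition wx : E := wdij 0%R 1%R.

Definition wcbase (i j : int) : E :=
  wa ^+ (- j) * (wa * wx) ^+ (j - i) * wa ^+ i.

(* c(i,j) for j <= p + 2; the last branch is meant for j = p + 2. *)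
Definition wcij (i j : int) : E :=
  if (j <= q - 1)%R then wcbase i j
  else if (j == q)%R then (wz ^ ((wz * wa) ^+ (- 2))) * wcbase i (q - 2)%R
  else if (j == q + 1)%R then (wz ^ ((wz * wa)^-1)) * wcbase i (q - 1)%R
  else wz * ((wz ^ ((wz * wa) ^+ (- 2))) * wcbase i (q - 2)%R).

Definition watilde : E := wzi 3%R ^ (wzi 2%R * wzi 1%R).
Definition wc : E := if odd n then wcij 1%R k else wcij 2%R k.
Definition wd : E := wcij 5%R (q + 2)%R.
Definition we : E :=
  if odd n then wz * wa * (wcij 2%R (k + 1)%R)^-1
  else wz * wa * (wcij 3%R (k + 1)%R)^-1.

Definition wxtilde : E :=
  (wdij 1%R (k + 2)%R * wdij 2%R (k + 1)%R) ^
    ((wdij 1%R (k + 2)%R ^ wy) * (wdij 2%R (k + 1)%R ^ wy)).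

Definition wu : E := (wz * wa) * ((wz * wa) ^ wy).

(* For n even and k = p - 1 the exponent (p - k - 3) / 2 is - 1, so that the
   two occurrences of wxtilde cancel. *)
Definition ww : E :=
  if kpar == p then (wz ^ (wy * wz^-1)) * (wz ^ (wy * wz))
  else if odd n then
    (wxtilde * wu ^+ (- 2)) ^+ ((q - k) %/ 2)%Z * wxtilde * wu ^+ (q - k)
  else
    (wdij 1%R (-1)%R ^ (wz * wa * wy * wa^-1 * wz ^+ (- 2) * wa^-1)) *
    ((wzi 1%R)^-1 ^ (wy * wa^-1 * wz^-1)) *
    (wxtilde * wu ^+ (- 2)) ^+ ((q - k - 3) %/ 2)%Z * wxtilde *
    wu ^+ (q - k - 3).

Definition Jbar (s : int) : presentation :=
  @Presentation 3
    [:: (wa ^+ q, wb ^+ (p.-1./2)%:Z);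
        ((wa ^+ s) ^ wb, wa ^+ (s - 1));
        ((wz * (wz ^ wa)) ^+ 2, 1);
        (watilde, (watilde * wh) ^ wy);
        (wc, wc ^ wy);
        ([~ wd, we ^ wy], 1);
        (wy, ww)].

End Words.

Lemma mem_irange (i j x : int) : (x \in irange i j) = (i <= x <= j).
Proof.
apply/mapP/idP => [[m] | /andP[ix xj]].
  rewrite mem_iota add0n /=; case: ifP => // ij lt_m ->.
  rewrite lerDl /= -lerBrDl -[leRHS]gez0_abs ?subr_ge0 //.
exists (absz (x - i)); last by rewrite gez0_abs ?subr_ge0 // addrCA subrr addr0.
rewrite mem_iota add0n /= (le_trans ix xj) ltnS -lez_nat.
by rewrite !gez0_abs ?subr_ge0 ?lerB // (le_trans ix).
Qed.

Lemma perm_byE n p (f : int -> int) (x : point n p) :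
  {in points n p, forall x, f x \in points n p} ->
  {in points n p &, injective f} ->
  val (perm_by n p f x) = f (val x).
Proof.
move=> fP f_inj; rewrite /perm_by; case: pickP => [t /forallP/(_ x)/eqP //|].
pose h (y : point n p) : point n p := SeqSub (fP _ (valP y)).
have h_inj : injective h.
  by move=> y z [] /f_inj eq_yz; apply/val_inj/eq_yz; apply: valP.
move/(_ (perm h_inj)); case/negP; apply/forallP=> y.
by rewrite permE.
Qed.

Lemma cycE n p (c : seq int) (x : point n p) :
  uniq c -> {subset c <= points n p} -> val (cyc n p c x) = next c (val x).
Proof.
move=> Uc sub; apply: perm_byE => [y Py | y z _ _].
  have [cy | nc] := boolP (y \in c); first by rewrite sub ?mem_next.
  by rewrite next_nth (negPf nc).
exact: (can_inj (prev_next Uc)).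
Qed.

Lemma mulpermE n p (beta : {unit 'F_p}) (x : point n p) :
  prime p -> (n <= 2 * p + 4)%N -> (p + 3 <= n)%N ->
  val (mulperm n beta x) =
    if 1 <= val x <= p%:Z - 1
    then (val (val beta * (val x)%:~R : 'F_p))%:Z else val x.
Proof.
move=> p_pr le_n le_p.
have valFp (y : int) : 1 <= y <= p%:Z - 1 ->
    1 <= (val (val beta * y%:~R : 'F_p))%:Z <= p%:Z - 1.
  case: y => [m|m] //= /andP[m_gt0 m_lt].
  have nz_m : m%:R != 0 :> 'F_p.
    by rewrite -(dvdn_pcharf (pchar_Fp p_pr)); apply/negP=> /dvdn_leq; lia.
  have: val beta * m%:R != 0 by rewrite mulf_neq0 // -unitfE (valP beta).
  have := ltn_ord (val beta * m%:R : 'F_p); rewrite [X in (_ < X)%N -> _]Fp_cast //.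
  by rewrite -val_eqE /=; lia.
have inP (y : int) : (y \in points n p) = (p%:Z + 3 - n%:Z <= y <= p%:Z + 2).
  by rewrite mem_irange /kpar; lia.
have val_int_inj (u v : 'F_p) : (val u)%:Z = (val v)%:Z -> u = v.
  by case=> /val_inj.
apply: perm_byE => [y | y z _ _].
  by rewrite !inP; case: ifP => // /valFp; lia.
case: ifP => [Py | nPy]; case: ifP => [Pz | nPz] //.
- move=> /val_int_inj/(mulrI (valP beta)) eq_yz.
  case: y z Py Pz eq_yz => [y|y] [z|z] //= Py Pz /(congr1 val).
  by rewrite /= !val_Fp_nat // !modn_small; lia.
- by move=> eq_yz; move: (valFp _ Py) nPz; rewrite eq_yz => ->.
- by move=> eq_yz; move: (valFp _ Pz) nPy; rewrite eq_yz => ->.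
Qed.

(* Main.v *)
Require Import Defs.
From HB Require Import structures.
From mathcomp Require Import all_boot all_order all_fingroup all_algebra.
From mathcomp Require Import all_solvable all_field.
From mathcomp Require Import boolp zify ring.

Set Implicit Arguments.
Unset Strict Implicit.
Unset Printing Implicit Defensive.

Import Order.TTheory GRing.Theory Num.Theory.
Local Open Scope group_scope.

(* lia splits on every boolean hypothesis, so the irrelevant ones go first. *)
Ltac arith :=
  repeat match goal with
  | H := _ |- _ => clear H
  | H : is_true (in_mem _ _) |- _ => clear H
  | H : is_true (~~ in_mem _ _) |- _ => clear H
  | H : is_true (prime _) |- _ => clear H
  | H : @eq (set_of _) _ _ |- _ => clear H
  | H : @eq (FinRing.unit_of _) _ _ |- _ => clear H
  | H : @eq nat (modn _ _) _ |- _ => clear H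
  end; lia.

(** Write m = (p-1)/2, which is odd and 5 modulo 6. That the given permutations satisfy the seven
    relations is a computation, so von Dyck's theorem ([von_dyck]) maps the presented group to the
    permutations of the points, and the image is the alternating group ([eval_alt], [alt_eval]).
    Injectivity is the real content: for elements a, g, y of any group G that satisfy the relations,
    there is a homomorphism F from the alternating group to G that sends the permutation of each
    word to the value of that word ([alt_hom]). When G is the presented group itself, F is a left
    inverse of the first map.

    F is built with Carmichael's presentation ([carmichael]): the alternating group on u, v and a
    set B is generated by the 3-cycles (i, u, v) with i in B, subject to X_i^3 = 1 and (X_i X_j)^2 =
    1 for distinct i, j. It is applied twice.

    The first application is to the points 1, ..., p+2, with u = p+1 and v = p+2. The first two
    relations yield a^p = b^m = 1 and a^b = a^r. As z is a power of g it commutes with b, so b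
    permutes the conjugates of z by powers of a. Every nonzero residue is a power of r up to sign,
    because -1 is not a square; so the relation (z z^a)^2 = 1 spreads to all pairs. The resulting f
    matches a and b up to factors that centralize its image. The word h detects the factor of b: its
    permutation is trivial, while in G it is the square of that factor. The relation for [watilde]
    forces h^3 = 1, which kills the factor because m is prime to 6; then the factor of a dies too,
    and f takes the value of g ([hom_private1_eval]).

    The second application is to all points, with u = 1 and v = 2: a positive j gets f of (j, 1, 2),
    and any other j gets a conjugate by y of such a value. The relations for [watilde] and c make y
    centralize f on the alternating group of the overlap 1, ..., k ([common_agree]). The remaining
    mixed Carmichael relations come from [d, e^y] = 1 ([glue_rel]), with room provided by the six
    common points 1, ..., 6. The extension F respects conjugation by y on the first alternating
    group ([extend_alt]). Since w is a word in a, g, a^y, g^y whose permutation is y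
    ([in_y_conjugates_w], [eval_w]), the relation y = w gives F the right value at y.

    For the length, the words have boundedly many symbols when each exponent counts once, and all
    exponents are at most 2n in absolute value ([bit_length_le]). *)

Definition expgz (G : groupType) (x : G) (m : int) : G :=
  match m with Posz k => x ^+ k | Negz k => x ^- k.+1 end.

(** * Integer powers and commutation in a group *)

Section IntegerPowers.
Variable G : groupType.
Implicit Types (x y : G) (m n : int).

Lemma expgzS x m : expgz x (m + 1)%R = expgz x m * x.
Proof.
case: m => [m | [|m]]; first by rewrite -PoszD addn1 /= expgSr.
  by rewrite /= expg1 mulVg.
have -> : (Negz m.+1 + 1 = Negz m)%R by rewrite !NegzE; lia.
by rewrite /= [in RHS]expgS invgM mulgVK.
Qed.

Lemma expgzB1 x m : expgz x (m - 1)%R = expgz x m * x^-1.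
Proof. by rewrite -[in RHS](subrK 1%R m) expgzS mulgK. Qed.

Lemma expgzD x m n : expgz x (m + n)%R = expgz x m * expgz x n.
Proof.
elim/int_ind: n => [|n IHn|n IHn]; first by rewrite addr0 /= mulg1.
  by rewrite -addn1 PoszD addrA !expgzS IHn mulgA.
by rewrite -addn1 PoszD opprD addrA !expgzB1 IHn mulgA.
Qed.

Lemma expgzN x m : expgz x (- m)%R = (expgz x m)^-1.
Proof.
by apply: (mulIg (expgz x m)); rewrite -expgzD addNr mulVg.
Qed.

Lemma expgzM x m n : expgz x (m * n)%R = expgz (expgz x m) n.
Proof.
elim/int_ind: n => [|n IHn|n IHn]; first by rewrite mulr0 /= !expg0.
  by rewrite -addn1 PoszD mulrDr mulr1 expgzS expgzD IHn.
by rewrite -addn1 PoszD opprD mulrDr mulrN1 expgzB1 expgzD IHn (expgzN x m).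
Qed.

Lemma expgzJ x y m : expgz x m ^ y = expgz (x ^ y) m.
Proof. by case: m => m /=; rewrite ?conjVg conjXg. Qed.

Lemma expgz_mod x p m : x ^+ p = 1 -> expgz x (m %% p%:Z)%Z = expgz x m.
Proof.
move=> xp1; rewrite [in RHS](divz_eq m p) [RHS]expgzD (mulrC _ (Posz p)) [X in _ = X * _]expgzM /= xp1.
have -> : expgz 1 (m %/ p%:Z)%Z = 1 :> G.
  by case: (m %/ p%:Z)%Z => j /=; rewrite expg1n ?invg1.
by rewrite mul1g.
Qed.

Lemma eq_expgz_mod x p m n :
  x ^+ p = 1 -> (m = n %[mod p%:Z])%Z -> expgz x m = expgz x n.
Proof. by move=> xp1 mn; rewrite -(expgz_mod m xp1) mn expgz_mod. Qed.

Lemma commute_expgz x y m : commute x y -> commute x (expgz y m).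
Proof.
by move=> cxy; case: m => m; [apply: commuteX | apply/commuteV/commuteX].
Qed.

Lemma commuteJ x y z : commute x y -> commute (x ^ z) (y ^ z).
Proof. by rewrite /commute -!conjMg => ->. Qed.

Lemma commute_conj x y : commute x y -> x ^ y = x.
Proof. by move=> cxy; rewrite conjgE cxy mulKg. Qed.

Lemma expg_gcdn_eq1 x (m n : nat) : x ^+ m = 1 -> x ^+ n = 1 -> x ^+ gcdn m n = 1.
Proof.
case: m => [|m] xm xn; first by rewrite gcd0n.
case: (@egcdnP m.+1 n) => // km kn def_km _.
have: x ^+ (km * m.+1) = x ^+ (kn * n + gcdn m.+1 n) by rewrite def_km.
by rewrite expgnDr (mulnC km) (mulnC kn) !expgnA xm xn !expg1n mul1g.
Qed.

End IntegerPowers.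

(** * Evaluation of words *)

Fixpoint eval (X : Type) (G : groupType) (rho : X -> G) (e : expr X) : G :=
  match e with
  | Gen x => rho x
  | One => 1
  | Mul u v => eval rho u * eval rho v
  | Pow u m => expgz (eval rho u) m
  end.

Section Eval.
Variables (X : Type) (G : groupType) (rho : X -> G).

Lemma evalV e : eval rho (Pow e (- 1)%R) = (eval rho e)^-1.
Proof. by []. Qed.

Lemma evalJ u v : eval rho (Conj u v) = eval rho u ^ eval rho v.
Proof. by rewrite conjgE mulgA. Qed.

Lemma evalR u v : eval rho (Comm u v) = [~ eval rho u, eval rho v].
Proof. by rewrite /= /commg /conjg !mulgA. Qed.

Definition weval (w : word X) : G :=
  \prod_(l <- w) (if l.2 then (rho l.1)^-1 else rho l.1).

Lemma weval_cat u v : weval (u ++ v) = weval u * weval v.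
Proof. by rewrite /weval big_cat. Qed.

Lemma wevalV u : weval (wordV u) = (weval u)^-1.
Proof.
rewrite /wordV; elim: u => [|[x b] u IHu]; first by rewrite /weval !big_nil invg1.
rewrite /= rev_cons -cats1 weval_cat IHu -[in RHS]cat1s [in RHS]weval_cat invgM.
by rewrite /weval !big_seq1 /=; case: b; rewrite /= ?invgK.
Qed.

Lemma weval_expand e : weval (expand e) = eval rho e.
Proof.
have wX w m : weval (flatten (nseq m w)) = weval w ^+ m.
  elim: m => [|m IHm]; first by rewrite /weval big_nil.
  by rewrite /= weval_cat IHm -expgS.
elim: e => [x||u IHu v IHv|u IHu [m|m]] /=.
- by rewrite /weval big_seq1.
- by rewrite /weval big_nil.
- by rewrite weval_cat IHu IHv.
- by rewrite wX IHu.
- by rewrite weval_cat wX wevalV IHu -expgS expVgn.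
Qed.

Lemma eval_ext rho' : rho =1 rho' -> eval rho =1 eval rho'.
Proof. by move=> eq_rho; elim=> //= [u -> v -> | u -> m]. Qed.

Lemma eval_esubst Y (h : Y -> expr X) e :
  eval rho (esubst h e) = eval (fun y => eval rho (h y)) e.
Proof. by elim: e => //= [u -> v -> | u -> m]. Qed.

End Eval.

Lemma eval_morph X (G H : groupType) (f : {multiplicative G -> H})
  (rho : X -> G) e : f (eval rho e) = eval (fun x => f (rho x)) e.
Proof.
have f1 : f 1 = 1 by apply: (mulgI (f 1)); rewrite -gmulfM !mulg1.
have fV x : f x^-1 = (f x)^-1.
  by apply: (mulgI (f x)); rewrite -gmulfM !mulgV.
have fX x m : f (x ^+ m) = f x ^+ m.
  by elim: m => // m IHm; rewrite !expgS gmulfM IHm.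
elim: e => //= [u IHu v IHv|u IHu [m|m]]; first by rewrite gmulfM IHu IHv.
  by rewrite /= fX IHu.
by rewrite fV fX IHu.
Qed.

(** * Homomorphisms out of a presented group *)

Section VonDyck.
Variable P : presentation.
Local Notation J := (presented P).

Lemma pclassM u v : pclass (u ++ v) = (pclass u : J) * pclass v.
Proof. exact: pclass_cat. Qed.

Lemma pclassV u : pclass (wordV u) = (pclass u : J)^-1.
Proof.
apply: (mulIg (pclass u : J)); rewrite -pclassM mulVg.
by apply/pclassP/word_mulVw.
Qed.

Lemma pclassX u m : pclass (flatten (nseq m u)) = (pclass u : J) ^+ m.
Proof. by elim: m => //= m IHm; rewrite pclassM IHm expgS. Qed.

Lemma pelt_eval e : pelt P e = eval (fun i => pelt P (Gen i)) e.
Proof.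
elim: e => //= [u IHu v IHv|u IHu [m|m]]; rewrite /expgz -?IHu -?IHv.
- exact: pclassM.
- exact: pclassX.
- by rewrite -expVgn -pclassV -pclassX.
Qed.

(** The fold unfolds, for a concrete presentation, to a nested conjunction with one equation per
    relation, closed by [True]. *)
Definition satisfies (G : groupType) (rho : 'I_(ngens P) -> G) : Prop :=
  foldr (fun r Q => eval rho r.1 = eval rho r.2 /\ Q) True (rels P).

Lemma pelt_satisfies : satisfies (fun i => pelt P (Gen i)).
Proof.
have: {subset [seq expand r.1 ++ wordV (expand r.2) | r <- rels P]
         <= relators P} by [].
rewrite /satisfies; elim: (rels P) => //= r rs IHrs sub_rs; split.
  rewrite -!pelt_eval; apply: divg1_eq; rewrite -pclassV -pclassM; apply/pclassP.
  by apply/word_eq_relator/sub_rs/mem_head.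
by apply: IHrs => u rs_u; apply: sub_rs; rewrite inE rs_u orbT.
Qed.

Lemma weval_word_eq (G : groupType) (rho : 'I_(ngens P) -> G) u v :
  satisfies rho -> word_eq (relators P) u v -> weval rho u = weval rho v.
Proof.
move=> rho_rel; elim=> {u v} // [u v w _ -> _ -> //|u u' v v' _ Eu _ Ev|x b|u].
- by rewrite !weval_cat Eu Ev.
- by rewrite /weval big_cons big_seq1 big_nil; case: b; rewrite /= ?mulVg ?mulgV.
rewrite [RHS]/weval big_nil; move: rho_rel; rewrite /relators /satisfies.
elim: (rels P) => //= r rs IHrs [Er Ers]; rewrite inE => /predU1P[-> |]; last exact: IHrs.
by rewrite weval_cat wevalV !weval_expand Er mulgV.
Qed.

(** Evaluating a representative word is independent of the representative by [weval_word_eq], and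
    concatenation evaluates to a product. *)
Lemma von_dyck (G : groupType) (rho : 'I_(ngens P) -> G) :
  satisfies rho ->
  exists phi : {multiplicative presented P -> G},
    forall e, phi (pelt P e) = eval rho e.
Proof.
move=> rho_rel; pose phi (x : J) := weval rho (prepr x).
have phiE u : phi (pclass u) = weval rho u.
  by apply: weval_word_eq => //; apply: prepr_pclass.
have phiM : {morph phi : x y / x * y}.
  elim/presented_ind=> u; elim/presented_ind=> v.
  by rewrite -pclassM !phiE weval_cat.
pose phi_isM := isMultiplicative.Build J G phi phiM.
pose phi_M : {multiplicative J -> G} := HB.pack phi phi_isM.
by exists phi_M => e; rewrite -weval_expand; apply: phiE.
Qed.

End VonDyck.

(** The group presented by no relators is one of the groups G, and the class of a word is its value
    there. Free equality of words thus reduces to an identity valid in all groups. *)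
Lemma word_eq_free k (u v : word 'I_k) :
  (forall (G : groupType) (rho : 'I_k -> G), weval rho u = weval rho v) ->
  word_eq [::] u v.
Proof.
pose P := @Presentation k [::] => eq_uv.
have pclassE (w : word 'I_(ngens P)) :
  pclass w = weval (fun i => pelt P (Gen i)) w :> presented P.
  elim: w => [|[x b] w IHw]; first by rewrite /weval big_nil.
  rewrite -cat1s pclassM weval_cat -IHw /weval big_seq1; congr (_ * _).
  case: b => //; exact: (@pclassV P [:: (x, false)]).
by apply/(@pclassP P); rewrite !pclassE; apply: eq_uv.
Qed.

(** * Carmichael's presentation of alternating groups *)

(** Alternating groups of different subsets live in one permutation type, so that they can be
    compared and glued. *)
Definition alt_on (T : finType) (S : {set T}) : {group {perm T}} :=
  (perm.Sym S :&: 'Alt_T)%G.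

(** The 3-cycle (i, u, v); u and v come first because they stay fixed while i runs over Carmichael's
    generators. *)
HB.lock Definition cycle3 (T : finType) (u v i : T) : {perm T} :=
  tperm i u * tperm i v.

Section Carmichael.
Variable T : finType.
Implicit Types (s t : {perm T}) (S A : {set T}) (u v i j m : T).

Lemma alt_onE S s : (s \in alt_on S) = perm_on S s && ~~ odd_perm s.
Proof. by rewrite /= inE Alt_even /perm.Sym inE. Qed.

Lemma alt_onS S S' s : S \subset S' -> s \in alt_on S -> s \in alt_on S'.
Proof.
rewrite !alt_onE => SS' /andP[Ss ->]; rewrite andbT.
exact: subset_trans Ss SS'.
Qed.

Lemma alt_onT s : (s \in alt_on [set: T]) = (s \in 'Alt_T).
Proof. by rewrite alt_onE Alt_even andb_idl // => _; apply/subsetP=> x; rewrite inE. Qed.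

Lemma alt_onJ S s t : (s ^ t \in alt_on (t @: S)) = (s \in alt_on S).
Proof.
rewrite !alt_onE odd_permJ; congr (_ && _).
apply/subsetP/subsetP => Ss x.
  rewrite inE => sx; have := Ss (t x); rewrite inE permJ (inj_eq perm_inj) => /(_ sx).
  by rewrite (mem_imset _ _ perm_inj).
rewrite inE -(permKV t x) permJ (inj_eq perm_inj) => sx.
by apply: imset_f; apply: Ss.
Qed.

Section ThreeCycle.
Variables u v i : T.
Hypotheses (uv : u != v) (iu : i != u) (iv : i != v).

Lemma cycle3_1 : cycle3 u v i i = u.
Proof. by rewrite cycle3.unlock permM tpermL tpermD // eq_sym. Qed.

Lemma cycle3_2 : cycle3 u v i u = v.
Proof. by rewrite cycle3.unlock permM tpermR tpermL. Qed.

Lemma cycle3_3 : cycle3 u v i v = i.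
Proof. by rewrite cycle3.unlock permM (tpermD iv uv) tpermR. Qed.

Lemma cycle3_out x : x != i -> x != u -> x != v -> cycle3 u v i x = x.
Proof. by move=> xi xu xv; rewrite cycle3.unlock permM !tpermD // eq_sym. Qed.

Lemma cycle3_even : ~~ odd_perm (cycle3 u v i).
Proof. by rewrite cycle3.unlock odd_permM !odd_tperm iu iv. Qed.

Lemma cycle3_on S : u \in S -> v \in S -> i \in S -> cycle3 u v i \in alt_on S.
Proof.
move=> Su Sv Si; rewrite alt_onE cycle3_even andbT; apply/subsetP=> x.
rewrite inE; apply: contraNT => Sx.
by apply/eqP/cycle3_out; apply: contraNneq Sx => ->.
Qed.

End ThreeCycle.

Lemma cycle3J u v i s : cycle3 u v i ^ s = cycle3 (s u) (s v) (s i).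
Proof. by rewrite cycle3.unlock conjMg !tpermJ. Qed.

Lemma cycle3_rot u v i : u != v -> i != u -> i != v -> cycle3 u v i = cycle3 v i u.
Proof.
move=> uv iu iv; apply/permP=> x.
have vu : v != u by rewrite eq_sym.
have ui : u != i by rewrite eq_sym.
have vi : v != i by rewrite eq_sym.
have [-> | xi] := eqVneq x i; first by rewrite cycle3_1 // cycle3_3.
have [-> | xu] := eqVneq x u; first by rewrite cycle3_2 // cycle3_1.
have [-> | xv] := eqVneq x v; first by rewrite cycle3_3 // cycle3_2.
by rewrite !cycle3_out.
Qed.

Lemma cycle3V u v i : (cycle3 u v i)^-1 = cycle3 v u i.
Proof. by rewrite cycle3.unlock invMg !tpermV. Qed.

Lemma cycle3_cube u v i : u != v -> i != u -> i != v -> cycle3 u v i ^+ 3 = 1.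
Proof.
move=> uv iu iv; apply/permP=> x; rewrite perm1 permX /=.
have [-> | xi] := eqVneq x i; first by rewrite cycle3_1 // cycle3_2 // cycle3_3.
have [-> | xu] := eqVneq x u; first by rewrite cycle3_2 // cycle3_3 // cycle3_1.
have [-> | xv] := eqVneq x v; first by rewrite cycle3_3 // cycle3_1 // cycle3_2.
by rewrite !cycle3_out.
Qed.

Lemma cycle3_mul_sq u v i j : u != v -> i != u -> i != v -> j != u -> j != v ->
  i != j -> (cycle3 u v i * cycle3 u v j) ^+ 2 = 1.
Proof.
move=> uv iu iv ju jv ij; have ji : j != i by rewrite eq_sym.
have vu : v != u by rewrite eq_sym.
have ui : u != i by rewrite eq_sym.
have vi : v != i by rewrite eq_sym.
have uj : u != j by rewrite eq_sym.
have vj : v != j by rewrite eq_sym.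
have ci := cycle3_1 uv iu; have cu := cycle3_2 u v i; have cv := cycle3_3 uv iv.
have di := cycle3_1 uv ju; have du := cycle3_2 u v j; have dv := cycle3_3 uv jv.
have o1 := @cycle3_out u v i; have o2 := @cycle3_out u v j.
move: (cycle3 u v i) (cycle3 u v j) ci cu cv di du dv o1 o2 => c d ci cu cv di du dv o1 o2.
apply/permP=> x; rewrite perm1 permX /= !permM.
have [-> | xi] := eqVneq x i; first by rewrite ci du cv (o2 i).
have [-> | xj] := eqVneq x j; first by rewrite (o1 j) // di cu dv.
have [-> | xu] := eqVneq x u; first by rewrite cu dv (o1 j) // di.
have [-> | xv] := eqVneq x v; first by rewrite cv (o2 i) // ci du.
by rewrite (o1 x) // (o2 x) // (o1 x) // (o2 x).
Qed.

Lemma cycle3_dij u v i j : u != v -> i != u -> i != v -> j != u -> j != v ->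
  i != j -> cycle3 u v i * (cycle3 u v j)^-1 * cycle3 u v i = tperm i j * tperm u v.
Proof.
move=> uv iu iv ju jv ij; have ji : j != i by rewrite eq_sym.
have vu : v != u by rewrite eq_sym.
have ui : u != i by rewrite eq_sym.
have vi : v != i by rewrite eq_sym.
have uj : u != j by rewrite eq_sym.
have vj : v != j by rewrite eq_sym.
have ci := cycle3_1 uv iu; have cu := cycle3_2 u v i; have cv := cycle3_3 uv iv.
have di := cycle3_1 vu jv; have dv := cycle3_2 v u j; have du := cycle3_3 vu ju.
have o1 := @cycle3_out u v i; have o2 := @cycle3_out v u j.
rewrite cycle3V.
move: (cycle3 u v i) (cycle3 v u j) ci cu cv di du dv o1 o2 => c d ci cu cv di du dv o1 o2.
apply/permP=> x; rewrite !permM.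
have [-> | xi] := eqVneq x i; first by rewrite ci du (o1 j) // tpermL tpermD.
have [-> | xj] := eqVneq x j; first by rewrite (o1 j) // di cv tpermR tpermD.
have [-> | xu] := eqVneq x u; first by rewrite cu dv cu (tpermD iu ju) tpermL.
have [-> | xv] := eqVneq x v; first by rewrite cv (o2 i) // ci (tpermD iv jv) tpermR.
by rewrite (o1 x) // (o2 x) // (o1 x) // (@tpermD _ i j) 1?eq_sym // tpermD // eq_sym.
Qed.

Variables u v : T.
Hypothesis uv : u != v.
Let vu : v != u. Proof. by rewrite eq_sym. Qed.

(** The alternatives are the cosets of the stabilizer of m, told apart by the image of m, which is
    m, u, v or some i in A. With c_i the 3-cycle of i, the representatives 1, c_m, c_m^-1 and c_m^-1
    c_i send m to these points. *)
Lemma alt_on_step A m s : m \notin [set u; v] -> m \notin A ->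
  u \notin A -> v \notin A ->
  s \in alt_on (m |: ([set u; v] :|: A)) ->
  exists t, [/\ t \in alt_on ([set u; v] :|: A) &
    [\/ s = t, s = t * cycle3 u v m, s = t * (cycle3 u v m)^-1 |
        exists2 i, i \in A & s = t * (cycle3 u v m)^-1 * cycle3 u v i]].
Proof.
rewrite in_set2 negb_or => /andP[mu mv].
move=> mA uA vA s_on.
set S := _ :|: A.
have cm_on : cycle3 u v m \in alt_on (m |: S) by rewrite cycle3_on // !inE ?eqxx ?orbT.
have stab t : t \in alt_on (m |: S) -> t m = m -> t \in alt_on S.
  rewrite !alt_onE => /andP[t_on ->] tm; rewrite andbT.
  apply/subsetP=> x tx; have := subsetP t_on x tx; rewrite in_setU1.
  by case/predU1P=> // x_m; move: tx; rewrite inE x_m tm eqxx.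
have: s m \in m |: S by rewrite perm_closed ?setU11 //; move: s_on; rewrite alt_onE => /andP[].
rewrite !inE => /predU1P[sm | /orP[/orP[] /eqP sm | sA]].
- by exists s; split; [apply: stab | constructor 1].
- exists (s * (cycle3 u v m)^-1); split; last by constructor 2; rewrite mulgVK.
  apply: stab; first by rewrite groupM ?groupV.
  by rewrite permM sm; apply: (canLR (permK _)); rewrite cycle3_1.
- exists (s * cycle3 u v m); split; last by constructor 3; rewrite mulgK.
  by apply: stab; [rewrite groupM | rewrite permM sm cycle3_3].
have [iu iv im] : [/\ s m != u, s m != v & s m != m].
  by split; apply: contraTneq sA => ->.
exists (s * (cycle3 u v (s m))^-1 * cycle3 u v m); split; last first.
  by constructor 4; exists (s m) => //; rewrite mulgK mulgVK.
apply: stab.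
  by rewrite !groupM // groupV cycle3_on // !inE ?eqxx ?orbT // sA !orbT.
rewrite permM (permM s) (canLR (permK _) (esym (cycle3_3 uv iv))).
exact: cycle3_3.
Qed.

End Carmichael.

(** Only positive products are allowed; the relation X_i^3 = 1 supplies the inverses ([gen_V]). *)
Inductive gen (T : finType) (H : groupType) (X : T -> H) (A : {set T}) : H -> Prop :=
| gen1 : gen X A 1
| genM h i : i \in A -> gen X A h -> gen X A (h * X i).

Section Gen.
Variables (T : finType) (H : groupType) (X : T -> H).
Implicit Types (A B : {set T}) (h l : H) (i j m : T).

Lemma gen_sub A A' h : A \subset A' -> gen X A h -> gen X A' h.
Proof.
move=> AA'; elim=> {h} [|h i Ai _ IH]; first exact: gen1.
by apply: genM => //; apply: (subsetP AA').
Qed.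

Lemma gen_mul A h l : gen X A h -> gen X A l -> gen X A (h * l).
Proof.
move=> Ah; elim=> {l} [|l i Ai _ IH]; first by rewrite mulg1.
by rewrite mulgA; apply: genM.
Qed.

Lemma gen_gen A i : i \in A -> gen X A (X i).
Proof. by move=> Ai; rewrite -[X i]mul1g; apply/genM/gen1. Qed.

Variable B : {set T}.
Hypothesis X3 : {in B, forall i, X i ^+ 3 = 1}.
Hypothesis X2 : {in B &, forall i j, i != j -> (X i * X j) ^+ 2 = 1}.

Lemma gen_V A i : i \in A -> i \in B -> gen X A (X i)^-1.
Proof.
move=> Ai Bi; have -> : (X i)^-1 = X i * X i.
  by apply: (mulgI (X i)); rewrite mulgV -(X3 Bi).
by apply: gen_mul; apply: gen_gen.
Qed.

(** The counterpart of [alt_on_step] in a group where only Carmichael's relations are known. The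
    same representatives are stable under right multiplication by each generator, up to a left
    factor that avoids X m. The relations enter as x x = x^-1 and x y = y^-1 x^-1. *)
Lemma gen_coset A m h : m \in A -> A \subset B -> gen X A h ->
  exists2 l, gen X (A :\ m) l &
   [\/ h = l, h = l * X m, h = l * (X m)^-1 |
       exists2 i, i \in A :\ m & h = l * (X m)^-1 * X i].
Proof.
move=> Am sAB; set A' := A :\ m.
have A'A : A' \subset A by apply: subsetDl.
have Bm := subsetP sAB _ Am.
have inB i : i \in A' -> i \in B by move=> /(subsetP A'A)/(subsetP sAB).
have xx j : j \in B -> X j * X j = (X j)^-1.
  by move=> Bj; apply: (mulgI (X j)); rewrite mulgV -(X3 Bj).
have vv j : j \in B -> (X j)^-1 * (X j)^-1 = X j.
  by move=> Bj; rewrite -invMg xx // invgK.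
have xy i j : i \in B -> j \in B -> i != j -> X i * X j = (X j)^-1 * (X i)^-1.
  by move=> Bi Bj ij; rewrite -invMg; apply/eqP; rewrite -mulg_eq1 -[_ * _]/(_ ^+ 2) X2.
have A'V i : i \in A' -> gen X A' (X i)^-1.
  by move=> A'i; apply: gen_V => //; apply: inB.
have mN i : i \in A' -> i != m by rewrite !inE => /andP[].
have Nm i : i \in A' -> m != i by rewrite eq_sym; apply: mN.
have swap i : i \in A' -> X m * (X i)^-1 = (X i)^-1 * (X m)^-1 * X i.
  by move=> A'i; rewrite -[X in _ * X = _]xx ?inB // mulgA (xy m i) ?Nm ?(inB i).
elim=> {h} [|h j Aj _ [l A'l]]; first by exists 1; [exact: gen1 | constructor 1].
have [-> | jm] := eqVneq j m.
  case=> [->|->|->|[i A'i ->]].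
  - by exists l => //; constructor 2.
  - by exists l => //; constructor 3; rewrite -mulgA xx.
  - by exists l => //; constructor 1; rewrite mulgVK.
  exists (l * (X i)^-1); first exact: gen_mul A'l (A'V _ A'i).
  constructor 4; exists i => //.
  by rewrite -!mulgA (xy i m) ?mN ?(inB i) // [X in l * X]mulgA vv // swap // !mulgA.
have A'j : j \in A' by rewrite !inE jm.
case=> [->|->|->|[i A'i ->]].
- by exists (l * X j); [apply: gen_mul A'l (gen_gen A'j) | constructor 1].
- exists (l * (X j)^-1); first exact: gen_mul A'l (A'V _ A'j).
  by constructor 3; rewrite -!mulgA (xy m j) ?Nm ?(inB j).
- by exists l => //; constructor 4; exists j.
have [-> | ij] := eqVneq i j.
  exists (l * X j); first by apply: gen_mul A'l (gen_gen A'j).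
  by constructor 2; rewrite -!mulgA xx ?inB // (xy j m) ?mN ?(inB j).
exists (l * X j * (X i)^-1); first exact: gen_mul (gen_mul A'l (gen_gen A'j)) (A'V _ A'i).
constructor 4; exists i => //.
rewrite -!mulgA (xy i j) ?inB // [X in l * X]mulgA -(xy j m) ?mN ?(inB j) //.
by rewrite -!mulgA swap // !mulgA.
Qed.

End Gen.

Section Hom.
Variables (T : finType) (u v : T).
Hypothesis uv : u != v.
Implicit Types (s t : {perm T}) (A : {set T}).

Lemma cycle3_rels (B : {set T}) : u \notin B -> v \notin B ->
  {in B, forall i, cycle3 u v i ^+ 3 = 1} /\
  {in B &, forall i j, i != j -> (cycle3 u v i * cycle3 u v j) ^+ 2 = 1}.
Proof.
move=> uB vB; have neqB i : i \in B -> (i != u) * (i != v).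
  by move=> Bi; split; apply: contraTneq Bi => ->.
split=> [i Bi | i j Bi Bj ij]; first by rewrite cycle3_cube ?(neqB i).
by rewrite cycle3_mul_sq ?(neqB i) ?(neqB j).
Qed.

(** Induction on the size of A, with [alt_on_step] removing one point. For A empty, the
    transposition of u and v is odd, so only the identity is left. *)
Lemma alt_on_gen A s : u \notin A -> v \notin A ->
  s \in alt_on ([set u; v] :|: A) -> gen (cycle3 u v) A s.
Proof.
elim: {A}#|A| {-2}A (erefl #|A|) s => [|k IHk] A cardA s uA vA s_on.
  have A0 : A = set0 by apply/eqP; rewrite -cards_eq0 cardA.
  suff -> : s = 1 by apply: gen1.
  move: s_on; rewrite alt_onE A0 setU0 => /andP[s_on s_even].
  have suv y : y != u -> y != v -> s y = y.
    by move=> yu yv; apply: (out_perm s_on); rewrite !inE negb_or yu.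
  have: s u \in [set u; v] by rewrite (perm_closed _ s_on) !inE eqxx.
  have: s v \in [set u; v] by rewrite (perm_closed _ s_on) !inE eqxx orbT.
  rewrite !inE => /orP[]/eqP sv /orP[]/eqP su.
  - by case/eqP: uv; apply: (@perm_inj _ s); rewrite su.
  - case/negP: s_even; suff -> : s = tperm u v by rewrite odd_tperm.
    apply/permP=> y; case: tpermP => [->|->|/eqP yu /eqP yv] //; exact: suv.
  - apply/permP=> y; rewrite perm1; have [->//|yu] := eqVneq y u.
    by have [->//|yv] := eqVneq y v; apply: suv.
  - by case/eqP: uv; apply: (@perm_inj _ s); rewrite sv.
have [cycle3_3 cycle3_2] := cycle3_rels uA vA.
have [m Am] : exists m, m \in A by apply/set0Pn; rewrite -cards_eq0 cardA.
have A'A : A :\ m \subset A by apply: subsetDl.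
have [u' v'] : u \notin A :\ m /\ v \notin A :\ m.
  by split; apply: contra (subsetP A'A _) _.
have: exists t, [/\ t \in alt_on ([set u; v] :|: A :\ m) &
    [\/ s = t, s = t * cycle3 u v m, s = t * (cycle3 u v m)^-1 |
        exists2 i, i \in A :\ m & s = t * (cycle3 u v m)^-1 * cycle3 u v i]].
  apply: alt_on_step; rewrite ?setD11 //.
    by rewrite !inE negb_or; apply/andP; split; apply: contraTneq Am => ->.
  by rewrite setUCA setD1K.
case=> t [t_on t_s]; have {t_on} t_g : gen (cycle3 u v) (A :\ m) t.
  by apply: IHk => //; move: cardA; rewrite (cardsD1 m) Am; case.
have {}t_g := gen_sub A'A t_g; have m_g := gen_V cycle3_3 Am Am.
case: t_s => [->|->|->|[i A'i ->]] //; first exact: genM.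
  exact: gen_mul.
by apply: genM (gen_mul _ _); rewrite // (subsetP A'A).
Qed.

Lemma gen_alt_on A s : u \notin A -> v \notin A -> gen (cycle3 u v) A s ->
  s \in alt_on ([set u; v] :|: A).
Proof.
move=> uA vA; elim=> {s} [|s i Ai _ IH]; first exact: group1.
rewrite groupM // cycle3_on ?inE ?eqxx ?orbT // ?Ai ?orbT //.
  by apply: contraTneq Ai => ->.
by apply: contraTneq Ai => ->.
Qed.

Lemma alt_on_ind A (P : {perm T} -> Prop) : u \notin A -> v \notin A ->
  P 1 -> (forall s i, s \in alt_on ([set u; v] :|: A) -> i \in A -> P s ->
          P (s * cycle3 u v i)) ->
  {in alt_on ([set u; v] :|: A), forall s, P s}.
Proof.
move=> uA vA P1 PM s /(alt_on_gen uA vA).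
by elim=> {s} // s i Ai s_g Ps; apply: PM; rewrite // gen_alt_on.
Qed.

Section Functional.
Variables (G : groupType) (x : T -> G) (B : {set T}).
Hypotheses (uB : u \notin B) (vB : v \notin B).
Hypothesis x3 : {in B, forall i, x i ^+ 3 = 1}.
Hypothesis x2 : {in B &, forall i j, i != j -> (x i * x j) ^+ 2 = 1}.

(** The homomorphism is found through its graph: the pairs (3-cycle, prescribed value) generate a
    subgroup of the product, to be shown the graph of a function. *)
Let X i : ({perm T} * G)%type := (cycle3 u v i, x i).

Let X3 : {in B, forall i, X i ^+ 3 = 1}.
Proof.
move=> i Bi; have [c33 _] := cycle3_rels uB vB.
by congr (_, _); [apply: c33 | apply: x3].
Qed.

Let X2 : {in B &, forall i j, i != j -> (X i * X j) ^+ 2 = 1}.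
Proof.
move=> i j Bi Bj ij; have [_ c32] := cycle3_rels uB vB.
by congr (_, _); [apply: c32 | apply: x2].
Qed.

Lemma gen_fst A h : gen X A h -> gen (cycle3 u v) A h.1.
Proof. by elim=> {h} [|h i Ai _ IH]; [apply: gen1 | apply: genM]. Qed.

Lemma gen_inj A g : A \subset B -> gen X A (1, g) -> g = 1.
Proof.
elim: {A}#|A| {-2}A (erefl #|A|) g => [|k IHk] A cardA g sAB.
  have A0 : A = set0 by apply/eqP; rewrite -cards_eq0 cardA.
  move Eh: (1, g) => h h_g; case: h_g Eh => [[] // | h' i].
  by rewrite A0 inE.
have [m Am] : exists m, m \in A by apply/set0Pn; rewrite -cards_eq0 cardA.
have Bm := subsetP sAB _ Am.
have A'A : A :\ m \subset A by apply: subsetDl.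
have [mu mv] : m != u /\ m != v by split; apply: contraTneq Bm => ->.
have neqA i : i \in A -> (i != u) * (i != v).
  by move=> /(subsetP sAB) Bi; split; apply: contraTneq Bi => ->.
case/(gen_coset X3 X2 Am sAB) => -[t l] tl_g.
have tm : t m = m.
  have: t \in alt_on ([set u; v] :|: A :\ m).
    by apply: gen_alt_on (gen_fst tl_g); apply: contra (subsetP (subset_trans A'A sAB) _) _.
  rewrite alt_onE => /andP[t_on _]; apply: (out_perm t_on).
  by rewrite !inE eqxx (negPf mu) (negPf mv).
have cm1 := cycle3_1 uv mu; have cmV : (cycle3 u v m)^-1 m = v.
  by rewrite cycle3V cycle3_1 // eq_sym.
have absurd s : 1 = s -> s m = m by move<-; rewrite perm1.
case=> [[Et El] | [/absurd] | [/absurd] | [i A'i [/absurd]]].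
- apply: (IHk (A :\ m)); last by rewrite Et El.
    by move: cardA; rewrite (cardsD1 m) Am; case.
  exact: subset_trans sAB.
- by rewrite permM tm cm1 => um; rewrite um eqxx in mu.
- by rewrite permM tm cmV => um; rewrite um eqxx in mv.
- have [iu iv] := neqA i (subsetP A'A _ A'i).
  by rewrite permM permM tm cmV cycle3_3 // => im; move: A'i; rewrite im !inE eqxx.
Qed.

(** The generated pairs project onto the alternating group by [alt_on_gen], and [gen_inj] makes the
    second component a function of the first. *)
Lemma carmichael : exists f : {perm T} -> G,
  {in alt_on ([set u; v] :|: B) &, {morph f : s t / s * t}} /\
  {in B, forall i, f (cycle3 u v i) = x i}.
Proof.
have f_ex s : s \in alt_on ([set u; v] :|: B) -> exists g, gen X B (s, g).
  move/(alt_on_gen uB vB); elim=> {s} [|s i Bi _ [g IH]]; first by exists 1; apply: gen1.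
  by exists (g * x i); apply: (@genM _ _ _ _ (s, g)).
pose f s := if pselect (exists g, gen X B (s, g)) is left ex then projT1 (cid ex) else 1.
have f_gen s : s \in alt_on ([set u; v] :|: B) -> gen X B (s, f s).
  by move/f_ex; rewrite /f; case: pselect => // ex _; case: (cid ex).
have gV h : gen X B h -> gen X B h^-1.
  elim=> {h} [|h i Bi _ IH]; first by rewrite invg1; apply: gen1.
  by rewrite invMg; exact: gen_mul (gen_V X3 Bi Bi) IH.
have f_uniq s g : gen X B (s, g) -> f s = g.
  move=> s_g; have := f_gen s (gen_alt_on uB vB (gen_fst s_g)).
  move=> s_f; apply: divg1_eq; apply: (@gen_inj B) => //.
  have -> : (1, f s * g^-1) = (s, f s) * (s, g)^-1 by congr (_, _); rewrite mulgV.
  exact: gen_mul s_f (gV _ s_g).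
exists f; split=> [s t s_on t_on | i Bi]; last by apply/f_uniq/gen_gen.
by apply/f_uniq/(@gen_mul _ _ _ _ (s, f s) (t, f t)); apply: f_gen.
Qed.

End Functional.
End Hom.

(** * Homomorphisms defined on a subgroup of a finite group *)

Section PartialMorphism.
Variables (gT : finGroupType) (G : groupType) (D : {group gT}) (f : gT -> G).
Hypothesis fM : {in D &, {morph f : s t / s * t}}.

Lemma pmorph1 : f 1 = 1.
Proof. by apply: (mulgI (f 1)); rewrite -fM ?group1 // !mulg1. Qed.

Lemma pmorphV : {in D, {morph f : s / s^-1}}.
Proof.
by move=> s Ds; apply: (mulgI (f s)); rewrite -fM ?groupV // !mulgV pmorph1.
Qed.

Lemma pmorphX n : {in D, {morph f : s / s ^+ n}}.
Proof.
move=> s Ds; elim: n => [|n IHn]; first exact: pmorph1.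
by rewrite !expgS fM ?groupX // IHn.
Qed.

Lemma pmorphJ : {in D &, {morph f : s t / s ^ t}}.
Proof. by move=> s t Ds Dt; rewrite !conjgE !fM ?groupM ?groupV // pmorphV. Qed.

Lemma group_expgz s m : s \in D -> expgz s m \in D.
Proof. by case: m => m Ds; rewrite /= ?groupV groupX. Qed.

Lemma eval_in X (rho : X -> gT) e :
  (forall i, rho i \in D) -> eval rho e \in D.
Proof.
move=> Dr; elim: e => [i||u Du v Dv|u Du m] /=.
- exact: Dr.
- exact: group1.
- exact: groupM.
- exact: group_expgz.
Qed.

Lemma pmorph_eval X (rho : X -> gT) e :
  (forall i, rho i \in D) -> f (eval rho e) = eval (f \o rho) e.
Proof.
move=> Dr; elim: e => [i||u IHu v IHv|u IHu m] //=; first exact: pmorph1.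
  by rewrite fM ?eval_in // IHu IHv.
rewrite -IHu; have Du := eval_in u Dr.
by case: m => m; rewrite /= ?pmorphV ?groupX // pmorphX.
Qed.

End PartialMorphism.

Lemma eq_alt_on_morph (T : finType) (u v : T) (A : {set T}) (G : groupType)
    (f1 f2 : {perm T} -> G) : u != v -> u \notin A -> v \notin A ->
  {in alt_on ([set u; v] :|: A) &, {morph f1 : s t / s * t}} ->
  {in alt_on ([set u; v] :|: A) &, {morph f2 : s t / s * t}} ->
  {in A, forall i, f1 (cycle3 u v i) = f2 (cycle3 u v i)} ->
  {in alt_on ([set u; v] :|: A), f1 =1 f2}.
Proof.
move=> uv uA vA f1M f2M f12; apply: (@alt_on_ind _ u v) => //.
  by rewrite (pmorph1 f1M) (pmorph1 f2M).
move=> s i s_on Ai Es; have ci : cycle3 u v i \in alt_on ([set u; v] :|: A).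
  by apply: gen_alt_on => //; apply: gen_gen.
by rewrite f1M // f2M // Es f12.
Qed.

Local Open Scope ring_scope.

(** * Squares modulo p *)

Section PrimeField.
Variable p : nat.
Hypotheses (p_pr : prime p) (p11 : p = 11 %[mod 12]).
Local Notation m := (p.-1./2).

Lemma half_p : [/\ p = (2 * m + 1)%N, odd m & (m %% 6 = 5)%N].
Proof. by move: p11; split; lia. Qed.

Lemma expg_unit_half (u : {unit 'F_p}) : u \in Fp_squares p -> (u ^+ m = 1)%g.
Proof.
case/imsetP=> v _ ->; rewrite -expgM; have [pE _ _] := half_p.
have -> : (2 * m = #|[set: {unit 'F_p}]|)%N.
  by rewrite card_finField_unit card_Fp //; lia.
by rewrite expg_cardG ?inE.
Qed.

(** Euler's criterion: t^m is 1 or -1. As m is odd, t^(m+1) is the square of t^((m+1)/2), and it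
    equals t or -t accordingly. *)
Lemma squareVN (t : {unit 'F_p}) : t \in Fp_squares p \/
  exists2 u, u \in Fp_squares p & val u = - val t.
Proof.
have [pE m_odd _] := half_p.
have sq v : v \in [set (u ^+ 2)%g | u in [set: {unit 'F_p}]] -> v \in Fp_squares p by [].
have tm : (val t ^+ m) ^+ 2 = 1.
  rewrite -exprM mulnC; apply: (mulfI (x := val t)).
    by rewrite -unitfE (valP t).
  rewrite mulr1 -exprS -[RHS]expf_card card_Fp //; congr (_ ^+ _); lia.
have t2 : ((t ^+ m.+1./2) ^+ 2 = t ^+ m.+1)%g.
  by rewrite -expgM; congr (_ ^+ _)%g; lia.
have valX (v : {unit 'F_p}) j : val (v ^+ j)%g = val v ^+ j.
  by elim: j => // j IHj; rewrite expgS exprS -IHj.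
move/eqP: tm; rewrite sqrf_eq1 => /orP[] /eqP tm; [left|right].
  apply: sq; apply/imsetP; exists (t ^+ m.+1./2)%g; rewrite ?inE // t2.
  by apply: val_inj; rewrite valX exprS tm mulr1.
exists (t ^+ m.+1)%g; last by rewrite valX exprS tm mulrN1.
by apply: sq; apply/imsetP; exists (t ^+ m.+1./2)%g; rewrite ?inE // t2.
Qed.

Lemma Fp_nat_eq0 (x : nat) : ((x%:R : 'F_p) == 0) = (p %| x)%N.
Proof. by rewrite -(dvdn_pcharf (pchar_Fp p_pr)). Qed.

Lemma Fp_int_eq0 (x : int) : ((x%:~R : 'F_p) == 0) = (p %| x)%Z.
Proof.
rewrite dvdzE /= -Fp_nat_eq0; case: x => // x.
by rewrite NegzE mulrNz oppr_eq0.
Qed.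

Lemma Fp_int_eq (x y : int) : (x%:~R = y%:~R :> 'F_p) <-> (x = y %[mod p])%Z.
Proof.
split=> [/eqP | /eqP].
  by rewrite -subr_eq0 -rmorphB Fp_int_eq0 -eqz_mod_dvd => /eqP.
by rewrite eqz_mod_dvd -Fp_int_eq0 rmorphB subr_eq0 => /eqP.
Qed.

Lemma Fp_valK (x : 'F_p) : (val x)%:~R = x :> 'F_p.
Proof. exact: natr_Zp. Qed.

Lemma Fp_val_lt (x : 'F_p) : (val x < p)%N.
Proof. by have := ltn_ord x; rewrite [X in (_ < X)%N -> _]Fp_cast. Qed.

Lemma Fp_val_int (x : int) : 0 <= x < p%:Z -> (val (x%:~R : 'F_p))%:Z = x.
Proof.
case: x => x //= xp; rewrite val_Fp_nat // modn_small //; lia.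
Qed.

Lemma neg1_square (u : {unit 'F_p}) : u \in Fp_squares p -> val u <> -1.
Proof.
move=> u_sq u1; have := expg_unit_half u_sq => /(congr1 val).
have [pE m_odd _] := half_p.
have -> : val (u ^+ m)%g = val u ^+ m.
  by elim: (m) => // j IHj; rewrite expgS exprS -IHj.
rewrite u1 -signr_odd m_odd expr1 /= => /eqP; rewrite eq_sym -subr_eq0 opprK.
by rewrite -[1 + 1]/(2%:R) Fp_nat_eq0 => /dvdn_leq; lia.
Qed.

Section Generator.
Variable r : {unit 'F_p}.
Hypothesis gen_r : Fp_squares p = <[r]>%g.

Lemma cycle_sq i : (r ^+ i)%g \in Fp_squares p.
Proof. by rewrite gen_r mem_cycle. Qed.

Lemma r_half : (r ^+ m = 1)%g.
Proof. by apply: expg_unit_half; rewrite gen_r cycle_id. Qed.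

(** The powers of r are the squares, and they cover all 2m units together with their negatives; so
    there are at least m of them. *)
Lemma order_r : #[r]%g = m.
Proof.
have [pE m_odd _] := half_p.
apply/eqP; rewrite eqn_dvd order_dvdn r_half eqxx /=.
suff le_m : (m <= #[r]%g)%N.
  have : (#[r]%g %| m)%N by rewrite order_dvdn r_half.
  by move/dvdn_leq => le_r; have -> : #[r]%g = m by apply/eqP; rewrite eqn_leq le_m le_r //; lia.
have neg_unit (u : {unit 'F_p}) : - val u \is a GRing.unit by rewrite unitrN (valP u).
pose N u : {unit 'F_p} := FinRing.unit 'F_p (neg_unit u).
have : [set: {unit 'F_p}] \subset <[r]>%g :|: (N @: <[r]>%g).
  apply/subsetP=> t _; rewrite inE -gen_r; apply/orP.
  case: (squareVN t) => [|[u u_sq ut]]; [by left | right].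
  by apply/imsetP; exists u => //; apply: val_inj; rewrite /= ut opprK.
move/subset_leq_card; rewrite card_finField_unit card_Fp //.
move/leq_trans/(_ (leq_card_setU _ _)) => le_p.
have := leq_imset_card N <[r]>%g; rewrite -orderE; move: le_p; rewrite -orderE.
move: (#|_|) => w; lia.
Qed.

Lemma exists_cube_root : exists2 alpha, alpha \in Fp_squares p & (alpha ^+ 3)%g = r.
Proof.
(* As m is 2 modulo 3, three times this exponent is m + 1, and r^m = 1. *)
exists (r ^+ (m %/ 3).+1)%g; first exact: cycle_sq.
rewrite -expgM; have [_ _ m6] := half_p.
have -> : ((m %/ 3).+1 * 3 = m + 1)%N by lia.
by rewrite expgD r_half mul1g.
Qed.

Lemma valX_unit (u : {unit 'F_p}) j : val (u ^+ j)%g = val u ^+ j.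
Proof. by elim: j => // j IHj; rewrite expgS exprS -IHj. Qed.

Lemma unit_pow (t : 'F_p) : t != 0 ->
  (exists i, t = val r ^+ i) \/ (exists i, t = - val r ^+ i).
Proof.
rewrite -unitfE => t_unit.
case: (squareVN (FinRing.unit 'F_p t_unit)) => [|[u]].
  by rewrite gen_r => /cycleP[i Ei]; left; exists i; rewrite -valX_unit -Ei.
rewrite gen_r => /cycleP[i ->] /=; rewrite valX_unit => Ei.
by right; exists i; rewrite Ei opprK.
Qed.

Lemma r_neq1 : val r != 1.
Proof.
apply/eqP=> r1; have r1' : r = 1%g by apply: val_inj.
by have := order_r; rewrite r1' order1; have [] := half_p; lia.
Qed.

Lemma r_gt1 : (1 < val (val r))%N.
Proof.
have p_gt1 : (1 < p)%N by apply: prime_gt1.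
have r0 : val r != 0 by rewrite -unitfE (valP r).
have v0 : (val (val r) != 0)%N by apply: contraNneq r0 => r0; apply/eqP/val_inj.
have v1 : (val (val r) != 1)%N.
  apply: contraNneq r_neq1 => r1; apply/eqP/val_inj; rewrite r1.
  apply/eqP; rewrite -eqz_nat -[1 : 'F_p]/(1%:~R) Fp_val_int //; lia.
by move: (val (val r)) v0 v1; lia.
Qed.

End Generator.
End PrimeField.

(** * The subgroup generated by a and g *)

Section AffineRelations.
Variables (p : nat) (r : {unit 'F_p}) (s : int) (G : groupType) (a g : G).
Local Notation m := (p.-1./2).
Local Notation b := (g ^+ 3)%g.
Local Notation z := (g ^+ m)%g.
Hypothesis p_pr : prime p.
Hypothesis p11 : p = 11 %[mod 12].
Hypothesis gen_r : Fp_squares p = <[r]>%g.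
Hypothesis sr : s%:~R * (val r - 1) = -1 :> 'F_p.
Hypothesis rel_ab : (a ^+ p = b ^+ m)%g.
Hypothesis rel_s : (expgz a s ^ b = expgz a (s - 1)%R)%g.
Hypothesis rel_z : ((z * z ^ a) ^+ 2 = 1)%g.

(* a^p is central, so raising rel_s to the power p gives a^(ps) = a^(ps - p). *)
Lemma affine_ap : (a ^+ p = 1)%g.
Proof.
have cab : (a ^+ p ^ b = a ^+ p)%g.
  by apply: commute_conj; rewrite rel_ab; apply/commute_sym/commuteX.
have: (expgz (a ^+ p) s = expgz (a ^+ p) (s - 1)%R)%g.
  have E t : expgz (a ^+ p)%g t = (expgz a t ^+ p)%g.
    by rewrite -[(a ^+ p)%g]/(expgz a p) -expgzM mulrC expgzM.
  by rewrite [RHS]E -rel_s -conjXg -E expgzJ cab.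
rewrite expgzB1 -{1}[expgz _ s]mulg1 => /mulgI/(congr1 (fun t : G => t^-1)%g).
by rewrite invgK invg1 => <-.
Qed.

Lemma affine_bm : (b ^+ m = 1)%g.
Proof. by rewrite -rel_ab affine_ap. Qed.

(** Once a^p = 1, exponents of a can be taken in the field, where conjugation by b becomes
    multiplication by r. *)
Definition apow (x : 'F_p) : G := (a ^+ (val x : nat))%g.

Lemma apow_expgz (i : int) : expgz a i = apow i%:~R.
Proof.
rewrite /apow -[(a ^+ _)%g]/(expgz a (val (i%:~R : 'F_p))).
by apply: (eq_expgz_mod affine_ap); apply/(Fp_int_eq p_pr); rewrite Fp_valK.
Qed.

Lemma apowD x y : apow (x + y) = (apow x * apow y)%g.
Proof.
by rewrite -[x]Fp_valK -[y]Fp_valK -rmorphD -!apow_expgz expgzD.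
Qed.

Lemma apowX x j : (apow x ^+ j)%g = apow (x *+ j).
Proof.
elim: j => [|j IHj]; last by rewrite expgSr mulrSr apowD IHj.
by rewrite expg0 mulr0n /apow.
Qed.

Lemma apow1 : apow 1 = a.
Proof. by rewrite -[1 : 'F_p]/(1%:~R) -apow_expgz. Qed.

(** The choice of s means s r = s - 1, so [rel_s] is the case x = s. Every x is a multiple of s
    because s is nonzero. *)
Lemma apow_conj x : (apow x ^ b)%g = apow (x * val r).
Proof.
have s_unit : (s%:~R : 'F_p) != 0.
  apply/eqP=> s0; move/eqP: sr; rewrite s0 mul0r eq_sym oppr_eq0.
  by rewrite oner_eq0.
have conj_s : (apow s%:~R ^ b)%g = apow (s%:~R * val r).
  rewrite -!apow_expgz rel_s apow_expgz; congr apow.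
  by rewrite rmorphB /= -sr mulrBr mulr1 addrC subrK.
pose y := x / s%:~R; have -> : x = s%:~R *+ (val y : nat).
  by rewrite -mulr_natr natr_Zp mulrC divfK.
rewrite -apowX conjXg conj_s apowX; congr apow.
by rewrite mulrnAl.
Qed.

Lemma affine_z3 : (z ^+ 3 = 1)%g.
Proof. by rewrite -expgM mulnC expgM affine_bm. Qed.

Lemma affine_zb : commute z b.
Proof. exact: commuteX2. Qed.

(** The element of G that plays the 3-cycle (x, p+1, p+2), where the residue 0 stands for the point
    p. *)
Definition zshift (x : 'F_p) : G := (z ^ apow x)%g.

Lemma zshift0 : zshift 0 = z.
Proof. by rewrite /zshift /apow conjg1. Qed.

Lemma zshiftJ x y : (zshift x ^ apow y)%g = zshift (x + y).
Proof. by rewrite /zshift -conjgM -apowD. Qed.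

Lemma zshift_conj x : (zshift x ^ b)%g = zshift (x * val r).
Proof.
by rewrite /zshift conjJg apow_conj (commute_conj affine_zb).
Qed.

Lemma zshift3 x : (zshift x ^+ 3 = 1)%g.
Proof. by rewrite -conjXg affine_z3 conj1g. Qed.

Lemma sqg_rot (x y : G) : ((x * y) ^+ 2 = 1)%g -> ((y * x) ^+ 2 = 1)%g.
Proof.
have -> : ((y * x) ^+ 2 = ((x * y) ^+ 2) ^ x)%g.
  by rewrite !expg2 conjgE !mulgA mulVg mul1g.
by move=> ->; rewrite conj1g.
Qed.

(* One of y - x and x - y is a square since -1 is not. *)
Lemma zshift2 x y : x != y -> ((zshift x * zshift y) ^+ 2 = 1)%g.
Proof.
have pow i w : ((zshift w * zshift (w + val r ^+ i)%R) ^+ 2 = 1)%g.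
  have -> : (zshift w * zshift (w + val r ^+ i)%R =
             (zshift 0 * zshift (val r ^+ i)%R) ^ apow w)%g.
    by rewrite conjMg !zshiftJ add0r (addrC _ w).
  rewrite -conjXg; have -> : ((zshift 0 * zshift (val r ^+ i)%R) ^+ 2 = 1)%g.
    elim: i => [|i IHi].
      rewrite expr0 zshift0 /zshift apow1; exact: rel_z.
    have -> : (zshift 0 * zshift (val r ^+ i.+1)%R =
               (zshift 0 * zshift (val r ^+ i)%R) ^ b)%g.
      by rewrite conjMg !zshift_conj mul0r exprSr.
    by rewrite -conjXg IHi conj1g.
  by rewrite conj1g.
move=> xy; have nz : y - x != 0 by rewrite subr_eq0 eq_sym.
case: (unit_pow p_pr p11 gen_r nz) => [] [i Ei].
  by rewrite -[y](subrK x) addrC Ei pow.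
apply: sqg_rot; have -> : x = y + val r ^+ i by rewrite -[val r ^+ i]opprK -Ei opprB addrC subrK.
exact: pow.
Qed.

End AffineRelations.

(** * Permutations of integer points *)

Section Cycles.
Variables n p : nat.
Local Notation point := (point n p).
Local Notation points := (points n p).
Local Notation cyc := (cyc n p).
Implicit Types (s t : {perm point}) (x y : int) (c : seq int).

(** Permutations are made to act on all integers, fixing those that are not points, so that
    equalities of permutations become case analyses for [lia]. *)
Definition ev t x : int := if insub x is Some y then val (t (y : point)) else x.

Lemma ev_val t (y : point) : ev t (val y) = val (t y).
Proof. by rewrite /ev valK. Qed.

Lemma ev_out t x : x \notin points -> ev t x = x.
Proof. by move=> Px; rewrite /ev insubN. Qed.

Lemma pointP x : x \in points -> exists y : point, x = val y.
Proof. by move=> Px; exists (SeqSub Px). Qed.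

Lemma ev_in t x : (ev t x \in points) = (x \in points).
Proof.
have [/pointP[y ->] | Px] := boolP (x \in points); last by rewrite ev_out ?(negPf Px).
by rewrite ev_val; apply: valP.
Qed.

Lemma ev_perm s t : {in points, ev s =1 ev t} -> s = t.
Proof.
move=> st; apply/permP=> y; apply: val_inj; rewrite -!ev_val.
exact: st (valP y).
Qed.

Lemma ev1 x : ev 1%g x = x.
Proof. by rewrite /ev; case: insubP => // y _ <-; rewrite perm1. Qed.

Lemma evM s t x : ev (s * t)%g x = ev t (ev s x).
Proof.
have [/pointP[y ->] | Px] := boolP (x \in points); last by rewrite !ev_out.
by rewrite !ev_val permM.
Qed.

Lemma evK t : cancel (ev t) (ev t^-1%g).
Proof. by move=> x; rewrite -evM mulgV ev1. Qed.

Lemma evKV t : cancel (ev t^-1%g) (ev t).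
Proof. by move=> x; rewrite -evM mulVg ev1. Qed.

Lemma evV t x y : ev t x = y -> ev t^-1%g y = x.
Proof. by move<-; rewrite evK. Qed.

Lemma ev_inj t : injective (ev t).
Proof. exact: can_inj (evK t). Qed.

Lemma evJ s t x : ev (s ^ t)%g (ev t x) = ev t (ev s x).
Proof. by rewrite -!evM [in RHS]conjgC. Qed.

Lemma evX_fix t x m : ev t x = x -> ev (t ^+ m)%g x = x.
Proof. by move=> tx; elim: m => [|m IHm]; rewrite ?ev1 // expgS evM tx. Qed.

(** Under this condition [cyc c] acts as [next c], instead of falling back on the default of
    [perm_by]. *)
Definition pcycle c : Prop := uniq c && all [in points] c.

Lemma pcycleE c : pcycle c = (uniq c && all [in points] c) :> Prop.
Proof. by []. Qed.

Lemma pcycle_sub c1 c2 : subseq c1 c2 -> pcycle c2 -> pcycle c1.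
Proof.
move=> c12 /andP[Uc sc]; rewrite /pcycle (subseq_uniq c12 Uc).
by apply/allP=> x /(mem_subseq c12)/(allP sc).
Qed.

Lemma ev_cyc c x : pcycle c -> ev (cyc c) x = next c x.
Proof.
case/andP=> Uc /allP sc; have [/pointP[y ->] | Px] := boolP (x \in points).
  by rewrite ev_val cycE.
by rewrite ev_out // next_nth (negPf (contra (sc x) Px)).
Qed.

Lemma cycJ c t : pcycle c -> (cyc c ^ t)%g = cyc (map (ev t) c).
Proof.
move=> pc; have tc : pcycle (map (ev t) c).
  case/andP: pc => Uc sc; rewrite /pcycle map_inj_uniq ?Uc; last exact: ev_inj.
  by rewrite all_map; apply: sub_all sc => x; rewrite /= ev_in.
apply: ev_perm => x _; rewrite -[x](evKV t) evJ !ev_cyc //.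
rewrite !next_nth mem_map; last exact: ev_inj.
case: ifP => // /[dup] cx; case: (c) => // z c' _ /=.
have := @index_map _ _ _ (@ev_inj t) (z :: c') (ev t^-1%g x); rewrite /= => ->.
set i := (if _ then _ else _); have [lt_i | le_i] := ltnP i (size c').
  by rewrite (nth_map z).
by rewrite !nth_default ?size_map.
Qed.

Lemma cyc_rot m c : pcycle c -> cyc (seq.rot m c) = cyc c.
Proof.
move=> pc; apply: ev_perm => x _; rewrite !ev_cyc //; last first.
  by move: pc; rewrite /pcycle rot_uniq => /andP[-> sc]; rewrite (eq_all_r (mem_rot m c)).
by rewrite next_rot //; case/andP: pc.
Qed.

Lemma cyc_catC c1 c2 : pcycle (c1 ++ c2) -> cyc (c1 ++ c2) = cyc (c2 ++ c1).
Proof. by move=> pc; rewrite -(cyc_rot (size c1) pc) rot_size_cat. Qed.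

Lemma pcycle_catC c1 c2 : pcycle (c1 ++ c2) = pcycle (c2 ++ c1).
Proof. by rewrite /pcycle uniq_catC !all_cat [all _ c1 && _]andbC. Qed.

Lemma ev_cyc_mid c1 x y c2 : pcycle (c1 ++ x :: y :: c2) ->
  ev (cyc (c1 ++ x :: y :: c2)) x = y.
Proof.
by move=> pc; rewrite cyc_catC // ev_cyc /= ?eqxx // -!cat_cons pcycle_catC.
Qed.

Lemma ev_cyc_last c x y : pcycle (x :: c ++ [:: y]) ->
  ev (cyc (x :: c ++ [:: y])) y = x.
Proof.
rewrite -cat_cons => pc; rewrite cyc_catC // ev_cyc /= ?eqxx //.
by rewrite -cat1s pcycle_catC.
Qed.

Lemma ev_cyc_out c x : pcycle c -> x \notin c -> ev (cyc c) x = x.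
Proof. by move=> pc xc; rewrite ev_cyc // next_nth (negPf xc). Qed.

Lemma cyc1 x : cyc [:: x] = 1%g.
Proof.
have [Px | Px] := boolP (x \in points).
  apply: ev_perm => y _; rewrite ev1 ev_cyc /pcycle /= ?Px //.
  by case: eqP => [->|].
apply: ev_perm => y Py; rewrite ev1 /cyc; have [z ->] := pointP Py.
rewrite ev_val perm_byE /= => [|w|v w _ _]; first by case: eqP => // ->.
  by case: eqP => // ->.
by case: eqP => [->|_]; case: eqP => [->|_].
Qed.

Lemma cyc_rcons x c y : pcycle (x :: rcons c y) ->
  cyc (x :: rcons c y) = (cyc (x :: c) * cyc [:: x; y])%g.
Proof.
move=> pcy; move: (pcy); rewrite {1}/pcycle /= all_rcons rcons_uniq mem_rcons inE negb_or.
case/andP=> /andP[/andP[xy xc] /andP[yc Uc]] /and3P[Px Py sc].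
have pc : pcycle (x :: c) by rewrite /pcycle /= xc Uc Px.
have pxy : pcycle [:: x; y] by rewrite /pcycle /= inE xy Px Py.
apply: ev_perm => z _; rewrite evM !ev_cyc //.
have nxy w : next [:: x; y] w = if w == x then y else if w == y then x else w.
  by [].
rewrite nxy !next_nth -rcons_cons mem_rcons inE.
have [-> | zy] /= := eqVneq z y.
  rewrite inE (negPf yc) (eq_sym y x) (negPf xy) /= eq_sym (negPf xy) eqxx.
  rewrite -cats1 index_cat (negPf yc) /= eqxx addn0 nth_default //.
  by rewrite size_cat addn1.
case: ifP => [zc | /negbT]; last first.
  by rewrite inE negb_or => /andP[/negPf-> _]; rewrite (negPf zy).
rewrite -[rcons c y]cats1.
have -> : (if x == z then 0%N else (index z (c ++ [:: y])).+1) = index z (x :: c).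
  rewrite /=; case: eqP zc => // /eqP xz; rewrite inE eq_sym (negPf xz) index_cat.
  by move=> /= ->.
rewrite -[(if x == z then _ else _)]/(index z (x :: c)).
have : (index z (x :: c) <= size c)%N by rewrite -ltnS -[(size c).+1]/(size (x :: c)) index_mem.
rewrite leq_eqVlt => /predU1P[-> | lt_i].
  by rewrite nth_cat ltnn subnn /= nth_default // eqxx.
rewrite nth_cat lt_i; have := mem_nth x lt_i.
move: (nth x c _) => w cw; case: eqP cw xc => [-> -> //|_ cw _].
by case: eqP cw yc => [-> ->|].
Qed.

(** The main rule for multiplying or splitting cycles that share one point; [cyc_rot] and [cyc_catC]
    first bring that point to the front. *)
Lemma cyc_cat x c1 c2 : pcycle (x :: c1 ++ c2) ->
  cyc (x :: c1 ++ c2) = (cyc (x :: c1) * cyc (x :: c2))%g.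
Proof.
elim/last_ind: c2 => [|c2 y IHc]; first by rewrite cats0 cyc1 mulg1.
rewrite -rcons_cat => pc; rewrite cyc_rcons // IHc ?cyc_rcons ?mulgA //.
  by apply: pcycle_sub pc; rewrite /= eqxx rcons_cat; apply: suffix_subseq.
by apply: pcycle_sub pc; rewrite /= eqxx -cats1; apply: prefix_subseq.
Qed.

Lemma cycV c : pcycle c -> (cyc c)^-1%g = cyc (rev c).
Proof.
move=> pc; have rc : pcycle (rev c) by move: pc; rewrite /pcycle rev_uniq all_rev.
have [Uc _] := andP pc; apply: ev_perm => x _; apply: evV.
by rewrite !ev_cyc // next_rev // next_prev.
Qed.

Lemma pcycle_map (C : seq point) : pcycle (map val C) = uniq C.
Proof.
rewrite /pcycle map_inj_uniq; last exact: val_inj.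
by rewrite andb_idr // => _; apply/allP=> _ /mapP[w _ ->]; apply: valP.
Qed.

Lemma cyc2_tperm (y z : point) : y != z -> cyc [:: val y; val z] = tperm y z.
Proof.
move=> yz; have Vyz : val y != val z by rewrite (inj_eq val_inj).
apply: ev_perm => x /pointP[w ->]; rewrite ev_cyc; last first.
  by rewrite -[[:: _; _]]/(map val [:: y; z]) pcycle_map /= inE yz.
rewrite ev_val /=; case: tpermP => [-> | -> | /eqP wy /eqP wz].
- by rewrite eqxx.
- by rewrite eq_sym (negPf Vyz) eqxx.
- by rewrite ![val w == _](inj_eq val_inj) (negPf wy) (negPf wz).
Qed.

(** The bridge from integer cycles to transpositions, from which parity ([odd_cyc]) and the
    comparison with [cycle3] follow. *)
Lemma cyc_tperms (y : point) (c : seq point) : uniq (y :: c) ->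
  cyc (val y :: map val c) = (\prod_(z <- c) tperm y z)%g.
Proof.
elim/last_ind: c => [|c z IHc]; first by rewrite big_nil cyc1.
rewrite -rcons_cons map_rcons => Uyz.
have pc : pcycle (val y :: rcons (map val c) (val z)).
  by rewrite -map_rcons -map_cons pcycle_map.
move: Uyz; rewrite /= mem_rcons inE negb_or rcons_uniq.
case/andP=> /andP[yz yc] /andP[zc Uc].
rewrite cyc_rcons // IHc /= ?yc // cyc2_tperm //.
by rewrite -cats1 big_cat big_seq1.
Qed.

Lemma pcycle_points c : pcycle c -> exists2 C : seq point, uniq C & c = map val C.
Proof.
case/andP=> Uc sc; exists (pmap insub c); first exact: pmap_sub_uniq.
by rewrite -[LHS]map_id; elim: c sc {Uc} => //= x c IHc /andP[Px /IHc ->]; rewrite insubT.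
Qed.

Lemma odd_cyc c : pcycle c -> odd_perm (cyc c) = ~~ odd (size c) && (c != [::]).
Proof.
case/pcycle_points=> -[|y C] UC ->.
  by rewrite /= (_ : cyc [::] = 1%g) ?odd_perm1 //; apply: ev_perm => x _; rewrite ev_cyc ?ev1.
rewrite andbT /= cyc_tperms //= negbK size_map; case/andP: UC => yC _.
elim: C yC => [|z C IHC] /=; first by rewrite big_nil odd_perm1.
rewrite inE negb_or big_cons odd_mul_tperm => /andP[-> /IHC ->].
by [].
Qed.

Lemma cyc3_cycle3 (u v i : point) : u != v -> i != u -> i != v ->
  cyc [:: val i; val u; val v] = cycle3 u v i.
Proof.
move=> uv iu iv; rewrite cycle3.unlock -[[:: val u; val v]]/(map val [:: u; v]).
by rewrite cyc_tperms /= ?inE ?negb_or ?iu ?iv ?uv // big_cons big_seq1.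
Qed.

End Cycles.

(** * Integer intervals *)

Section Irange.
Implicit Types i j x : int.

Lemma irange_cat m i j : i <= m + 1 -> m <= j ->
  irange i j = irange i m ++ irange (m + 1) j.
Proof.
move=> im mj; rewrite /irange.
set a := (if i <= m then _ else _); set b := (if m + 1 <= j then _ else _).
have -> : (if i <= j then (absz (j - i)).+1 else 0%N) = (a + b)%N.
  by rewrite /a /b; case: ifP; case: ifP; case: ifP; lia.
have a_def : m + 1 = i + a%:Z by rewrite /a; case: ifP; lia.
rewrite iotaD map_cat add0n; congr (_ ++ _).
rewrite -[X in iota X]addn0 iotaDl -map_comp; apply: eq_map => x /=.
by rewrite PoszD a_def addrA.
Qed.

Lemma irange_nil i j : j < i -> irange i j = [::].
Proof. by move=> ji; rewrite /irange leNgt ji. Qed.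

Lemma irange1 i : irange i i = [:: i].
Proof. by rewrite /irange lexx subrr /= addr0. Qed.

Lemma irange_cons i j : i <= j -> irange i j = i :: irange (i + 1) j.
Proof. by move=> ij; rewrite (@irange_cat i) ?irange1 //; lia. Qed.

Lemma irange_rcons i j : i <= j -> irange i j = irange i (j - 1) ++ [:: j].
Proof. by move=> ij; rewrite (@irange_cat (j - 1)) ?subrK ?irange1 //; lia. Qed.

Lemma irange2 (i : int) : irange i (i + 1) = [:: i; i + 1].
Proof. by rewrite irange_cons ?irange1 //; lia. Qed.

Lemma irange3 (i : int) : irange i (i + 2) = [:: i; i + 1; i + 2].
Proof.
rewrite irange_cons; last lia.
have i2 : i + 2 = i + 1 + 1 by lia.
by rewrite i2 irange2.
Qed.

Lemma irange_uniq i j : uniq (irange i j).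
Proof. by rewrite map_inj_uniq ?iota_uniq // => x y /addrI[]. Qed.

Lemma size_irange i j : i <= j -> size (irange i j) = (absz (j - i)).+1.
Proof. by move=> ij; rewrite size_map size_iota ij. Qed.

End Irange.

(** * Subgroups on which two homomorphisms agree *)

Section Equalizer.
Variables (gT : finGroupType) (G : groupType) (D : {group gT}) (f1 f2 : gT -> G).
Hypothesis f1M : {in D &, {morph f1 : s t / (s * t)%g}}.
Hypothesis f2M : {in D &, {morph f2 : s t / (s * t)%g}}.

Fact equalizer_group_set : group_set [set t in D | f1 t == f2 t].
Proof.
apply/group_setP; split; first by rewrite inE group1 (pmorph1 f1M) (pmorph1 f2M) eqxx.
move=> t1 t2; rewrite !inE => /andP[D1 /eqP E1] /andP[D2 /eqP E2].
by rewrite groupM //= f1M // f2M // E1 E2.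
Qed.

(** With f1 the conjugate of f2 by some w, this is the group of elements whose image commutes with
    w. A commutation is then proved by generating the element from others known to commute. *)
Definition equalizer : {group gT} := Group equalizer_group_set.

Lemma equalizerP t : reflect (t \in D /\ f1 t = f2 t) (t \in equalizer).
Proof. by rewrite inE; apply: (iffP andP) => -[Dt /eqP]. Qed.

End Equalizer.

Section ConjMorphism.
Variables (gT : finGroupType) (G : groupType) (D : {group gT}) (f : gT -> G).
Hypothesis fM : {in D &, {morph f : s t / (s * t)%g}}.

Lemma conj_morph w : {in D &, {morph (fun t => (f t ^ w)%g) : s t / (s * t)%g}}.
Proof. by move=> t1 t2 D1 D2; rewrite /= fM // conjMg. Qed.

Lemma pmorph_commute t1 t2 : t1 \in D -> t2 \in D -> commute t1 t2 ->
  commute (f t1) (f t2).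
Proof. by move=> D1 D2 c12; rewrite /commute -!fM // c12. Qed.

End ConjMorphism.

Lemma commute_fix (G : groupType) (x w : G) : (x ^ w = x)%g <-> commute x w.
Proof.
split=> [xw | /commute_conj //]; apply/commgP.
by rewrite -conjg_fix xw eqxx.
Qed.

Lemma sqg_commute3 (G : groupType) (x w t : G) : (x ^+ 2 = 1)%g -> (w ^+ 2 = 1)%g ->
  (t ^+ 2 = 1)%g -> commute x w -> commute x t -> commute w t ->
  ((x * w * t) ^+ 2 = 1)%g.
Proof.
move=> x2 w2 t2 xw xt wt; rewrite expgMn; last first.
  by apply/commute_sym/commuteM; apply: commute_sym.
by rewrite expgMn // x2 w2 t2 !mulg1.
Qed.
(** * Words in which y occurs only through conjugation *)

Fixpoint yfree (e : expr 'I_3) : bool :=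
  match e with
  | Gen i => (i != 2 :> nat)%N
  | One => true
  | Mul u v => yfree u && yfree v
  | Pow u _ => yfree u
  end.

Lemma yfree_eval (G : groupType) (rho1 rho2 : 'I_3 -> G) e :
  (forall i : 'I_3, (i != 2 :> nat)%N -> rho1 i = rho2 i) -> yfree e ->
  eval rho1 e = eval rho2 e.
Proof.
move=> rho12; elim: e => [i | | u IHu v IHv | u IHu j] //=; first exact: rho12.
  by case/andP=> Yu Yv; rewrite IHu // IHv.
by move=> Yu; rewrite IHu.
Qed.

Lemma yfree_wcij p i j : yfree (wcij p i j).
Proof. by rewrite /wcij; do !case: ifP. Qed.
Definition y_conjugates : 'I_4 -> expr 'I_3 :=
  fun i => nth One [:: wa; wg; Conj wa wy; Conj wg wy] i.

(* e lies in the subgroup of the free group generated by a, g, a^y, g^y. *)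
Definition in_y_conjugates (e : expr 'I_3) : Prop :=
  exists v : expr 'I_4, forall (G : groupType) (rho : 'I_3 -> G),
    eval rho e = eval (fun i => eval rho (y_conjugates i)) v.

Lemma in_y_conjugates_yfree e : yfree e -> in_y_conjugates e.
Proof.
move=> Ye; pose l (i : 'I_3) : expr 'I_4 :=
  Gen (if i == 0 :> nat then Ordinal (isT : 0 < 4)%N else Ordinal (isT : 1 < 4)%N).
exists (esubst l e) => G rho; rewrite eval_esubst; apply: yfree_eval Ye.
by case=> [[|[|[|i]]] i_lt] //= _; congr rho; apply: val_inj.
Qed.

Lemma in_y_conjugates_Jy e : yfree e -> in_y_conjugates (Conj e wy).
Proof.
move=> Ye; pose l (i : 'I_3) : expr 'I_4 :=
  Gen (if i == 0 :> nat then Ordinal (isT : 2 < 4)%N else Ordinal (isT : 3 < 4)%N).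
exists (esubst l e) => G rho; rewrite evalJ eval_esubst.
have -> : (eval rho e ^ eval rho wy)%g = eval (fun i => (rho i ^ eval rho wy)%g) e.
  elim: e {Ye} => [i||u IHu v IHv|u IHu j] //=; first exact: conj1g.
    by rewrite conjMg IHu IHv.
  by rewrite expgzJ IHu.
apply: yfree_eval Ye; case=> [[|[|[|i]]] i_lt] //= _; rewrite conjgE mulgA;
  by congr (_ * rho _ * _)%g; apply: val_inj.
Qed.

Lemma in_y_conjugatesM u v :
  in_y_conjugates u -> in_y_conjugates v -> in_y_conjugates (Mul u v).
Proof. by case=> u' Eu [v' Ev]; exists (Mul u' v') => G rho /=; rewrite Eu Ev. Qed.

Lemma in_y_conjugatesX u j : in_y_conjugates u -> in_y_conjugates (Pow u j).
Proof. by case=> u' Eu; exists (Pow u' j) => G rho /=; rewrite Eu. Qed.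

Lemma in_y_conjugatesJ u v :
  in_y_conjugates u -> in_y_conjugates v -> in_y_conjugates (Conj u v).
Proof. by case=> u' Eu [v' Ev]; exists (Conj u' v') => G rho; rewrite !evalJ Eu Ev. Qed.

(** Splitting a conjugator that contains y isolates the conjugation by y itself, which then acts on
    a word free of y. *)
Lemma in_y_conjugatesJM u v w :
  in_y_conjugates (Conj (Conj u v) w) -> in_y_conjugates (Conj u (Mul v w)).
Proof.
by case=> e Ee; exists e => G rho; rewrite -Ee !evalJ /= conjgM.
Qed.

Lemma in_y_conjugates_xt n p : in_y_conjugates (wxtilde n p).
Proof.
apply: in_y_conjugatesJ; first exact: in_y_conjugates_yfree.
by apply: in_y_conjugatesM; apply: in_y_conjugates_Jy.
Qed.

Lemma in_y_conjugates_u p : in_y_conjugates (wu p).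
Proof.
apply: in_y_conjugatesM; first exact: in_y_conjugates_yfree.
exact: in_y_conjugates_Jy.
Qed.

Lemma in_y_conjugates_w n p : in_y_conjugates (ww n p).
Proof.
have [xtw uw] := (in_y_conjugates_xt n p, in_y_conjugates_u p).
have zJ u : yfree u -> in_y_conjugates (Conj (wz p) (Mul wy u)).
  move=> Yu; apply/in_y_conjugatesJM/in_y_conjugatesJ; first exact: in_y_conjugates_Jy.
  exact: in_y_conjugates_yfree.
rewrite /ww; case: ifP => _; first by apply: in_y_conjugatesM; apply: zJ.
case: ifP => _.
  apply: in_y_conjugatesM; last exact: in_y_conjugatesX.
  apply: (in_y_conjugatesM _ xtw); apply: in_y_conjugatesX.
  by apply: (in_y_conjugatesM xtw); apply: in_y_conjugatesX.
apply: in_y_conjugatesM; last exact: in_y_conjugatesX.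
apply: (in_y_conjugatesM _ xtw); apply: in_y_conjugatesM; last first.
  by apply: in_y_conjugatesX; apply: (in_y_conjugatesM xtw); apply: in_y_conjugatesX.
apply: in_y_conjugatesM.
  do 3 (apply/in_y_conjugatesJM/in_y_conjugatesJ; last exact: in_y_conjugates_yfree).
  by apply/in_y_conjugatesJM/in_y_conjugates_Jy.
do 2 (apply/in_y_conjugatesJM/in_y_conjugatesJ; last exact: in_y_conjugates_yfree).
exact: in_y_conjugates_Jy.
Qed.

Lemma w_word n p : exists v : expr 'I_4,
  word_eq [::] (expand (ww n p)) (expand (esubst y_conjugates v)).
Proof.
have [v Ev] := in_y_conjugates_w n p; exists v; apply: word_eq_free => G rho.
by rewrite !weval_expand eval_esubst.
Qed.

(** * Bit length *)

Section Length.
Variables (X : Type) (N : nat).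

(** An exponent counts once whatever its value, so this size is bounded independently of n and p for
    the words of the presentation. The digits are controlled separately through [exponents_le]. *)
Fixpoint esize (e : expr X) : nat :=
  match e with
  | Gen _ | One => 1
  | Mul u v => esize u + esize v
  | Pow u _ => (esize u).+1
  end.

Fixpoint exponents_le (e : expr X) : bool :=
  match e with
  | Gen _ | One => true
  | Mul u v => exponents_le u && exponents_le v
  | Pow u j => (absz j <= N)%N && exponents_le u
  end.

Lemma symbol_length_le e : exponents_le e ->
  (symbol_length e <= esize e * (trunc_log 2 N + 4))%N.
Proof.
elim: e => [x||u IHu v IHv|u IHu j] /=; try by rewrite mul1n addn4.
  by case/andP=> /IHu Lu /IHv Lv; rewrite mulnDl leq_add.
case/andP=> jN /IHu Lu; rewrite mulSn -addnA addnC leq_add //.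
have := @leq_trunc_log 2 _ _ jN; case: (_ < _); lia.
Qed.

End Length.

Section WordLengths.
Variables (n p : nat) (s : int).
Hypothesis n15 : (15 <= n)%N.
Hypothesis kn : (kpar n p + n = 2 * p + 4)%N.
Hypothesis kp : (kpar n p <= p)%N.
Hypothesis pn : (p + 4 <= n)%N.
Hypothesis sp : (absz s <= p)%N.
Local Notation small := (exponents_le (2 * n)).

Let small_one : (1 <= 2 * n)%N. Proof. by lia. Qed.

Lemma smallJ (u v : expr 'I_3) : small u -> small v -> small (Conj u v).
Proof. by move=> su sv /=; rewrite su sv small_one. Qed.

Lemma smallM (u v : expr 'I_3) : small u -> small v -> small (Mul u v).
Proof. by move=> su sv /=; rewrite su. Qed.

Lemma smallX (u : expr 'I_3) j : small u -> (absz j <= 2 * n)%N -> small (Pow u j).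
Proof. by move=> su sj /=; rewrite sj. Qed.

Lemma small_z : small (wz p).
Proof. by apply: smallX => //=; lia. Qed.

Lemma small_zi i : (absz i <= 2 * n)%N -> small (wzi p i).
Proof. by move=> si; apply: smallJ; [apply: small_z | apply: smallX]. Qed.

Lemma small_dij i j : (absz i <= 2 * n)%N -> (absz j <= 2 * n)%N -> small (wdij p i j).
Proof.
move=> si sj; apply: smallM; last exact: small_zi.
by apply: smallM; [apply: small_zi | apply: smallX; first apply: small_zi].
Qed.

Lemma small_cij (i j : int) : 1 <= i <= p%:Z -> i <= j <= p%:Z + 2 -> small (wcij p i j).
Proof.
move=> i_in j_in; have cb (l : int) : i - 2 <= l <= p%:Z + 2 -> small (wcbase p i l).
  move=> l_in; apply: smallM; last by apply: smallX => //; lia.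
  apply: smallM; first by apply: smallX => //; lia.
  by apply: smallX; [apply: smallM => //; apply: small_dij; lia | lia].
have za : small (Mul (wz p) wa) by apply: smallM => //; apply: small_z.
rewrite /wcij; do !case: ifP => ?; first by apply: cb; lia.
- apply: smallM; last by apply: cb; lia.
  by apply: smallJ; [apply: small_z | apply: smallX => //; lia].
- apply: smallM; last by apply: cb; lia.
  by apply: smallJ; [apply: small_z | apply: smallX => //; lia].
apply: smallM; first exact: small_z.
apply: smallM; last by apply: cb; lia.
by apply: smallJ; [apply: small_z | apply: smallX => //; lia].
Qed.

Lemma esize_cij i j : (esize (wcij p i j) <= 100)%N.
Proof. by rewrite /wcij; do !case: ifP. Qed.

Hypothesis k6 : (6 <= kpar n p)%N.

Lemma small_atilde : small (watilde p).
Proof.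
by apply: smallJ; [|apply: smallM]; apply: small_zi; lia.
Qed.

Lemma small_h : small (wh p).
Proof.
apply: smallX; last by lia.
apply: smallM; last by apply: small_zi; lia.
apply: smallM; last by apply: small_zi; lia.
by do 2 (apply: smallX; last by lia).
Qed.

Lemma small_c : small (wc n p).
Proof. by rewrite /wc; case: ifP => _; apply: small_cij; lia. Qed.

Lemma small_e : small (we n p).
Proof.
have za : small (Mul (wz p) wa) by apply: smallM => //; apply: small_z.
by rewrite /we; case: ifP => _; apply: smallM => //; apply: smallX => //; apply: small_cij; lia.
Qed.

Lemma small_w : small (ww n p).
Proof.
have za : small (Mul (wz p) wa) by apply: smallM => //; apply: small_z.
have zJ u : small u -> small (Conj (wz p) u) by apply: smallJ; apply: small_z.
have dd i j : (absz i <= 2 * n)%N -> (absz j <= 2 * n)%N -> small (wdij p i j).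
  exact: small_dij.
have xt : small (wxtilde n p).
  apply: smallJ; first by apply: smallM; apply: dd; lia.
  by apply: smallM; apply: smallJ => //; apply: dd; lia.
have u : small (wu p) by apply: smallM => //; apply: smallJ.
have xu : small (Mul (wxtilde n p) (Pow (wu p) (- 2))).
  by apply: smallM => //; apply: smallX => //; lia.
rewrite /ww; case: eqP => kE.
  apply: smallM; apply: zJ; apply: smallM => //; last exact: small_z.
  by apply: smallX => //; apply: small_z.
case: ifP => n_odd.
  apply: smallM; last by apply: smallX => //; lia.
  by apply: smallM => //; apply: smallX => //; lia.
apply: smallM; last by apply: smallX => //; lia.
apply: smallM => //; apply: smallM; last by apply: smallX => //; lia.
have aV : small (Pow wa (- 1)) by apply: smallX.
have zX j : (absz j <= 2 * n)%N -> small (Pow (wz p) j).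
  by move=> sj; apply: smallX => //; apply: small_z.
apply: smallM; apply: smallJ.
- by apply: dd; lia.
- by repeat (apply: smallM => //); apply: zX; lia.
- by apply: smallX => //; apply: small_zi; lia.
by repeat (apply: smallM => //); apply: zX; lia.
Qed.

Lemma esize_w : (esize (ww n p) <= 1000)%N.
Proof. by rewrite /ww; do !case: ifP. Qed.

(** Each side of each relation has [esize] at most 1000 and exponents at most 2n, hence length at
    most 1000 B. Since n is at least 15, B is at most three times the logarithm of n. *)
Lemma bit_length_le : (bit_length (Jbar n p s) <= 50 * 1000 * trunc_log 2 n)%N.
Proof.
set B := (trunc_log 2 (2 * n) + 4)%N.
have log_n : (3 <= trunc_log 2 n)%N by apply: (@leq_trans (trunc_log 2 15)); last exact: leq_trunc_log.
have B_le : (B <= 3 * trunc_log 2 n)%N by rewrite /B mul2n trunc_log2_double; lia.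
have sl c (e : expr 'I_3) : small e -> (esize e <= c)%N -> (symbol_length e <= c * B)%N.
  by move=> se ec; apply: leq_trans (symbol_length_le se) _; rewrite leq_mul2r ec orbT.
have len (u v : expr 'I_3) : small u -> small v -> (esize u <= 1000)%N -> (esize v <= 1000)%N ->
    (symbol_length u + symbol_length v + 1 <= 2000 * B + 1)%N.
  by move=> su sv eu ev; rewrite leq_add2r -[2000%N]/(1000 + 1000)%N mulnDl leq_add // sl.
have aX j : (absz j <= 2 * n)%N -> small (Pow wa j) by apply: smallX.
have sb : small wb by apply: smallX => //; lia.
have r1 := len (Pow wa p%:Z) (Pow wb (p.-1./2)%:Z) (aX p%:Z ltac:(lia))
  (smallX (j := (p.-1./2)%:Z) sb ltac:(lia)) isT isT.
have r2 := len (Conj (Pow wa s) wb) (Pow wa (s - 1))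
  (smallJ (aX s ltac:(lia)) sb) (aX (s - 1) ltac:(lia)) isT isT.
have r3 := len (Pow (Mul (wz p) (Conj (wz p) wa)) 2) One
  (smallX (j := 2) (smallM small_z (smallJ (v := wa) small_z isT)) ltac:(lia))
  isT isT isT.
have r4 := len (watilde p) (Conj (Mul (watilde p) (wh p)) wy) small_atilde
  (smallJ (v := wy) (smallM small_atilde small_h) isT) isT isT.
have ec : (esize (wc n p) <= 100)%N by rewrite /wc; case: ifP => _; apply: esize_cij.
have r5 := len (wc n p) (Conj (wc n p) wy) small_c (smallJ (v := wy) small_c isT)
  ltac:(lia) ltac:(move: (wc n p) ec => e /=; lia).
have ee : (esize (we n p) <= 200)%N.
  by rewrite /we; case: ifP => _; [have := esize_cij 2 (kpar n p + 1) |
    have := esize_cij 3 (kpar n p + 1)]; move: (wcij _ _ _) => e /=; lia.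
have sd : small (wd p) by apply: small_cij; lia.
have sde : small (Comm (wd p) (Conj (we n p) wy)).
  have sy : small (Conj (we n p) wy) by apply: smallJ; first exact: small_e.
  by apply: smallM; apply: smallM => //; apply: smallX.
have r6 := len (Comm (wd p) (Conj (we n p) wy)) One sde isT
  ltac:(have := esize_cij 5 (p%:Z + 2); rewrite -[wcij _ _ _]/(wd p);
    move: (wd p) (we n p) ee => e1 e2 /=; lia) isT.
have r7 := len wy (ww n p) isT small_w isT esize_w.
pose b := (2000 * B + 1)%N.
(* Three generators and seven relations, each of length at most b; the final 0 is the empty sum left
   by [big_nil]. *)
apply: (@leq_trans (3 + (b + (b + (b + (b + (b + (b + (b + 0))))))))%N); last by rewrite /b; lia.
rewrite /bit_length leq_add2l; cbn [rels Jbar]; rewrite !big_cons big_nil.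
exact: (leq_add r1 (leq_add r2 (leq_add r3 (leq_add r4 (leq_add r5 (leq_add r6 (leq_add r7 (leqnn 0)))))))).
Qed.

End WordLengths.

(** * The words evaluated in the alternating group *)

Section Images.
Variables n p : nat.
Local Notation k := (kpar n p).
Local Notation K := (k%:Z).
Local Notation q := (p%:Z).
Local Notation m := (p.-1./2).
Local Notation point := (point n p).
Local Notation points := (points n p).
Local Notation cyc := (cyc n p).
Local Notation pcycle := (pcycle n p).
Hypothesis kn : (k + n = 2 * p + 4)%N.
Hypothesis k6 : (6 <= k)%N.
Hypothesis kp : (k <= p)%N.
Hypothesis p_pr : prime p.
Hypothesis p11 : p = 11 %[mod 12].

Let p_ge11 : (11 <= p)%N.
Proof. by move: p11; lia. Qed.

Lemma mem_points (x : int) :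
  (x \in points) = (K - q - 1 <= x <= q + 2).
Proof. by rewrite mem_irange; congr (_ && _); lia. Qed.

Lemma pcycle_irange (i j : int) :
  K - q - 1 <= i -> j <= q + 2 -> pcycle (irange i j).
Proof.
move=> i_ge j_le; rewrite pcycleE irange_uniq; apply/allP=> x.
by rewrite mem_irange => xij; rewrite [_ \in _]mem_points; lia.
Qed.

Lemma ev_irange (i j x : int) :
  K - q - 1 <= i -> i <= j -> j <= q + 2 ->
  ev (cyc (irange i j)) x =
    if i <= x < j then x + 1 else if x == j then i else x.
Proof.
move=> i_ge ij j_le; have pc := pcycle_irange i_ge j_le.
case: ifP => [xij | Nxij].
  have split_ij : irange i j = irange i (x - 1) ++ x :: (x + 1) :: irange (x + 1 + 1) j.
    rewrite (@irange_cat (x - 1)) ?subrK; try lia.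
    by rewrite (@irange_cons x) ?(@irange_cons (x + 1)) //; lia.
  by rewrite split_ij ev_cyc_mid -?split_ij.
case: eqP => [-> | xj].
  have [ij' | ij'] := eqVneq i j; first by rewrite ij' irange1 cyc1 ev1.
  have split_ij : irange i j = i :: irange (i + 1) (j - 1) ++ [:: j].
    by rewrite irange_cons // irange_rcons //; lia.
  by rewrite split_ij ev_cyc_last -?split_ij.
by rewrite ev_cyc_out // mem_irange; lia.
Qed.

Lemma pcycle2 (a b : int) : K - q - 1 <= a <= q + 2 -> K - q - 1 <= b <= q + 2 ->
  a != b -> pcycle [:: a; b].
Proof. by move=> Pa Pb ab; rewrite /pcycle /= inE ab !mem_points // Pa Pb. Qed.

Lemma pcycle3 (a b c : int) : K - q - 1 <= a <= q + 2 ->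
  K - q - 1 <= b <= q + 2 -> K - q - 1 <= c <= q + 2 ->
  a != b -> a != c -> b != c -> pcycle [:: a; b; c].
Proof.
move=> Pa Pb Pc ab ac bc; rewrite /pcycle /= !inE negb_or ab ac bc.
by rewrite !mem_points // Pa Pb Pc.
Qed.

Lemma ev_cyc2 (a b x : int) : pcycle [:: a; b] ->
  ev (cyc [:: a; b]) x = if x == a then b else if x == b then a else x.
Proof. by move=> pc; rewrite ev_cyc. Qed.

Lemma ev_cyc3 (a b c x : int) : pcycle [:: a; b; c] ->
  ev (cyc [:: a; b; c]) x =
    if x == a then b else if x == b then c else if x == c then a else x.
Proof. by move=> pc; rewrite ev_cyc. Qed.

(** The transposition that corrects parity: it accompanies each odd permutation of 1, ..., p among
    the values of the words. *)
Definition swap_end : {perm point} := cyc [:: q + 1; q + 2].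
Local Notation T := swap_end.

Lemma pcycle_end : pcycle [:: q + 1; q + 2].
Proof. by apply: pcycle2; lia. Qed.

Lemma swap_end2 : (T * T = 1)%g.
Proof.
apply: ev_perm => x _; rewrite ev1 evM !(ev_cyc2 _ pcycle_end).
by case: (x =P q + 1) => [->|?]; do !case: eqP; lia.
Qed.

(** * Multiplication of the points 1, ..., p-1 by units *)

Section MulPerm.
Implicit Types beta gamma : {unit 'F_p}.

Lemma ev_mulperm beta (x : int) : ev (mulperm n beta) x =
  if 1 <= x <= q - 1 then (val (val beta * x%:~R : 'F_p))%:Z else x.
Proof.
have [/pointP[y ->] | Px] := boolP (x \in points).
  by rewrite ev_val mulpermE //; lia.
by rewrite ev_out //; move: Px; rewrite mem_points //; case: ifP; lia.
Qed.

Lemma unit_mul_range beta (x : int) : 1 <= x <= q - 1 ->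
  1 <= (val (val beta * x%:~R : 'F_p))%:Z <= q - 1.
Proof.
move=> x_in; have nz_x : (x%:~R : 'F_p) != 0.
  by rewrite Fp_int_eq0 // dvdzE; apply/negP=> /dvdn_leq; lia.
have: val beta * x%:~R != 0 by rewrite mulf_neq0 // -unitfE (valP beta).
have := Fp_val_lt p_pr (val beta * x%:~R).
by rewrite -val_eqE /=; lia.
Qed.

Lemma mulpermM beta gamma :
  mulperm n (beta * gamma)%g = (mulperm n beta * mulperm n gamma)%g.
Proof.
apply: ev_perm => x _; rewrite evM !ev_mulperm.
case x_in: (1 <= x <= q - 1); last by rewrite x_in.
rewrite unit_mul_range // Fp_valK // -[val (beta * gamma)%g]/(val beta * val gamma).
by congr (Posz (val _)); rewrite mulrA [val gamma * _]mulrC.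
Qed.

Lemma mulperm1 : mulperm n (1%g : {unit 'F_p}) = 1%g.
Proof.
apply: ev_perm => x _; rewrite ev1 ev_mulperm; case: ifP => // x_in.
by rewrite -[val (1%g : {unit 'F_p})]/(1 : 'F_p) mul1r Fp_val_int //; lia.
Qed.

Lemma mulpermX beta j : mulperm n (beta ^+ j)%g = (mulperm n beta ^+ j)%g.
Proof. by elim: j => [|j IHj]; rewrite ?mulperm1 // !expgS mulpermM IHj. Qed.

Lemma mulperm_even beta : beta \in Fp_squares p -> ~~ odd_perm (mulperm n beta).
Proof.
by case/imsetP=> u _ ->; rewrite mulpermX odd_permM addbb.
Qed.

End MulPerm.

Variables r alpha : {unit 'F_p}.
Hypothesis gen_r : Fp_squares p = <[r]>%g.
Hypothesis alpha_sq : alpha \in Fp_squares p.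
Hypothesis alpha3 : (alpha ^+ 3)%g = r.

Definition sigma_env (i : 'I_3) : {perm point} :=
  nth 1%g [:: sigma_a n p; sigma_g n alpha; sigma_y n p] i.
Local Notation sa := (sigma_a n p).
Local Notation sg := (sigma_g n alpha).
Local Notation sy := (sigma_y n p).
Local Notation E := (eval sigma_env).

Definition sigma_z : {perm point} := cyc [:: q; q + 1; q + 2].
Local Notation sz := sigma_z.

Lemma pcycle_z (i : int) : 1 <= i <= q -> pcycle [:: i; q + 1; q + 2].
Proof. by move=> i_in; apply: pcycle3; lia. Qed.

Let z' : {perm point} := cyc [:: q + 2; q + 1; q].

Let mul_z' : commute (mulperm n alpha) z'.
Proof.
have pz' : pcycle [:: q + 2; q + 1; q] by apply: pcycle3; lia.
apply/commute_sym/commgP; rewrite -conjg_fix /z' cycJ //=.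
by rewrite !ev_mulperm !ifF //; lia.
Qed.

Let z'V : z'^-1%g = sz.
Proof. by rewrite cycV //; apply: pcycle3; lia. Qed.

Let z'3 : (z' ^+ 3 = 1)%g.
Proof.
apply: ev_perm => x _; rewrite ev1 expgS expg2 !evM.
rewrite !(@ev_cyc3 (q + 2)); try by apply: pcycle3; lia.
case: (x =P q + 2) => [->|x1]; first by do !case: eqP; lia.
case: (x =P q + 1) => [->|x2]; first by do !case: eqP; lia.
case: (x =P q) => [->|x3]; first by do !case: eqP; lia.
by do !case: eqP; lia.
Qed.

(** The two factors of g commute, and cubing kills the 3-cycle. *)
Lemma eval_b : E wb = mulperm n r.
Proof.
rewrite /= -[sigma_env _]/sg /sigma_g expgMn // z'3 mulg1.
by rewrite -mulpermX alpha3.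
Qed.

(** The exponent m kills multiplication by the square alpha; being 2 modulo 3, it inverts the
    3-cycle (p+2, p+1, p). *)
Lemma eval_z : E (wz p) = sz.
Proof.
have [_ _ m6] := half_p p_pr p11; have Em : m = (m %/ 3 * 3 + 2)%N by lia.
rewrite /= -[sigma_env _]/sg /sigma_g expgMn // -mulpermX.
rewrite (expg_unit_half p_pr p11 alpha_sq) mulperm1 mul1g {1}Em.
rewrite expgD mulnC expgM z'3 expg1n mul1g -z'V.
by apply: (mulgI z'); rewrite mulgV -expgS z'3.
Qed.

Lemma ev_a (x : int) : ev sa x = if 1 <= x < q then x + 1 else if x == q then 1 else x.
Proof. by rewrite ev_irange //; lia. Qed.

Lemma ev_aX (i : int) : 1 <= i <= q -> ev (expgz sa i) q = i.
Proof.
case: i => // i; elim: i => [|i IHi] //= i_in.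
rewrite expgSr evM; have [-> | i0] := eqVneq i 0%N.
  by rewrite ev1 ev_a; do !case: ifP; lia.
rewrite [ev (_ ^+ i) q](IHi _) ?ev_a; last lia.
by case: ifP; lia.
Qed.

Lemma expgz_a_fix (i x : int) : q < x -> ev (expgz sa i) x = x.
Proof.
move=> qx; have ax : ev sa x = x by rewrite ev_a; do !case: ifP; lia.
case: i => i /=; first exact: evX_fix.
by rewrite -expVgn; apply/evX_fix/evV.
Qed.

Lemma eval_zi (i : int) : 1 <= i <= q -> E (wzi p i) = cyc [:: i; q + 1; q + 2].
Proof.
move=> i_in; rewrite evalJ eval_z [E _]/(expgz sa i) cycJ /=; last by apply: pcycle_z; lia.
by rewrite ev_aX // !expgz_a_fix //; lia.
Qed.

Lemma sigma_aX : (sa ^+ p = 1)%g.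
Proof.
apply: ev_perm => x _; rewrite ev1; have [x_in | x_out] := boolP (1 <= x <= q); last first.
  by apply: evX_fix; rewrite ev_a; do !case: ifP; lia.
rewrite -[in LHS](ev_aX x_in) -[expgz sa x]/(expgz sa x).
have aq : ev (sa ^+ p)%g q = q by apply: (ev_aX (i := q)); lia.
rewrite -evM (_ : commute _ _) ?evM ?aq ?ev_aX //.
by apply: commuteX; apply/commute_sym/commute_expgz.
Qed.

Lemma eq_wzi (i j : int) : (i = j %[mod q])%Z -> E (wzi p i) = E (wzi p j).
Proof.
move=> ij; rewrite !evalJ [E (Pow wa i)]/(expgz sa i) [E (Pow wa j)]/(expgz sa j).
by congr (_ ^ _)%g; apply: eq_expgz_mod sigma_aX ij.
Qed.

Lemma eval_dE (i j : int) :
  E (wdij p i j) = (E (wzi p i) * (E (wzi p j))^-1 * E (wzi p i))%g.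
Proof. by []. Qed.

Lemma eval_d (i j : int) : 1 <= i <= q -> 1 <= j <= q -> i != j ->
  E (wdij p i j) = (cyc [:: i; j] * T)%g.
Proof.
move=> i_in j_in ij; rewrite eval_dE !eval_zi // /T /swap_end.
have pc : pcycle [:: i; j; q + 1; q + 2].
  by rewrite pcycleE /= !inE !negb_or ij !mem_points //; lia.
have [C UC EC] := pcycle_points pc.
case: C UC EC => [|ci [|cj [|u [|v [|? ?]]]]] //= UC [-> -> -> ->].
move: UC; rewrite !inE !negb_or.
case/and4P=> /and3P[ij' iu iv] /andP[ju jv] uv _.
by rewrite !cyc3_cycle3 // !cyc2_tperm // cycle3_dij.
Qed.

Let pcyc_irange (i j : int) : K - q - 1 <= i -> j <= q + 2 -> pcycle (irange i j).
Proof. exact: pcycle_irange. Qed.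

Lemma cyc_irange_step (i j l : int) : K - q - 1 <= i -> i <= j -> j <= l -> l <= q + 2 ->
  (cyc (irange j l) * cyc (irange i j))%g = cyc (irange i l).
Proof.
move=> i_ge ij jl l_le.
have El : irange i l = irange i (j - 1) ++ irange j l.
  by rewrite (@irange_cat (j - 1)) ?subrK //; lia.
have pl : pcycle (irange j l ++ irange i (j - 1)).
  by rewrite pcycle_catC -El; apply: pcycle_irange.
have Ej : irange j l = j :: irange (j + 1) l by rewrite irange_cons.
have pj : pcycle (irange i (j - 1) ++ [:: j]).
  by rewrite -irange_rcons //; apply: pcycle_irange; lia.
rewrite (irange_rcons ij) (cyc_catC pj) Ej -cyc_cat -?cat_cons -?Ej //.
by rewrite cyc_catC -?El.
Qed.

Let eq_cyc3 (a b c a' b' c' : int) : a = a' -> b = b' -> c = c' ->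
  cyc [:: a; b; c] = cyc [:: a'; b'; c'].
Proof. by move=> -> -> ->. Qed.

Lemma swap_endX a : (T ^+ a)%g = (if odd a then T else 1%g).
Proof.
have T2 : (T ^+ 2 = 1)%g by rewrite expg2 swap_end2.
by rewrite -{1}[a]odd_double_half -muln2 expgD mulnC expgM T2 expg1n mulg1; case: odd.
Qed.

Lemma eval_ziJ (i j : int) : (E (wzi p i) ^ expgz sa j)%g = E (wzi p (i + j)).
Proof. by rewrite !evalJ -conjgM -expgzD. Qed.

Lemma eval_dJ (i j l : int) : (E (wdij p i j) ^ expgz sa l)%g = E (wdij p (i + l) (j + l)).
Proof.
rewrite !eval_dE -!eval_ziJ.
by move: (E (wzi p i)) (E (wzi p j)) => zi zj; rewrite !conjMg conjVg.
Qed.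

Lemma eq_wdij (i i' j j' : int) : (i = i' %[mod q])%Z -> (j = j' %[mod q])%Z ->
  E (wdij p i j) = E (wdij p i' j').
Proof. by move=> ii' jj'; rewrite !eval_dE (eq_wzi ii') (eq_wzi jj'). Qed.

Lemma eval_x : E (wx p) = (cyc [:: 1; q]%R * T)%g.
Proof.
rewrite -[RHS](_ : cyc [:: q; 1%R] * T = _)%g; last first.
  by congr (_ * _)%g; rewrite (@cyc_catC _ _ [:: q] [:: 1%R]) //; apply: pcycle2; lia.
by rewrite -eval_d //; [apply: eq_wdij => //; rewrite modzz mod0z | lia | lia | lia].
Qed.

(** Induction on j - i. Since a^-j x a^j = d(j, j+1), passing from j to j + 1 multiplies c(i, j) on
    the left by d(j, j+1), which lengthens the cycle by one. *)
Lemma eval_cbase (i j : int) : 1 <= i -> i <= j -> j <= q ->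
  E (wcbase p i j) = (cyc (irange i j) * T ^+ absz (j - i)%R)%g.
Proof.
move=> i1 ij jq; have [d Ej] : exists d : nat, j = i + d%:Z by exists (absz (j - i)); lia.
have Ec (j' : int) : E (wcbase p i j') =
  (expgz sa (- j') * expgz (sa * E (wx p)) (j' - i) * expgz sa i)%g by [].
elim: d j Ej {ij} jq => [|d IHd] j -> jq.
  have e0 y : expgz y 0 = 1%g :> {perm point} by [].
  by rewrite Ec addr0 subrr irange1 cyc1 e0 mulg1 -expgzD addNr mul1g.
have [j' Ej'] : exists j', j' = i + d%:Z by exists (i + d%:Z).
have Ej1 : i + d.+1%:Z = j' + 1 by lia.
have IH := IHd j' Ej'; rewrite Ej1 in jq *; rewrite -(@cyc_irange_step i j'); try lia.
rewrite irange2 (_ : absz _ = (absz (j' - i)%R).+1); last lia.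
rewrite expgS mulgA -[X in (X * _)%g]mulgA -/T.
have cT : commute (cyc (irange i j')) T.
  apply/commute_sym/commgP; rewrite -conjg_fix [T]/swap_end cycJ /=; last exact: pcycle_end.
  by rewrite !ev_irange ?ifF //; lia.
rewrite cT mulgA -eval_d; try lia; rewrite -[RHS]mulgA -IH; last lia.
have -> : E (wdij p j' (j' + 1)) = (E (wx p) ^ expgz sa j')%g.
  by rewrite eval_dJ add0r addrC.
have Ed : j' + 1 - i = 1 + (j' - i) by lia.
have ax1 : expgz (sa * E (wx p))%g 1 = (sa * E (wx p))%g by [].
rewrite !Ec Ed opprD !expgzD ax1 (expgzN _ j') conjgE -[expgz sa (-1)]/(sa^-1)%g.
move: (E (wx p)) (expgz (sa * _) _)%g (expgz sa i) (expgz sa j') => x s t u.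
by rewrite !mulgA mulgVK mulgK.
Qed.

Lemma sigma_za : (sz * sa)%g = cyc (irange 1 (q + 2)).
Proof. by rewrite /sigma_z -irange3 cyc_irange_step //; lia. Qed.

Lemma ev_za (x : int) : ev (sz * sa)%g x =
  if 1 <= x < q + 2 then x + 1 else if x == q + 2 then 1 else x.
Proof. by rewrite sigma_za ev_irange //; lia. Qed.

Lemma ev_za_out (x : int) : x < 1 -> ev (sz * sa)%g x = x.
Proof.
move=> x_lt; rewrite sigma_za; apply: ev_cyc_out; first by apply: pcycle_irange; lia.
by rewrite mem_irange; lia.
Qed.

Lemma ev_zaV (x : int) : 2 <= x <= q + 2 -> ev (sz * sa)^-1%g x = x - 1.
Proof. by move=> x_in; apply: evV; rewrite ev_za ifT ?subrK //; lia. Qed.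

(** Beyond p - 1 a shorter cycle is extended by 3-cycles: z and its conjugates (p-1, p, p+1) and
    (p-2, p-1, p) by negative powers of za = (1, ..., p+2). *)
Lemma eval_c (i j : int) :
  [\/ 1 <= i <= j /\ j <= q - 1, 1 <= i <= q - 2 /\ j = q,
      1 <= i <= q - 1 /\ j = q + 1 | 1 <= i <= q - 2 /\ j = q + 2] ->
  E (wcij p i j) = (cyc (irange i j) * T ^+ absz (j - i)%R)%g.
Proof.
have zJ1 : (E (wz p) ^ (E (wz p * wa))^-1)%g = cyc (irange (q - 1) (q + 1)).
  have -> : q + 1 = q - 1 + 2 by lia.
  rewrite irange3 -[E (_ * _)]/(E (wz p) * sa)%g eval_z /sigma_z cycJ; last by apply: pcycle_z; lia.
  by rewrite /= -/sz !ev_zaV; [apply: eq_cyc3; lia | lia ..].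
have zJ2 : (E (wz p) ^ expgz (E (wz p * wa)) (- 2))%g = cyc (irange (q - 2) q).
  rewrite (_ : expgz _ _ = ((E (wz p * wa))^-1 * (E (wz p * wa))^-1)%g); last first.
    by rewrite -invMg.
  rewrite conjgM zJ1 cycJ; last by apply: pcycle_irange; lia.
  have Eq : q + 1 = q - 1 + 2 by lia.
  have Eq' : irange (q - 2) q = irange (q - 2) (q - 2 + 2) by rewrite subrK.
  rewrite Eq Eq' !irange3 -[E (_ * _)]/(E (wz p) * sa)%g eval_z /=.
  by rewrite !ev_zaV; [apply: eq_cyc3; lia | lia ..].
(* Each 3-cycle lengthens the cycle by two, so the parity of the exponent of [T] is unchanged. *)
have T2 a b (s : {perm point}) : odd a = odd b -> (s * T ^+ a)%g = (s * T ^+ b)%g.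
  by move=> ab; rewrite !swap_endX ab.
have cq i' : 1 <= i' <= q - 2 -> (cyc (irange (q - 2) q) * E (wcbase p i' (q - 2)))%g =
    (cyc (irange i' q) * T ^+ absz (q - i')%R)%g.
  move=> i_in; rewrite eval_cbase ?mulgA ?cyc_irange_step; try lia.
  by apply: T2; lia.
have EM u v : E (Mul u v) = (E u * E v)%g by [].
rewrite /wcij; case=> [[ij jq]|[i_in ->]|[i_in ->]|[i_in ->]].
- by rewrite jq eval_cbase //; lia.
- rewrite ifF ?eqxx; last lia.
  by rewrite EM evalJ [E (Pow _ _)]/(expgz (E (wz p * wa)) (- 2)) zJ2 cq.
- do 2!(rewrite ifF; last lia); rewrite eqxx.
  rewrite EM evalJ [E (Pow _ _)]/((E (wz p * wa))^-1)%g.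
  rewrite zJ1 eval_cbase ?mulgA ?cyc_irange_step; try lia.
  by apply: T2; lia.
- do 3!(rewrite ifF; last lia).
  rewrite 2!EM evalJ [E (Pow _ _)]/(expgz (E (wz p * wa)) (- 2)).
  rewrite zJ2 cq // eval_z /sigma_z -irange3 mulgA cyc_irange_step; try lia.
  by apply: T2; lia.
Qed.

Lemma cyc_rot3 (a b c : int) : pcycle [:: a; b; c] -> cyc [:: a; b; c] = cyc [:: b; c; a].
Proof. by move=> pc; rewrite -(cyc_rot 1 pc). Qed.

Lemma eval_atilde : E (watilde p) = cyc [:: 1; 2; 3]%R.
Proof.
rewrite evalJ [E (_ * _)%W]/(E (wzi p 2) * E (wzi p 1))%g !eval_zi; try lia.
rewrite cycJ; last by apply: pcycle_z; lia.
have z_out i x : 1 <= i <= q -> x < q + 1 -> x != i ->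
    ev (cyc [:: i; q + 1; q + 2]) x = x.
  by move=> i_in x_lt xi; apply: ev_cyc_out; [apply: pcycle_z | rewrite !inE; lia].
have z_in i : 1 <= i <= q -> ev (cyc [:: i; q + 1; q + 2]) (q + 1) = q + 2 /\
    ev (cyc [:: i; q + 1; q + 2]) (q + 2) = i.
  move=> i_in; rewrite !(ev_cyc3 _ (pcycle_z i_in)).
  by split; do !case: eqP => //; lia.
have [z21 z22] := @z_in 2 ltac:(lia); have [z11 z12] := @z_in 1 ltac:(lia).
rewrite /= !evM z21 z22 z12 !z_out; try lia.
by rewrite cyc_rot3 //; apply: pcycle3; lia.
Qed.

Lemma eval_cw : E (wc n p) = cyc (if odd n then irange 1 K else irange 2 K).
Proof.
rewrite /wc; case: ifP => n_odd; rewrite eval_c ?swap_endX.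
- by rewrite ifF ?mulg1 //; lia.
- have [kq | kq] := eqVneq k p; first by constructor 2; lia.
  by constructor 1; lia.
- by rewrite ifF ?mulg1 //; lia.
- by constructor 1; lia.
Qed.

Lemma eval_dw : E (wd p) = cyc (irange 5 (q + 2)).
Proof.
rewrite /wd eval_c ?swap_endX; last by constructor 4; lia.
by rewrite ifF ?mulg1 //; lia.
Qed.

(** From (1, ..., i, k+1, ..., p+2)(i+1, ..., k+1) = (1, ..., p+2), with i = 1 for n odd and i = 2
    for n even. In both cases the removed cycle is even and carries no [T]. *)
Lemma eval_ew : E (we n p) =
  cyc (if odd n then 1 :: irange (K + 1) (q + 2) else 1 :: 2 :: irange (K + 1) (q + 2)).
Proof.
have EV u v : E (u * v^-1)%W = (E u * (E v)^-1)%g by [].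
have za : E (wz p * wa)%W = cyc (irange 1 (q + 2)).
  by rewrite -[LHS]/(E (wz p) * sa)%g eval_z sigma_za.
have step (i : int) : 1 <= i -> i <= K ->
  (cyc (irange 1 i ++ irange (K + 1) (q + 2)) * cyc (irange (i + 1) (K + 1)))%g =
  cyc (irange 1 (q + 2)).
  move=> i1 iK; set hi := irange (K + 1) (q + 2).
  have Ehi : hi = K + 1 :: irange (K + 1 + 1) (q + 2) by rewrite /hi irange_cons //; lia.
  have Elo : irange 1 K = irange 1 i ++ irange (i + 1) K by rewrite -irange_cat //; lia.
  have Eall : irange 1 (q + 2) = irange 1 K ++ hi by rewrite -irange_cat //; lia.
  have pall : pcycle (irange 1 K ++ hi) by rewrite -Eall; apply: pcycle_irange; lia.
  have pe : pcycle (irange 1 i ++ hi).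
    apply: pcycle_sub pall; rewrite Elo; apply: cat_subseq => //; exact: prefix_subseq.
  have pc : pcycle (irange (i + 1) K ++ [:: K + 1]).
    apply: pcycle_sub pall; rewrite Elo Ehi; apply: cat_subseq => //.
      exact: suffix_subseq.
    by rewrite /= eqxx sub0seq.
  have pr : pcycle ((K + 1 :: irange (K + 1 + 1) (q + 2) ++ irange 1 i) ++ irange (i + 1) K).
    by rewrite -cat_cons -Ehi -catA -Elo pcycle_catC.
  rewrite (@irange_rcons (i + 1)); last lia.
  rewrite addrK (cyc_catC pc) (cyc_catC pe) Ehi -[(_ :: _) ++ _]/(_ :: (_ ++ _)) -cyc_cat //.
  by rewrite -!cat_cons -Ehi -catA -Elo cyc_catC -?Eall // pcycle_catC.
rewrite /we; case: ifP => n_odd; rewrite EV za.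
  rewrite eval_c ?swap_endX; last first.
    have [kq | kq] := eqVneq k p; first by constructor 3; lia.
    by constructor 1; lia.
  rewrite ifF ?mulg1; last lia.
  by apply: (canLR (mulgK _)); rewrite -(step 1) ?irange1 //; lia.
rewrite eval_c ?swap_endX; last first.
  have [kq | kq] := eqVneq k.+1 p; first by constructor 2; lia.
  by constructor 1; lia.
rewrite ifF ?mulg1; last lia.
by apply: (canLR (mulgK _)); rewrite -(step 2) ?(irange2 1) //; lia.
Qed.

(** * Disjoint cycles and the permutation y *)

Lemma disjoint_commute (s t : {perm point}) :
  (forall x, x \in points -> ev s x = x \/ ev t x = x) -> commute s t.
Proof.
move=> dst; apply: ev_perm => x Px; rewrite !evM.
have [sx | tx] := dst x Px.
  rewrite sx; have [->//|tx] : ev s (ev t x) = ev t x \/ ev t (ev t x) = ev t x.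
    by apply: dst; rewrite ev_in.
  by rewrite (ev_inj tx) sx.
rewrite tx; have [sx|//] : ev s (ev s x) = ev s x \/ ev t (ev s x) = ev s x.
  by apply: dst; rewrite ev_in.
by rewrite (ev_inj sx) tx.
Qed.

Lemma cyc_commute (c1 c2 : seq int) : pcycle c1 -> pcycle c2 ->
  ~~ has [in c1] c2 -> commute (cyc c1) (cyc c2).
Proof.
move=> p1 p2 /hasPn d12; apply: disjoint_commute => x _.
have [c1x | c1x] := boolP (x \in c1); [right | left]; apply: ev_cyc_out => //.
by apply: contraL c1x => /d12.
Qed.

Lemma cyc2C (a b : int) : pcycle [:: a; b] -> cyc [:: a; b] = cyc [:: b; a].
Proof. by move=> pc; rewrite -(cyc_rot 1 pc). Qed.

Lemma cyc2_sq (a b : int) : pcycle [:: a; b] -> (cyc [:: a; b] * cyc [:: a; b] = 1)%g.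
Proof.
move=> pc; have /= cV := cycV pc; rewrite -{2}[cyc _]invgK cV -[rev _]/([:: b; a]).
by rewrite -cyc2C ?mulgV // (pcycle_catC _ _ [:: b] [:: a]).
Qed.

(** The first N transpositions of the reflection x to k+1-x, from the innermost (0, k+1) outwards.
    For n odd y is the full reflection; for n even a 4-cycle replaces the two outermost
    transpositions. *)
Definition swap_pairs (N : nat) : {perm point} :=
  (\prod_(i < N) cyc [:: - i%:Z; K + 1 + i%:Z]%R)%g.

Lemma swap_pairsS (N : nat) :
  swap_pairs N.+1 = (swap_pairs N * cyc [:: - N%:Z; K + 1 + N%:Z]%R)%g.
Proof. exact: big_ord_recr. Qed.

Lemma pcycle_pair (i : nat) : (i <= p + 1 - k)%N -> pcycle [:: - i%:Z; K + 1 + i%:Z].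
Proof. by move=> i_le; apply: pcycle2; lia. Qed.

Lemma ev_swap_pairs (N : nat) (x : int) : (N <= p + 2 - k)%N ->
  ev (swap_pairs N) x =
    if (- N%:Z < x <= 0) || (K + 1 <= x < K + 1 + N%:Z) then K + 1 - x else x.
Proof.
elim: N => [|N IHN] N_le; first by rewrite /swap_pairs big_ord0 ev1 ifF //; lia.
have := IHN (ltnW N_le); rewrite swap_pairsS evM; case: ifP => xN ->.
all: rewrite ev_cyc2; last by apply: pcycle_pair; lia.
  case: eqP => ?; first lia.
  by case: eqP => ?; first lia; rewrite ifT //; lia.
case: eqP => ?; first by rewrite ifT; lia.
case: eqP => ?; first by rewrite ifT; lia.
by rewrite ifF //; lia.
Qed.

Lemma sigma_y_odd : odd n -> sy = swap_pairs (p + 2 - k).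
Proof. by rewrite /sigma_y => ->. Qed.

Definition end_cycle : {perm point} := cyc [:: - q - 1 + K; q + 2; - q + K; q + 1].

Lemma sigma_y_even : ~~ odd n -> sy = (end_cycle * swap_pairs (p - k))%g.
Proof. by rewrite /sigma_y => /negPf->. Qed.

Lemma pcycle4 (a b c d : int) : K - q - 1 <= a <= q + 2 ->
  K - q - 1 <= b <= q + 2 -> K - q - 1 <= c <= q + 2 -> K - q - 1 <= d <= q + 2 ->
  uniq [:: a; b; c; d] -> pcycle [:: a; b; c; d].
Proof.
move=> Pa Pb Pc Pd U; rewrite pcycleE U /=.
by rewrite !mem_points // Pa Pb Pc Pd.
Qed.

Lemma pcycle_end_cycle : (k < p)%N -> pcycle [:: - q - 1 + K; q + 2; - q + K; q + 1].
Proof. by move=> lt_kp; apply: pcycle4; rewrite /= ?inE; lia. Qed.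

Lemma ev_y_odd (x : int) : odd n -> x \in points ->
  ev sy x = if 1 <= x <= K then x else K + 1 - x.
Proof.
move=> n_odd; rewrite mem_points // => Px; rewrite sigma_y_odd // ev_swap_pairs //.
by do !case: ifP; lia.
Qed.

Lemma ev_y_even (x : int) : ~~ odd n -> ev sy x =
  if x == - q - 1 + K then q + 2 else if x == q + 2 then - q + K
  else if x == - q + K then q + 1 else if x == q + 1 then - q - 1 + K
  else if (K - q < x <= 0) || (K + 1 <= x <= q) then K + 1 - x else x.
Proof.
move=> n_even; have lt_kp : (k < p)%N by move: n_even p11; lia.
rewrite sigma_y_even // evM ev_swap_pairs; last lia.
rewrite ev_cyc /=; last exact: pcycle_end_cycle.
by do !case: eqP => ?; do !case: ifP; lia.
Qed.

Lemma ev_y_in (x : int) : 1 <= x <= K -> ev sy x = x.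
Proof.
move=> x_in; have [n_odd | n_even] := boolP (odd n).
  by rewrite ev_y_odd ?x_in // mem_points; lia.
by rewrite ev_y_even //; do !case: eqP; do ?case: ifP; lia.
Qed.

(** The points above k on which y is the reflection end here; for n even, p+1 and p+2 lie on the
    4-cycle. *)
Definition pair_bound : int := if odd n then q + 2 else q.

Lemma ev_y_hi (i : nat) : K + 1 + i%:Z <= pair_bound -> ev sy (K + 1 + i%:Z) = - i%:Z.
Proof.
rewrite /pair_bound; case: ifP => [n_odd | /negbT n_even] i_le.
  by rewrite ev_y_odd // ?mem_points; try lia; case: ifP; lia.
by rewrite ev_y_even //; do !case: eqP; do ?case: ifP; lia.
Qed.

Lemma ev_y_lo (i : nat) : K + 1 + i%:Z <= pair_bound -> ev sy (- i%:Z) = K + 1 + i%:Z.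
Proof.
rewrite /pair_bound; case: ifP => [n_odd | /negbT n_even] i_le.
  by rewrite ev_y_odd // ?mem_points; try lia; case: ifP; lia.
by rewrite ev_y_even //; do !case: eqP; do ?case: ifP; lia.
Qed.

(** * The words [wu], [wxtilde] and [ww] *)

Lemma eval_uE : E (wu p) = ((sz * sa) * (sz * sa) ^ sy)%g.
Proof.
rewrite -[LHS]/(E (wz p * wa)%W * E ((wz p * wa) ^ wy)%W)%g evalJ.
by rewrite -[E (wz p * wa)%W]/(E (wz p) * sa)%g eval_z.
Qed.

Lemma eval_u : (k < p)%N -> E (wu p) = (cyc (irange 1 (q + 2))%R *
   cyc (irange 1 K ++ if odd n then [seq - i%:Z | i <- iota 0 (p + 2 - k)]
     else [seq - i%:Z | i <- iota 0 (p - k)] ++ [:: - q - 1 + K; - q + K])%R)%g.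
Proof.
move=> lt_kp; rewrite eval_uE sigma_za; congr (_ * _)%g.
rewrite cycJ; last by apply: pcycle_irange; lia.
rewrite (@irange_cat K); try lia; rewrite map_cat.
have -> : map (ev sy) (irange 1 K) = irange 1 K.
  rewrite -[RHS]map_id; apply/eq_in_map=> x; rewrite mem_irange; exact: ev_y_in.
congr (cyc (_ ++ _)).
have hi (N : nat) : K + N%:Z <= pair_bound ->
    map (ev sy) [seq K + 1 + i%:Z | i <- iota 0 N] = [seq - i%:Z | i <- iota 0 N].
  move=> N_le; rewrite -map_comp; apply/eq_in_map=> i; rewrite mem_iota /= => i_lt.
  by rewrite ev_y_hi //; lia.
have [n_odd | n_even] := boolP (odd n).
  rewrite /irange ifT; last lia.
  rewrite (_ : (absz _).+1 = (p + 2 - k)%N) ?hi //; last lia.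
  by rewrite /pair_bound n_odd; lia.
rewrite (@irange_cat q); try lia; rewrite map_cat {1}/irange ifT; last lia.
rewrite (_ : (absz _).+1 = (p - k)%N) ?hi //; try lia; last first.
  by rewrite /pair_bound (negPf n_even); lia.
have -> : irange (q + 1) (q + 2) = [:: q + 1; q + 2].
  have -> : q + 2 = q + 1 + 1 by lia.
  by rewrite irange2.
congr (_ ++ _); rewrite /= !ev_y_even //.
by congr [:: _; _]; do !case: eqP; lia.
Qed.

(** Moving the powers of v to the right leaves conjugates of x. With x = [wxtilde] and v = [wu]
    squared, this explains the shape of w: the product runs over shifted copies of two adjacent
    pairs. *)
Lemma expg_twist (G : groupType) (x v : G) (N : nat) :
  ((x * v^-1) ^+ N * x * v ^+ N)%g = (\prod_(i < N.+1) x ^ (v ^+ i))%g.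
Proof.
elim: N => [|N IHN]; first by rewrite big_ord_recl big_ord0 !mulg1 mul1g conjg1.
rewrite big_ord_recl expg0 conjg1.
have -> : (\prod_(i < N.+1) x ^ (v ^+ (lift ord0 i)) =
           (\prod_(i < N.+1) x ^ (v ^+ i)) ^ v)%g.
  by rewrite conjg_prod; apply: eq_bigr => i _; rewrite /= expgSr conjgM.
rewrite -IHN expgS expgSr conjgE; move: (_ ^+ N)%g => y.
by rewrite !mulgA.
Qed.

Lemma eval_xtE : E (wxtilde n p) =
  ((E (wdij p 1 (K + 2)) * E (wdij p 2 (K + 1))) ^
     ((E (wdij p 1 (K + 2)) * E (wdij p 2 (K + 1))) ^ sy))%g.
Proof.
have EM u v : E (Mul u v) = (E u * E v)%g by [].
by rewrite evalJ (EM (wdij _ _ _)) (EM (Conj _ _)) 2!evalJ -conjMg.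
Qed.

Lemma cyc_end_commute (a b : int) : pcycle [:: a; b] -> a < q + 1 -> b < q + 1 ->
  commute T (cyc [:: a; b]).
Proof.
move=> pc a_lt b_lt; apply: cyc_commute pcycle_end pc _.
by rewrite /= !inE; lia.
Qed.

(** If k = p - 1 then k + 2 is congruent to 1, so d(1, k+2) degenerates to z(1), and p + 2 takes the
    place of k + 2. *)
Let far : int := if (k + 2 <= p)%N then K + 2 else q + 2.

Lemma eval_dd : (k < p)%N -> (E (wdij p 1 (K + 2)) * E (wdij p 2 (K + 1)))%g =
  (cyc [:: 1; far]%R * cyc [:: 2; K + 1]%R)%g.
Proof.
move=> lt_kp; have p2 : pcycle [:: 2; K + 1] by apply: pcycle2; lia.
rewrite (eval_d (i := 2)); try lia; rewrite -/T -(cyc_end_commute p2); try lia.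
rewrite /far mulgA; congr (_ * _)%g; case: ifP => kp2.
  by rewrite eval_d ?swap_end2; try lia; rewrite -mulgA swap_end2 mulg1.
have -> : E (wdij p 1 (K + 2)) = E (wzi p 1).
  have Eq : K + 2 = 1 + q by lia.
  have Ez : E (wzi p (K + 2)) = E (wzi p 1) by apply: eq_wzi; rewrite Eq modzDr.
  by rewrite eval_dE Ez mulgV mul1g.
rewrite eval_zi; last lia.
have [pz pz' pe p1] : [/\ pcycle [:: 1; q + 1; q + 2], pcycle [:: q + 2; 1; q + 1],
    pcycle [:: q + 2; q + 1] & pcycle [:: q + 2; 1]].
  by split; [apply: pcycle_z | apply: pcycle3 | apply: pcycle2 | apply: pcycle2];
     clear p2; lia.
rewrite -(cyc_rot 2 pz) (@cyc_cat _ _ (q + 2) [:: 1] [:: q + 1]) // -mulgA.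
by rewrite /swap_end (cyc2C pcycle_end) cyc2_sq // mulg1 cyc2C.
Qed.

(** The element (1, far)(2, k+1) is conjugated by its own conjugate under y, which is (1, -1)(2,
    0). *)
Lemma eval_xt : (k < p)%N ->
  E (wxtilde n p) = (cyc [:: -1; far]%R * cyc [:: 0; K + 1]%R)%g.
Proof.
move=> lt_kp; rewrite eval_xtE eval_dd //.
have far_in : K + 1 < far <= q + 2 by rewrite /far; case: ifP; lia.
have pf : pcycle [:: 1; far] by apply: pcycle2; lia.
have pf' : pcycle [:: 1; -1] by apply: pcycle2; lia.
have p2 : pcycle [:: 2; K + 1] by apply: pcycle2; lia.
have p20 : pcycle [:: 2; 0] by apply: pcycle2; lia.
have y_far : ev sy far = -1.
  rewrite /far; case: ifP => kp2.
    have -> : K + 2 = K + 1 + 1%N by lia.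
    by rewrite ev_y_hi // /pair_bound; case: ifP; lia.
  have n_even : ~~ odd n by move: p11; lia.
  by rewrite ev_y_even //; case: eqP => ?; [lia | rewrite eqxx; lia].
have y_K1 : ev sy (K + 1) = 0.
  by rewrite -[K + 1]addr0 (@ev_y_hi 0%N) // /pair_bound; case: ifP; lia.
have -> : ((cyc [:: 1; far]%R * cyc [:: 2; K + 1]%R) ^ sy =
    cyc [:: 1; -1]%R * cyc [:: 2; 0]%R)%g.
  by rewrite conjMg !cycJ //= y_far y_K1 !ev_y_in //; lia.
rewrite conjMg !cycJ //= !evM !(ev_cyc2 _ pf').
have e1 : (if 1 == 1 :> int then -1 else if 1 == -1 :> int then 1 else 1 : int) = -1 by [].
have e2 : (if 2 == 1 :> int then -1 else if 2 == -1 :> int then 1 else 2 : int) = 2 by [].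
rewrite e1 e2 !ifF; try lia.
rewrite !(ev_cyc2 _ p20).
have e3 : (if -1 == 2 :> int then 0 else if -1 == 0 :> int then 2 else -1 : int) = -1 by [].
have e4 : (if 2 == 2 :> int then 0 else if 2 == 0 :> int then 2 else 2 : int) = 0 by [].
by rewrite e3 e4 !ifF //; lia.
Qed.

(** In u = (za)(za)^y the first factor fixes the nonpositive points and the second fixes their
    mirror images under y. So u moves both entries of the pair (-i, k+1+i) one step outwards. *)
Lemma ev_u_hi (i : nat) : K + 1 + i.+1%:Z <= pair_bound ->
  ev (E (wu p)) (K + 1 + i%:Z) = K + 1 + i.+1%:Z.
Proof.
move=> i_le; have b_le : pair_bound <= q + 2 by rewrite /pair_bound; case: ifP; lia.
rewrite eval_uE evM ev_za ifT; last lia.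
have -> : K + 1 + i%:Z + 1 = ev sy (- i.+1%:Z) by rewrite ev_y_lo //; lia.
by rewrite evJ ev_za_out ?ev_y_lo //; lia.
Qed.

Lemma ev_u_lo (i : nat) : K + 1 + i.+1%:Z <= pair_bound ->
  ev (E (wu p)) (- i%:Z) = - i.+1%:Z.
Proof.
move=> i_le; have b_le : pair_bound <= q + 2 by rewrite /pair_bound; case: ifP; lia.
rewrite eval_uE evM ev_za_out; last lia.
have -> : - i%:Z = ev sy (K + 1 + i%:Z) by rewrite ev_y_hi //; lia.
rewrite evJ ev_za ifT ?ev_y_hi; try lia.
have -> : K + 1 + i%:Z + 1 = K + 1 + i.+1%:Z by lia.
by rewrite ev_y_hi.
Qed.

Lemma xt_shift (i : nat) : (k < p)%N -> K + 1 + (i.*2).+1%:Z <= pair_bound ->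
  (E (wxtilde n p) ^ ((E (wu p) ^+ 2) ^+ i))%g =
  (cyc [:: - i.*2%:Z; K + 1 + i.*2%:Z]%R *
   cyc [:: - (i.*2).+1%:Z; K + 1 + (i.*2).+1%:Z]%R)%g.
Proof.
move=> lt_kp; have b_le : pair_bound <= q + 2 by rewrite /pair_bound; case: ifP; lia.
elim: i => [|i IHi] i_le.
  rewrite expg0 conjg1 eval_xt // /far ifT; last first.
    by move: i_le p11; rewrite /pair_bound; case: ifP; lia.
  rewrite (cyc_commute (pcycle2 _ _ _) (pcycle2 _ _ _)) //; try lia; last first.
    by rewrite /= !inE; lia.
  by rewrite oppr0 addr0; have -> : K + 1 + 1%N = K + 2 by lia.
have step (j : nat) : K + 1 + j.+2%:Z <= pair_bound ->
    (cyc [:: - j%:Z; K + 1 + j%:Z]%R ^ (E (wu p) ^+ 2))%g =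
    cyc [:: - j.+2%:Z; K + 1 + j.+2%:Z]%R.
  move=> j_le; rewrite cycJ; last by apply: pcycle2; lia.
  have lo := ev_u_lo; have hi := ev_u_hi; move: (E (wu p)) lo hi => U lo hi.
  have j_le' : K + 1 + j.+1%:Z <= pair_bound by lia.
  by rewrite /= expg2 !evM (lo j) // (lo j.+1) // (hi j) // (hi j.+1).
rewrite expgSr conjgM IHi; last by lia.
by rewrite conjMg !step //; lia.
Qed.

Lemma swap_pairs_shift (N : nat) : (k < p)%N -> K + 1 + (N.*2).-1%:Z <= pair_bound ->
  (\prod_(i < N) E (wxtilde n p) ^ ((E (wu p) ^+ 2) ^+ i))%g = swap_pairs N.*2.
Proof.
move=> lt_kp; elim: N => [|N IHN] N_le; first by rewrite /swap_pairs !big_ord0.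
rewrite big_ord_recr /= IHN; last by lia.
rewrite xt_shift //.
by rewrite doubleS 2!swap_pairsS mulgA.
Qed.

Lemma swap_pairs_twist (N : nat) : (k < p)%N -> K + 1 + (N.*2).+1%:Z <= pair_bound ->
  ((E (wxtilde n p) * expgz (E (wu p)) (- 2)) ^+ N * E (wxtilde n p) *
     E (wu p) ^+ N.*2)%g = swap_pairs N.*2.+2.
Proof.
move=> lt_kp N_le; rewrite -doubleS -swap_pairs_shift //.
by rewrite -mul2n expgM -expg_twist.
Qed.

(** Here z^y = (p, 0, -1), so the two factors of w are (p+2, 0, -1) and (p+1, 0, -1), and the
    transposition of 0 and -1 cancels in the product. *)
Lemma eval_w_eq : k = p -> E (ww n p) = (cyc [:: -1; q + 2]%R * cyc [:: 0; q + 1]%R)%g.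
Proof.
move=> kq; have n_odd : odd n by move: p11; lia.
rewrite /ww kq eqxx.
have EM u v : E (Mul u v) = (E u * E v)%g by [].
rewrite EM !evalJ !EM [E (Pow (wz p) _)]/((E (wz p))^-1)%g !conjgM eval_z.
rewrite -[E wy]/sy.
have y1 : ev sy q = q by apply: ev_y_in; lia.
have y2 : ev sy (q + 1) = 0.
  by rewrite ev_y_odd ?mem_points //; try lia; rewrite ifF; lia.
have y3 : ev sy (q + 2) = -1.
  by rewrite ev_y_odd ?mem_points //; try lia; rewrite ifF; lia.
have pz : pcycle [:: q; q + 1; q + 2] by apply: pcycle_z; lia.
have -> : (sz ^ sy)%g = cyc [:: q; 0; -1]%R by rewrite /sigma_z cycJ //= y1 y2 y3.
have pq : pcycle [:: q; 0; -1] by apply: pcycle3; lia.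
have z_fix (x : int) : x < 1 -> ev sz x = x.
  by move=> x_lt; apply: ev_cyc_out => //; rewrite !inE; lia.
have zV_fix (x : int) : x < 1 -> ev sz^-1%g x = x by move=> x_lt; apply/evV/z_fix.
have zq : ev sz q = q + 1 by rewrite ev_cyc3 // eqxx.
have zVq : ev sz^-1%g q = q + 2.
  by apply: evV; rewrite ev_cyc3 //; do !case: eqP => //; lia.
rewrite !cycJ //= zq zVq !z_fix ?zV_fix //.
have p1 : pcycle [:: q + 2; 0; -1] by apply: pcycle3; lia.
have p2 : pcycle [:: q + 1; 0; -1] by apply: pcycle3; lia.
have p3 : pcycle [:: -1; q + 2; 0] by apply: pcycle3; lia.
have p4 : pcycle [:: 0; -1; q + 1] by apply: pcycle3; lia.
have p5 : pcycle [:: -1; 0] by apply: pcycle2; lia.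
rewrite -(cyc_rot 2 p1) -(cyc_rot 1 p2).
rewrite (@cyc_cat _ _ (-1) [:: q + 2] [:: 0%R]) // (@cyc_cat _ _ 0 [:: -1] [:: q + 1]) //.
rewrite -mulgA [in X in (_ * X)%g]mulgA; congr (_ * _)%g.
by rewrite (cyc2C p5) cyc2_sq ?mul1g //; apply: pcycle2; lia.
Qed.

Lemma pair_commute (i j : nat) : (i <= p + 1 - k)%N -> (j <= p + 1 - k)%N -> i != j ->
  commute (cyc [:: - i%:Z; K + 1 + i%:Z]) (cyc [:: - j%:Z; K + 1 + j%:Z]).
Proof.
move=> i_le j_le ij; apply: cyc_commute; try exact: pcycle_pair.
by rewrite /= !inE; lia.
Qed.

(** The conjugate of d(1, -1) is (p, -p+k+1)(-p+k, p+1) and that of z(1)^-1 is (-p+k, -p-1+k, p+2).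
    The last two cycles share -p+k and compose to the 4-cycle of y. *)
Lemma eval_w_ends : ~~ odd n -> (k < p)%N ->
  (E (wdij p 1%R (-1)%R ^ (wz p * wa * wy * wa^-1 * wz p ^+ (- 2) * wa^-1))%W *
   E ((wzi p 1%R)^-1 ^ (wy * wa^-1 * (wz p)^-1))%W)%g =
  (cyc [:: q; - q + K + 1] * end_cycle)%g.
Proof.
move=> n_even lt_kp.
have EM u v : E (Mul u v) = (E u * E v)%g by [].
have EV u : E (u^-1)%W = (E u)^-1%g by [].
have Ez2 : E (wz p ^+ (-2))%W = (sz^-1 * sz^-1)%g.
  by rewrite -[LHS]/(expgz (E (wz p)) (- 2)) eval_z -invMg.
have EC1 u : E (u ^ (wz p * wa * wy * wa^-1 * wz p ^+ (- 2) * wa^-1))%W =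
    (E u ^ (sz * sa * sy * sa^-1 * (sz^-1 * sz^-1) * sa^-1))%g.
  by rewrite evalJ !EM Ez2 !EV eval_z.
have EC2 u : E (u ^ (wy * wa^-1 * (wz p)^-1))%W = (E u ^ (sy * sa^-1 * sz^-1))%g.
  by rewrite evalJ !EM !EV eval_z.
rewrite EC1 EC2 EV.
have -> : E (wdij p 1%R (-1)%R) = E (wdij p 1%R (q - 1)%R).
  by apply: eq_wdij => //; rewrite -modzDr addrC.
rewrite eval_d ?eval_zi; try lia.
have za1 : ev sa (ev sz 1) = 2.
  by rewrite -evM ev_za ifT; lia.
have za2 : ev sa (ev sz (q - 1)) = q.
  by rewrite -evM ev_za ifT; lia.
have za3 : ev sa (ev sz (q + 1)) = q + 2.
  by rewrite -evM ev_za ifT; lia.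
have za4 : ev sa (ev sz (q + 2)) = 1.
  by rewrite -evM ev_za ifF ?eqxx //; lia.
have y1 : ev sy 1 = 1 by apply: ev_y_in; lia.
have y2 : ev sy 2 = 2 by apply: ev_y_in; lia.
have yq : ev sy q = - q + K + 1.
  by rewrite ev_y_even //; do 4!(rewrite ifF; last lia); rewrite ifT; lia.
have yq1 : ev sy (q + 1) = - q - 1 + K.
  by rewrite ev_y_even //; do 3!(rewrite ifF; last lia); rewrite eqxx.
have yq2 : ev sy (q + 2) = - q + K.
  by rewrite ev_y_even // ifF ?eqxx //; lia.
have aV1 : ev sa^-1%g 1 = q by apply: evV; rewrite ev_a ifF ?eqxx //; lia.
have aV2 : ev sa^-1%g 2 = 1 by apply: evV; rewrite ev_a ifT //; lia.
have aV_fix (x : int) : x < 1 \/ q < x -> ev sa^-1%g x = x.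
  by move=> x_out; apply: evV; rewrite ev_a; do 2!(rewrite ifF; last lia).
have pz : pcycle [:: q; q + 1; q + 2] by apply: pcycle_z; lia.
have zV_fix (x : int) : x < q -> ev sz^-1%g x = x.
  move=> x_lt; apply: evV; apply: ev_cyc_out => //; rewrite !inE; lia.
have zVq : ev sz^-1%g q = q + 2.
  by apply: evV; rewrite ev_cyc3 //; do !case: eqP => //; lia.
have zVq2 : ev sz^-1%g (q + 2) = q + 1.
  by apply: evV; rewrite ev_cyc3 //; do !case: eqP => //; lia.
have pd : pcycle [:: 1; q - 1] by apply: pcycle2; lia.
have pz1 : pcycle [:: 1; q + 1; q + 2] by apply: pcycle_z; lia.
have -> : ((cyc [:: 1; q - 1]%R * T) ^ (sz * sa * sy * sa^-1 * (sz^-1 * sz^-1) * sa^-1) =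
    cyc [:: q; - q + K + 1]%R * cyc [:: - q + K; q + 1]%R)%g.
  have [f1 f2 f4] : [/\ ev sa^-1%g (- q + K + 1) = - q + K + 1,
      ev sa^-1%g (- q + K) = - q + K & ev sa^-1%g (q + 1) = q + 1].
    by split; apply: aV_fix; lia.
  have [g0 g1 g2] : [/\ ev sz^-1%g 1 = 1, ev sz^-1%g (- q + K + 1) = - q + K + 1
      & ev sz^-1%g (- q + K) = - q + K].
    by split; apply: zV_fix; lia.
  rewrite conjMg /swap_end (cycJ _ pd) (cycJ _ pcycle_end).
  by rewrite /= !evM za1 za2 za3 za4 y1 y2 yq yq2 aV1 aV2 f1 f2 zVq !g0 !g1 !g2 zVq2 aV1 f1 f2 f4.
have -> : ((cyc [:: 1; q + 1; q + 2]%R)^-1 ^ (sy * sa^-1 * sz^-1) =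
    cyc [:: - q + K; - q - 1 + K; q + 2]%R)%g.
  have [f1 f2] : ev sa^-1%g (- q - 1 + K) = - q - 1 + K /\ ev sa^-1%g (- q + K) = - q + K.
    by split; apply: aV_fix; lia.
  have [g1 g2] : ev sz^-1%g (- q - 1 + K) = - q - 1 + K /\ ev sz^-1%g (- q + K) = - q + K.
    by split; apply: zV_fix; lia.
  rewrite conjVg (cycJ _ pz1) /= !evM y1 yq1 yq2 aV1 f1 f2 zVq g1 g2.
  by rewrite cycV //; apply: pcycle3; lia.
have p3 : pcycle [:: - q + K; - q - 1 + K; q + 2] by apply: pcycle3; lia.
have p4 : pcycle [:: - q + K; q + 1; - q - 1 + K; q + 2].
  by apply: pcycle4; rewrite /= ?inE; lia.
rewrite -mulgA; congr (_ * _)%g.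
by rewrite -(@cyc_cat _ _ _ [:: q + 1] [:: - q - 1 + K; q + 2]) // -(cyc_rot 2 p4).
Qed.

Lemma eval_w : E (ww n p) = sy.
Proof.
have [kq | kq] := eqVneq k p.
  rewrite eval_w_eq // sigma_y_odd; last by move: p11; lia.
  have -> : (p + 2 - k = 2)%N by lia.
  rewrite 2!swap_pairsS /swap_pairs big_ord0 mul1g.
  have -> : q + 2 = K + 1 + 1%:Z by lia.
  have -> : q + 1 = K + 1 + 0%:Z by lia.
  by rewrite -[0 in LHS]oppr0 (@pair_commute 1 0) //; lia.
have lt_kp : (k < p)%N by lia.
rewrite /ww (negPf kq).
have EM u v : E (Mul u v) = (E u * E v)%g by [].
have EX u i : E (Pow u i) = expgz (E u) i by [].
case: ifP => [n_odd | /negbT n_even].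
  have [N EN] : exists N, (p - k = N.*2)%N by exists (p - k)./2; move: p11; lia.
  rewrite !EM !EX [E (_ * _)%W]/(E (wxtilde n p) * expgz (E (wu p)) (- 2))%g.
  have -> : q - K = N.*2%:Z by lia.
  have -> : (N.*2%:Z %/ 2)%Z = N by lia.
  rewrite sigma_y_odd // -[expgz _ N%:Z]/(_ ^+ N)%g -[expgz _ N.*2%:Z]/(_ ^+ _)%g.
  rewrite swap_pairs_twist //; last by rewrite /pair_bound n_odd; lia.
  by congr swap_pairs; lia.
set C := ((wxtilde n p * wu p ^+ (-2)) ^+ ((q - K - 3)%R %/ 2)%Z)%W.
set F := (wu p ^+ (q - K - 3)%R)%W.
have S : (E C * E (wxtilde n p) * E F)%g = swap_pairs (p - k - 1).
  rewrite /C /F !EX [E (_ * _)%W]/(E (wxtilde n p) * expgz (E (wu p)) (- 2))%g.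
  (* For k = p - 1 the exponents are -1 and -2, and the word collapses to 1, the product of no
     pairs. *)
  have [k1 | k1] := eqVneq (p - k)%N 1%N.
    have -> : q - K - 3 = - 2 by lia.
    rewrite k1 /swap_pairs big_ord0 -[X in expgz X]invgK.
    by rewrite -[((- 2) %/ 2)%Z]/(- 1) -[expgz _ (- 1)]/(_^-1)%g invgK -mulgA mulVg.
  have [N EN] : exists N, (p - k = N.*2.+3)%N.
    by exists (p - k - 3)./2; move: p11; lia.
  have -> : q - K - 3 = N.*2%:Z by lia.
  have -> : (N.*2%:Z %/ 2)%Z = N by lia.
  rewrite -[expgz _ N%:Z]/(_ ^+ N)%g -[expgz _ N.*2%:Z]/(_ ^+ _)%g.
  rewrite swap_pairs_twist //; last by rewrite /pair_bound (negPf n_even); lia.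
  by congr swap_pairs; lia.
rewrite 4!EM eval_w_ends //; move: (E C) (E (wxtilde n p)) (E F) S => X Y Z S.
have {X Y Z S} -> : (cyc [:: q; - q + K + 1] * end_cycle * X * Y * Z =
    cyc [:: q; - q + K + 1] * end_cycle * swap_pairs (p - k - 1))%g.
  by rewrite -S !mulgA.
(* The twist produced the pairs with index below N = p - k - 1. The missing pair (-N, k+1+N) is the
   transposition (p, -p+k+1) supplied by the prefix of w. *)
have [N EN] : exists N, (p - k = N.+1)%N by exists (p - k - 1)%N; lia.
rewrite sigma_y_even // EN subn1 swap_pairsS /=.
have -> : cyc [:: q; - q + K + 1] = cyc [:: - N%:Z; K + 1 + N%:Z].
  have -> : K + 1 + N%:Z = q by lia.
  have -> : - N%:Z = - q + K + 1 by lia.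
  by apply: cyc2C; apply: pcycle2; lia.
have cN (M : nat) : (M <= N)%N ->
    commute (cyc [:: - N%:Z; K + 1 + N%:Z]) (swap_pairs M).
  elim: M => [|M IHM] M_lt; first by rewrite /swap_pairs big_ord0; apply: commute1.
  rewrite swap_pairsS; apply: commuteM; first by apply: IHM; lia.
  by apply: pair_commute; lia.
rewrite -(cN N) // [RHS]mulgA; congr (_ * _)%g.
apply: cyc_commute; first by apply: pcycle_pair; lia.
  exact: pcycle_end_cycle.
by rewrite /= !inE; lia.
Qed.

(** * The permutation of h is trivial *)

Section TheWordH.

(** As m is odd, r^2 generates the squares. The two factors z(1) and z(-1) insert p+2 and p+1 into
    the orbits of 1 and -1 under r^2, which gives the two cycles (1, r^2, r^4, ..., p+2) and (-1,
    -r^2, -r^4, ..., p+1) of length m + 1. *)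
Let tau : {perm point} :=
  (mulperm n (r ^+ 2)%g * cyc [:: 1; q + 1; q + 2]%R * cyc [:: q - 1; q + 1; q + 2]%R)%g.

Let pz1 : pcycle [:: 1; q + 1; q + 2].
Proof. by apply: pcycle_z; lia. Qed.

Let pzN1 : pcycle [:: q - 1; q + 1; q + 2].
Proof. by apply: pcycle_z; lia. Qed.

Let ev_tau (x : int) : ev tau x =
  ev (cyc [:: q - 1; q + 1; q + 2]) (ev (cyc [:: 1; q + 1; q + 2])
    (ev (mulperm n (r ^+ 2)%g) x)).
Proof. by rewrite !evM. Qed.

Let tau_hi1 : ev tau (q + 1) = q - 1.
Proof.
rewrite ev_tau ev_mulperm ifF; last lia.
by rewrite (ev_cyc3 _ pz1) (ev_cyc3 _ pzN1); do !case: eqP => //; lia.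
Qed.

Let tau_hi2 : ev tau (q + 2) = 1.
Proof.
rewrite ev_tau ev_mulperm ifF; last lia.
by rewrite (ev_cyc3 _ pz1) (ev_cyc3 _ pzN1); do !case: eqP => //; lia.
Qed.

Let tau_mul (x : int) : 1 <= x <= q - 1 ->
  let y := (val (val (r ^+ 2)%g * x%:~R : 'F_p))%:Z in
  ev tau x = if y == 1 then q + 2 else if y == q - 1 then q + 1 else y.
Proof.
move=> x_in y; rewrite ev_tau ev_mulperm x_in -/y.
have y_in : 1 <= y <= q - 1 by apply: unit_mul_range.
move: (y) y_in => {}y y_in {x x_in}.
rewrite (ev_cyc3 _ pz1) (ev_cyc3 _ pzN1).
case: (y =P 1) => [_|y1]; first by do !case: eqP => //; lia.
case: (y =P q + 1) => [|_]; first lia.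
case: (y =P q + 2) => [|_]; first lia.
case: (y =P q - 1) => [_|y2] //.
by do !case: eqP => //; lia.
Qed.

Let tau_out (x : int) : ~~ (1 <= x <= q - 1) -> x != q + 1 -> x != q + 2 -> ev tau x = x.
Proof.
move=> x_out x1 x2; rewrite ev_tau ev_mulperm (negPf x_out).
by rewrite (ev_cyc3 _ pz1) (ev_cyc3 _ pzN1); do !case: eqP => //; lia.
Qed.

Let orb (eps : 'F_p) (i : nat) : int := (val (eps * val r ^+ (i.*2)))%:Z.

Let val1 : (val (1 : 'F_p))%:Z = 1.
Proof. by rewrite -[1 : 'F_p]/(1%:~R) Fp_val_int //; lia. Qed.

Let valN1 : (val (-1 : 'F_p))%:Z = q - 1.
Proof.
have -> : -1 = (q - 1)%:~R :> 'F_p.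
  rewrite rmorphB /= -pmulrn; have -> : p%:R = 0 :> 'F_p.
    by apply/eqP; rewrite Fp_nat_eq0.
  by rewrite sub0r.
by rewrite Fp_val_int //; lia.
Qed.

Let val_eq (u v : 'F_p) : ((val u)%:Z == (val v)%:Z) = (u == v).
Proof. by rewrite eqz_nat. Qed.

Let r_pow_neq (i : nat) : (0 < i < m)%N ->
  (val r ^+ i.*2 != 1) && (val r ^+ i.*2 != -1).
Proof.
have [pE m_odd _] := half_p p_pr p11.
move=> i_in; apply/andP; split; apply/eqP; rewrite -valX_unit.
  move=> r1; have /eqP : (r ^+ i.*2 = 1)%g by apply: val_inj.
  rewrite -order_dvdn (order_r p_pr p11 gen_r) -mul2n Gauss_dvdr ?coprimen2 //.
  by move/dvdn_leq; lia.
by apply: (neg1_square p_pr p11); apply: (cycle_sq gen_r).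
Qed.

Let orb_step (eps : 'F_p) (e : int) :
  (eps = 1 /\ e = q + 2) \/ (eps = -1 /\ e = q + 1) ->
  forall i, (i < m)%N -> ev tau (orb eps i) = if i.+1 == m then e else orb eps i.+1.
Proof.
move=> eps_e i i_lt.
have nz : eps * val r ^+ i.*2 != 0.
  rewrite mulf_neq0 ?expf_neq0 // -?unitfE ?(valP r) //.
  by case: eps_e => [[-> _]|[-> _]]; rewrite ?unitrN unitr1.
have o_in : 1 <= orb eps i <= q - 1.
  rewrite /orb; move: (eps * _) nz => w nz; have := Fp_val_lt p_pr w.
  have w_gt0 : (0 < val w)%N.
    by rewrite lt0n; apply: contraNneq nz => w0; apply/eqP/val_inj.
  by move: (val w) w_gt0; lia.
rewrite tau_mul //.
have -> : val (r ^+ 2)%g * (orb eps i)%:~R = eps * val r ^+ i.+1.*2.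
  by rewrite /orb Fp_valK // valX_unit mulrCA -exprD doubleS.
rewrite -val1 -valN1 !val_eq -/(orb eps i.+1).
case: (i.+1 =P m) => [im | /eqP im].
  have -> : val r ^+ i.+1.*2 = 1.
    by rewrite im -mul2n mulnC exprM -valX_unit (r_half p_pr p11 gen_r) expr1n.
  rewrite mulr1; case: eps_e => [[-> ->]|[-> ->]]; rewrite ?eqxx //.
  have /eqP N11 : (-1 : 'F_p) != 1.
    by rewrite -val_eq valN1 val1; lia.
  by case: eqP.
have /andP[r1 rN1] : (val r ^+ i.+1.*2 != 1) && (val r ^+ i.+1.*2 != -1).
  by apply: r_pow_neq; lia.
case: eps_e => [[-> _]|[-> _]].
  by rewrite mul1r (negPf r1) (negPf rN1).
by rewrite mulN1r eqr_opp (negPf r1) eqr_oppLR (negPf rN1).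
Qed.

Let orb_tauX (eps : 'F_p) (e : int) :
  (eps = 1 /\ e = q + 2) \/ (eps = -1 /\ e = q + 1) ->
  (forall i, (i < m)%N -> ev (tau ^+ i)%g (orb eps 0) = orb eps i) /\
  ev (tau ^+ m)%g (orb eps 0) = e.
Proof.
move=> eps_e; have [pE m_odd _] := half_p p_pr p11.
have IH i : (i < m)%N -> ev (tau ^+ i)%g (orb eps 0) = orb eps i.
  elim: i => [|i IHi] i_lt; first by rewrite ev1.
  by rewrite expgSr evM IHi ?(orb_step eps_e) ?ifF //; lia.
split=> //; have Em : m = m.-1.+1 by lia.
rewrite {1}Em expgSr evM IH; last lia.
by rewrite (orb_step eps_e) -?Em ?eqxx //; lia.
Qed.

Let tau_order : (tau ^+ m.+1 = 1)%g.
Proof.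
have [pE m_odd _] := half_p p_pr p11.
have orb0 eps e : (eps = 1 /\ e = q + 2) \/ (eps = -1 /\ e = q + 1) ->
    ev (tau ^+ m.+1)%g (orb eps 0) = orb eps 0.
  move=> eps_e; have [_ tm] := orb_tauX eps_e.
  rewrite expgSr evM tm /orb expr0 mulr1.
  by case: eps_e => [[-> ->]|[-> ->]]; rewrite ?val1 ?valN1.
have fixX eps e i : (eps = 1 /\ e = q + 2) \/ (eps = -1 /\ e = q + 1) ->
    ev (tau ^+ m.+1)%g (ev (tau ^+ i)%g (orb eps 0)) = ev (tau ^+ i)%g (orb eps 0).
  move=> eps_e; rewrite -evM -expgD addnC expgD evM (orb0 _ _ eps_e) //.
have r_even j : exists2 i, (i < m)%N & val r ^+ j = val r ^+ i.*2.
  (* Adding the odd number m to an odd exponent makes it even and does not change the power of r. *)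
  have [i Ei] : exists i, (j + odd j * m = i.*2)%N.
    by exists (j + odd j * m)./2; move: m_odd; case: (odd j) (odd_double_half j); lia.
  exists (i %% m)%N; first by rewrite ltn_mod; lia.
  rewrite -!valX_unit; congr (val _); apply/eqP.
  rewrite eq_expg_mod_order (order_r p_pr p11 gen_r) -!mul2n modnMmr mul2n -Ei.
  by rewrite addnC modnMDl.
apply: ev_perm => x _; rewrite ev1.
have [x_in | x_out] := boolP (1 <= x <= q - 1); last first.
  have [->|x1] := eqVneq x (q + 1).
    have [_ <-] := @orb_tauX (-1) (q + 1) (or_intror (conj erefl erefl)).
    by apply: fixX; right.
  have [->|x2] := eqVneq x (q + 2).
    have [_ <-] := @orb_tauX 1 (q + 2) (or_introl (conj erefl erefl)).
    by apply: fixX; left.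
  by apply/evX_fix/tau_out.
have Ex : x = (val (x%:~R : 'F_p))%:Z by rewrite Fp_val_int //; lia.
have nz : (x%:~R : 'F_p) != 0 by rewrite Fp_int_eq0 // dvdzE; apply/negP=> /dvdn_leq; lia.
case: (unit_pow p_pr p11 gen_r nz) => [] [j Ej].
  have [i i_lt Ei] := r_even j; have [tX _] := @orb_tauX 1 (q + 2) (or_introl (conj erefl erefl)).
  have -> : x = orb 1 i by rewrite Ex Ej Ei /orb mul1r.
  by rewrite -tX //; apply: fixX; left.
have [i i_lt Ei] := r_even j; have [tX _] := @orb_tauX (-1) (q + 1) (or_intror (conj erefl erefl)).
have -> : x = orb (-1) i by rewrite Ex Ej Ei /orb mulN1r.
by rewrite -tX //; apply: fixX; right.
Qed.

Lemma eval_h : E (wh p) = 1%g.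
Proof.
have EM u v : E (Mul u v) = (E u * E v)%g by [].
rewrite -[LHS]/(E ((wb ^+ 2) * wzi p 1%R * wzi p (-1)%R)%W ^+ _)%g 2!EM.
have -> : E (wzi p (-1)) = E (wzi p (q - 1)) by apply: eq_wzi; rewrite -modzDr addrC.
rewrite !eval_zi; try lia.
rewrite -[E (wb ^+ 2)%W]/(E wb ^+ 2)%g eval_b -mulpermX -/tau.
have -> : (p.+1./2 = m.+1)%N by have [] := half_p p_pr p11; lia.
exact: tau_order.
Qed.

End TheWordH.

(** * Homomorphisms from the alternating group of the positive points *)

(** Words free of y act within these points ([eval_P1]); the other points are reached only through
    y. *)
Definition private1 : {set point} := [set x | 1 <= val x].
Local Notation P1 := private1.

Lemma perm_on_fix (S : {set point}) (t : {perm point}) :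
  (forall x, x \notin S -> t x = x) -> perm_on S t.
Proof.
by move=> tfix; apply/subsetP=> x; rewrite inE; apply: contraNT => /tfix->.
Qed.

Lemma alt_on_P1 (t : {perm point}) : ~~ odd_perm t ->
  (forall x, x < 1 -> ev t x = x) -> t \in alt_on P1.
Proof.
move=> t_even tfix; rewrite alt_onE t_even andbT; apply: perm_on_fix => x.
by rewrite inE -ltNge => x_lt; apply: val_inj; rewrite -ev_val tfix.
Qed.

Lemma sigma_a_P1 : sa \in alt_on P1.
Proof.
have pa : pcycle (irange 1 q) by apply: pcycle_irange; lia.
have [pE _ _] := half_p p_pr p11.
apply: alt_on_P1 => [|x x_lt]; last by rewrite ev_a; do 2!(rewrite ifF; last lia).
rewrite odd_cyc // size_irange; last lia.
by rewrite irange_cons; [rewrite andbT; lia | lia].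
Qed.

Lemma sigma_g_P1 : sg \in alt_on P1.
Proof.
have pz' : pcycle [:: q + 2; q + 1; q] by apply: pcycle3; lia.
apply: alt_on_P1 => [|x x_lt].
  by rewrite odd_permM (negPf (mulperm_even alpha_sq)) odd_cyc.
rewrite evM ev_mulperm ifF; last lia.
by apply: ev_cyc_out => //; rewrite !inE; lia.
Qed.

(** Sending y to 1 puts every letter in [alt_on P1] and leaves the value of words free of y
    unchanged. *)
Let env0 (i : 'I_3) : {perm point} := if (i == 2 :> nat) then 1%g else sigma_env i.

Let env0_P1 i : env0 i \in alt_on P1.
Proof.
by case: i => [[|[|[|i]]] i_lt] //; [apply: sigma_a_P1 | apply: sigma_g_P1 | apply: group1].
Qed.

Let eval0 e : yfree e -> E e = eval env0 e.
Proof. by apply: yfree_eval => i i2; rewrite /env0 (negPf i2). Qed.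

Lemma eval_P1 e : yfree e -> E e \in alt_on P1.
Proof. by move=> Ye; rewrite eval0 // eval_in. Qed.

Let half_succ : (p.+1./2 = m.+1)%N.
Proof. by have [] := half_p p_pr p11; lia. Qed.

Let m_third : (3 * (m %/ 3).+1 = 1 + m)%N.
Proof. by have [] := half_p p_pr p11; lia. Qed.

Let small_in (i : int) : (1 <= i <= 11) || (i == q - 1) || (i == q) -> 1 <= i <= q.
Proof. by lia. Qed.

Let sb : {perm point} := mulperm n r.

Lemma Fp_rep_inj (x w : int) :
  1 <= x <= q -> 1 <= w <= q -> x%:~R = w%:~R :> 'F_p -> x = w.
Proof.
move=> x_in w_in /(Fp_int_eq p_pr).
have [->|xq] := eqVneq x q; have [->|wq] := eqVneq w q => //.
- by rewrite modzz modz_small; lia.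
- by rewrite modzz modz_small; lia.
- by rewrite !modz_small; lia.
Qed.

Let q0 : (q%:~R : 'F_p) = 0.
Proof. by apply/eqP; rewrite Fp_int_eq0 // dvdzz. Qed.

Let b_res (x : int) : 1 <= x <= q ->
  1 <= ev sb x <= q /\ (ev sb x)%:~R = val r * x%:~R :> 'F_p.
Proof.
move=> x_in; rewrite /sb ev_mulperm; have [-> | xq] := eqVneq x q.
  by rewrite ifF ?q0 ?mulr0 //; [split => //; lia | lia].
have x_in' : 1 <= x <= q - 1 by lia.
rewrite x_in' Fp_valK; split=> //; have := unit_mul_range r x_in'; lia.
Qed.

Let sb_zi (i : int) : 1 <= i <= q -> (E (wzi p i) ^ sb)%g = E (wzi p (ev sb i)).
Proof.
move=> i_in; have [bi_in _] := b_res i_in.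
rewrite !eval_zi // cycJ; last by apply: pcycle_z.
have b_fix (x : int) : q < x -> ev sb x = x by move=> ?; rewrite /sb ev_mulperm ifF //; lia.
by rewrite /= (b_fix (q + 1)) ?(b_fix (q + 2)) //; lia.
Qed.

Lemma sigma_ab : (sa ^ sb = sa ^+ (val r : nat))%g.
Proof.
have a_res (x : int) : 1 <= x <= q ->
    1 <= ev sa x <= q /\ (ev sa x)%:~R = x%:~R + 1 :> 'F_p.
  move=> x_in; rewrite ev_a; have [-> | xq] := eqVneq x q.
    by rewrite ifF ?q0 ?add0r //; [split => //; lia | lia].
  by rewrite ifT; [rewrite rmorphD /=; split => //; lia | lia].
have aX_res j (x : int) : 1 <= x <= q ->
    1 <= ev (sa ^+ j)%g x <= q /\ (ev (sa ^+ j)%g x)%:~R = x%:~R + j%:R :> 'F_p.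
  move=> x_in; elim: j => [|j [IHi IHe]]; first by rewrite ev1 addr0.
  rewrite expgSr evM; have [-> ->] := a_res _ IHi; split=> //.
  by rewrite IHe -addrA natr1.
apply: ev_perm => w _; rewrite -[w](evKV sb) evJ; move: (ev sb^-1%g w) => {}w.
have [w_in | w_out] := boolP (1 <= w <= q); last first.
  have bw : ev sb w = w by rewrite /sb ev_mulperm ifF //; lia.
  have aw : ev sa w = w by rewrite ev_a; do 2!(rewrite ifF; last lia).
  by rewrite aw bw evX_fix.
have [aw_in aw] := a_res _ w_in; have [bw_in bw] := b_res w_in.
have [baw_in baw] := b_res aw_in; have [abw_in abw] := aX_res (val r) _ bw_in.
apply: Fp_rep_inj => //; rewrite baw aw abw bw mulrDr mulr1; congr (_ + _).
by rewrite natr_Zp.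
Qed.

Section LocalHom.
Variables (u v : point).
Hypotheses (val_u : val u = q + 1) (val_v : val v = q + 2).
Let B : {set point} := [set x : point | 1 <= val x <= q].

Let uv : u != v.
Proof. by apply/eqP=> /(congr1 val); rewrite val_u val_v; lia. Qed.

Let uB : u \notin B. Proof. by rewrite inE val_u; lia. Qed.
Let vB : v \notin B. Proof. by rewrite inE val_v; lia. Qed.

Let P1E : P1 = [set u; v] :|: B.
Proof.
apply/setP=> x; rewrite !inE; have := valP x; rewrite mem_points // => x_in.
have eq_val (w : point) : (x == w) = (val x == val w :> int) by rewrite -(inj_eq val_inj).
by rewrite !eq_val val_u val_v; move: (val x) x_in; lia.
Qed.

Let cycle3_zi (i : point) : i \in B -> cycle3 u v i = E (wzi p (val i)).
Proof.
rewrite inE => i_in; rewrite eval_zi // -val_u -val_v cyc3_cycle3 //.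
  by apply/eqP=> /(congr1 val); rewrite val_u; move: (val i) i_in; lia.
by apply/eqP=> /(congr1 val); rewrite val_v; move: (val i) i_in; lia.
Qed.

Section Presented.
Variables (s : int) (G : groupType) (rho : 'I_3 -> G).
Hypothesis sr : s%:~R * (val r - 1) = -1 :> 'F_p.
Local Notation R := (eval rho).
Local Notation a := (R wa).
Local Notation g := (R wg).
Local Notation y := (R wy).
Hypothesis rel_ab : R (wa ^+ q)%W = R (wb ^+ m%:Z)%W.
Hypothesis rel_s : R ((wa ^+ s) ^ wb)%W = R (wa ^+ (s - 1)%R)%W.
Hypothesis rel_z : R ((wz p * (wz p ^ wa)) ^+ 2)%W = 1%g.
Hypothesis rel_h : R (watilde p) = R ((watilde p * wh p) ^ wy)%W.

Let rel_s' : (expgz a s ^ (g ^+ 3) = expgz a (s - 1)%R)%g.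
Proof. by rewrite -[RHS]/(R (wa ^+ (s - 1)%R)%W) -rel_s evalJ. Qed.

Let rel_z' : ((g ^+ m * (g ^+ m) ^ a) ^+ 2 = 1)%g.
Proof. by rewrite -[RHS]rel_z -[RHS]/(R (wz p * wz p ^ wa)%W ^+ 2)%g -[R (_ * _)%W]/(R (wz p) * R (wz p ^ wa)%W)%g evalJ. Qed.

Let ap : (a ^+ p = 1)%g := affine_ap rel_ab rel_s'.
Local Notation zs := (@zshift p G a g).

Let apow_a : apow a (1 : 'F_p) = a.
Proof. exact: (apow1 p_pr rel_ab rel_s'). Qed.

Lemma eval_G_zi (i : int) : R (wzi p i) = zs i%:~R.
Proof.
rewrite evalJ -[R (wa ^+ i)%W]/(expgz a i) (apow_expgz p_pr rel_ab rel_s').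
by [].
Qed.

(** Carmichael's presentation with u = p+1 and v = p+2; its relations are [zshift3] and
    [zshift2]. *)
Lemma hom_private1_zi : exists f : {perm point} -> G,
  {in alt_on P1 &, {morph f : t1 t2 / (t1 * t2)%g}} /\
  forall i, 1 <= i <= q -> f (E (wzi p i)) = R (wzi p i).
Proof.
have z3 : {in B, forall i : point, (zs (val i)%:~R ^+ 3 = 1)%g}.
  by move=> i _; apply: (zshift3 rel_ab rel_s').
have z2 : {in B &, forall i j : point, i != j ->
    ((zs (val i)%:~R * zs (val j)%:~R) ^+ 2 = 1)%g}.
  move=> i j; rewrite !inE => i_in j_in ij.
  apply: (zshift2 p_pr p11 gen_r sr rel_ab rel_s' rel_z').
  by apply: contra ij => /eqP/(Fp_rep_inj i_in j_in)/val_inj->.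
have [f [fM fx]] := carmichael uv uB vB z3 z2; exists f; split; first by rewrite P1E.
move=> i i_in; have [x Ex] : exists x : point, i = val x.
  by apply: pointP; rewrite mem_points //; lia.
by rewrite Ex -cycle3_zi ?fx ?eval_G_zi // inE -Ex.
Qed.

Section Hom.
Variable f : {perm point} -> G.
Hypothesis fM : {in alt_on P1 &, {morph f : t1 t2 / (t1 * t2)%g}}.
Hypothesis fz : forall i, 1 <= i <= q -> f (E (wzi p i)) = R (wzi p i).

Let eval_P1' e : yfree e -> E e \in alt_on P1 := @eval_P1 e.

(** If x permutes the images of the generators as t permutes the generators, then two homomorphisms
    agree on the generators, hence everywhere. *)
Let f_conj (t : {perm point}) (x : G) : t \in alt_on P1 ->
  (forall i, 1 <= i <= q -> exists2 j, 1 <= j <= q &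
     (E (wzi p i) ^ t)%g = E (wzi p j) /\ (R (wzi p i) ^ x)%g = R (wzi p j)) ->
  {in alt_on P1, forall s, (f s ^ x)%g = f (s ^ t)%g}.
Proof.
move=> t_on tx; rewrite P1E; apply: (eq_alt_on_morph uv uB vB) => [s1 s2|s1 s2|i iB].
- by rewrite -P1E => s1_on s2_on; rewrite fM // conjMg.
- by rewrite -P1E => s1_on s2_on; rewrite conjMg fM // groupJ.
rewrite cycle3_zi //; move: iB; rewrite inE => i_in.
by have [j j_in [-> Rj]] := tx _ i_in; rewrite !fz.
Qed.

Lemma f_conj_a : {in alt_on P1, forall s, (f s ^ a)%g = f (s ^ sa)%g}.
Proof.
apply: f_conj => [|i i_in]; first exact: sigma_a_P1.
exists (if i == q then 1 else i + 1); first by case: eqP; lia.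
have mod_eq : (i + 1 = (if i == q then 1 else i + 1) %[mod q])%Z.
  by case: eqP => [->|] //; rewrite modzDl.
split.
  transitivity (E (wzi p (i + 1)%R)); last exact: eq_wzi.
  exact: (@eval_ziJ i 1).
rewrite !eval_G_zi -(proj2 (Fp_int_eq p_pr _ _) mod_eq) rmorphD /=.
by rewrite -(zshiftJ p_pr rel_ab rel_s') apow_a.
Qed.

Lemma f_conj_b : {in alt_on P1, forall s, (f s ^ R wb)%g = f (s ^ sb)%g}.
Proof.
apply: f_conj => [|i i_in]; first by rewrite /sb -(eval_b); apply: eval_P1.
have [bi_in bi] := b_res i_in; exists (ev sb i) => //; split; first exact: sb_zi.
rewrite !eval_G_zi -[R wb]/(g ^+ 3)%g (zshift_conj p_pr sr rel_ab rel_s').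
by congr (zs _); rewrite bi mulrC.
Qed.

Lemma commute_divg (x x' w : G) : (w ^ x = w ^ x')%g -> commute (x * x'^-1)%g w.
Proof.
move=> wx; apply/commute_sym/commgP; rewrite -conjg_fix conjgM wx.
by rewrite -conjgM mulgV conjg1.
Qed.

Let fJ := pmorphJ fM.
Let fX := pmorphX fM.
Let fV := pmorphV fM.

Let sb_P1 : sb \in alt_on P1.
Proof. by rewrite /sb -eval_b; apply: eval_P1. Qed.

(** The discrepancies between a, b and the images of their permutations. Both centralize the image
    of f by [f_conj_a] and [f_conj_b], and both will turn out to be trivial. *)
Let a' := locked (a * (f sa)^-1)%g.
Let b' := locked (R wb * (f sb)^-1)%g.

Let a'E : a = (a' * f sa)%g.
Proof. by rewrite /a' -lock mulgVK. Qed.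

Let b'E : R wb = (b' * f sb)%g.
Proof. by rewrite /b' -lock mulgVK. Qed.

Let a'_comm t : t \in alt_on P1 -> commute a' (f t).
Proof.
by move=> t_on; rewrite /a' -lock; apply: commute_divg; rewrite f_conj_a // fJ // sigma_a_P1.
Qed.

Let b'_comm t : t \in alt_on P1 -> commute b' (f t).
Proof. by move=> t_on; rewrite /b' -lock; apply: commute_divg; rewrite f_conj_b // fJ. Qed.

Let sb_m : (sb ^+ m = 1)%g.
Proof. by rewrite /sb -mulpermX (r_half p_pr p11 gen_r) mulperm1. Qed.

Let Rb_m : (R wb ^+ m = 1)%g.
Proof. exact: (affine_bm rel_ab rel_s'). Qed.

Let b'_m : (b' ^+ m = 1)%g.
Proof.
have fb_m : (f sb ^+ m = 1)%g by rewrite -fX // sb_m (pmorph1 fM).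
by rewrite -[RHS]Rb_m b'E [RHS]expgMn ?fb_m ?mulg1 //; apply: b'_comm.
Qed.

Let zi_P1 (i : int) : E (wzi p i) \in alt_on P1.
Proof. exact: eval_P1. Qed.

Let f_zi (i j : int) : 1 <= j <= q -> (i = j %[mod q])%Z -> f (E (wzi p i)) = R (wzi p i).
Proof.
move=> j_in ij; rewrite (eq_wzi ij) fz // !eval_G_zi.
by rewrite (proj2 (Fp_int_eq p_pr _ _) ij).
Qed.

Let f_atilde : f (E (watilde p)) = R (watilde p).
Proof.
have EM e1 e2 : E (Mul e1 e2) = (E e1 * E e2)%g by [].
have RM e1 e2 : R (Mul e1 e2) = (R e1 * R e2)%g by [].
rewrite /watilde (evalJ sigma_env) (evalJ rho) EM RM.
by rewrite (fJ (zi_P1 3) (groupM (zi_P1 2) (zi_P1 1))) (fM (zi_P1 2) (zi_P1 1)) !fz //;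
  apply: small_in.
Qed.

(** The base of the power h is b'^2 times the image of a permutation whose power m + 1 is trivial by
    [eval_h]. So h is b'^(2(m+1)), and b'^m = 1. *)
Let R_h : R (wh p) = (b' ^+ 2)%g.
Proof.
have [_ m_odd _] := half_p p_pr p11.
have Ez : (-1 = q - 1 %[mod q])%Z by rewrite -modzDr addrC.
have -> : R (wh p) = ((R wb ^+ 2 * R (wzi p 1) * R (wzi p (-1))) ^+ m.+1)%g.
  rewrite -[LHS]/((R wb ^+ 2 * R (wzi p 1%R) * R (wzi p (-1)%R)) ^+ p.+1./2)%g.
  by rewrite half_succ.
set w := (sb ^+ 2 * E (wzi p 1) * E (wzi p (-1)))%g.
have b2_on : (sb ^+ 2)%g \in alt_on P1 by apply: groupX.
have w1_on : (sb ^+ 2 * E (wzi p 1))%g \in alt_on P1 by apply: groupM.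
have w_on : w \in alt_on P1 by apply: groupM.
have w_m : (w ^+ m.+1 = 1)%g.
  have := eval_h; rewrite -[E (wh p)]/((E wb ^+ 2 * E (wzi p 1%R) * E (wzi p (-1)%R)) ^+ p.+1./2)%g.
  by rewrite eval_b half_succ.
have -> : (R wb ^+ 2 * R (wzi p 1) * R (wzi p (-1)))%g = (b' ^+ 2 * f w)%g.
  have in1 : 1 <= q - 1 <= q by apply: small_in; rewrite eqxx orbT.
  rewrite -(f_zi in1 Ez) -(@f_zi 1 1) //; last exact: small_in.
  rewrite b'E expgMn; last exact: b'_comm.
  by rewrite /w (fM w1_on) // (fM b2_on) // fX // !mulgA.
rewrite expgMn; last by apply/commute_sym/commuteX/commute_sym/b'_comm.
rewrite -fX // w_m (pmorph1 fM) mulg1 -expgM mulnS mulnC expgD expgM b'_m.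
by rewrite expg1n mulg1.
Qed.

(** The relation makes [watilde] times h conjugate to [watilde], which has trivial cube. The two
    factors commute, so b'^6 = h^3 = 1, while b'^m = 1 with m prime to 6. *)
Let b'1 : b' = 1%g.
Proof.
have [_ m_odd m6] := half_p p_pr p11.
have at3 : (R (watilde p) ^+ 3 = 1)%g.
  by rewrite /watilde evalJ -conjXg eval_G_zi (zshift3 rel_ab rel_s') conj1g.
have at_on : E (watilde p) \in alt_on P1 by apply: eval_P1.
have: ((R (watilde p) * R (wh p)) ^+ 3 = 1)%g.
  apply/eqP; rewrite -(conjg_eq1 _ y) conjXg.
  by move: rel_h; rewrite evalJ => <-; rewrite at3.
rewrite R_h expgMn; last first.
  by apply: commuteX; rewrite -f_atilde; apply/commute_sym/b'_comm.
rewrite at3 mul1g -expgM => b'6; have := expg_gcdn_eq1 b'6 b'_m.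
have -> : gcdn (2 * 3) m = 1%N by rewrite -gcdn_modr m6.
by rewrite expg1.
Qed.

Let f_sb : f sb = R wb.
Proof. by rewrite b'E b'1 mul1g. Qed.

(** Conjugation by b fixes a' and raises both a and f(sa) to the power r, whence a' = a'^r. Since
    a'^p = 1 and r - 1 is prime to p, a' is trivial. *)
Let a'1 : a' = 1%g.
Proof.
have a'_p : (a' ^+ p = 1)%g.
  have := ap; rewrite {1}a'E expgMn; last exact/a'_comm/sigma_a_P1.
  by rewrite -fX ?sigma_a_P1 // sigma_aX (pmorph1 fM) mulg1.
have a'b : (a' ^ R wb = a')%g by apply: commute_conj; rewrite -f_sb; apply: a'_comm.
have ab : (a ^ R wb = a ^+ (val r : nat))%g.
  have := apow_conj p_pr sr rel_ab rel_s' 1; rewrite apow_a mul1r; exact.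
have fab : (f sa ^ R wb = f sa ^+ (val r : nat))%g.
  by rewrite -f_sb -fJ ?sigma_a_P1 // sigma_ab fX ?sigma_a_P1.
have : (a' = a' ^+ (val r : nat))%g.
  apply: (mulIg (f sa ^+ (val r : nat))%g); rewrite -{1}fab -{1}a'b -conjMg -a'E ab.
  by rewrite {1}a'E expgMn //; exact/a'_comm/sigma_a_P1.
have r_lt : ((val r : nat) < p)%N := Fp_val_lt p_pr (val r).
have r_gt : (1 < (val r : nat))%N := r_gt1 p_pr p11 gen_r.
move: (val r : nat) r_lt r_gt => [|j] // j_lt j0; rewrite expgS -{1}[a']mulg1.
move/mulgI/esym => a'j; have := expg_gcdn_eq1 a'j a'_p.
have /eqP-> : coprime j p by rewrite coprime_sym prime_coprime //; apply/negP=> /dvdn_leq;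
  clear - j_lt j0; lia.
by rewrite expg1.
Qed.

Let f_sa : f sa = a.
Proof. by rewrite [RHS]a'E a'1 mul1g. Qed.

Let f_sg : f sg = g.
Proof.
have [_ _ m6] := half_p p_pr p11.
(* As 3(m %/ 3 + 1) = m + 1, g is a product of powers of g^3 = b and g^m = z, whose images are
   already known. *)
have gE (H : groupType) (x : H) : (x = (x ^+ 3) ^+ (m %/ 3).+1 * (x ^+ m)^-1)%g.
  by rewrite -expgM m_third expgD mulgK.
have fz0 : f sz = (g ^+ m)%g.
  have q_in : 1 <= q <= q by apply: small_in; rewrite eqxx orbT.
  have -> : sz = E (wzi p q) by rewrite eval_zi.
  rewrite fz //.
  rewrite eval_G_zi q0; exact: zshift0.
have sz_on : sz \in alt_on P1 by rewrite -eval_z; apply: eval_P1.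
have -> : sg = (sb ^+ (m %/ 3).+1 * sz^-1)%g by rewrite {1}[sg]gE -eval_z /sb -eval_b.
by rewrite fM ?groupX ?groupV // fX // fV // f_sb fz0 -gE.
Qed.

Lemma hom_private1_eval e : yfree e -> f (E e) = R e.
Proof.
move=> Ye; rewrite eval0 // (pmorph_eval fM) //.
apply: yfree_eval Ye => i; case: i => [[|[|[|i]]] i_lt] //= _.
  rewrite -[env0 _]/sa f_sa; congr rho; exact: val_inj.
rewrite -[env0 _]/sg f_sg; congr rho; exact: val_inj.
Qed.

End Hom.

End Presented.
End LocalHom.

(** * Generating the alternating group on 1, ..., k *)

Let one_in : (1 : int) \in points.
Proof. by rewrite mem_points; arith. Qed.

Definition pt (x : int) : point := insubd (SeqSub one_in : point) x.

Lemma ptK (x : int) : K - q - 1 <= x <= q + 2 -> val (pt x) = x.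
Proof. by move=> x_in; rewrite val_insubd [_ \in _]mem_points // x_in. Qed.

Lemma val_range (x : point) : K - q - 1 <= val x <= q + 2.
Proof. by rewrite -mem_points //; apply: valP. Qed.

Lemma valK_pt (x : point) : pt (val x) = x.
Proof. by apply: val_inj; rewrite ptK // val_range. Qed.

Lemma pt_eq (x w : int) : K - q - 1 <= x <= q + 2 -> K - q - 1 <= w <= q + 2 ->
  (pt x == pt w) = (x == w).
Proof. by move=> x_in w_in; rewrite -(inj_eq val_inj) !ptK. Qed.

Lemma cyc3_pt (x u v : int) : K - q - 1 <= x <= q + 2 -> K - q - 1 <= u <= q + 2 ->
  K - q - 1 <= v <= q + 2 -> u != v -> x != u -> x != v ->
  cyc [:: x; u; v] = cycle3 (pt u) (pt v) (pt x).
Proof.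
move=> x_in u_in v_in uv xu xv.
by rewrite -(cyc3_cycle3 (i := pt x)) ?pt_eq // !ptK.
Qed.

Lemma alt_on_sub (u v : point) (A : {set point}) (H : {group {perm point}}) :
  u != v -> u \notin A -> v \notin A -> {in A, forall i, cycle3 u v i \in H} ->
  forall t, t \in alt_on ([set u; v] :|: A) -> t \in H.
Proof.
move=> uv uA vA AH; apply: alt_on_ind => // t i _ iA tH.
by rewrite groupM // AH.
Qed.

(** The fixed points of y, which are also the overlap of the positive points with their image under
    y. *)
Definition common : {set point} := [set x : point | 1 <= val x <= K].
Local Notation P12 := common.

Lemma cyc3_prod (x u v w : int) : pcycle [:: x; u; v] -> pcycle [:: x; v; w] ->
  pcycle [:: x; u; w] -> (cyc [:: x; u; v] * cyc [:: x; v; w])%g = cyc [:: x; u; w].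
Proof.
move=> p1 p2 p3; rewrite (@cyc_cat _ _ x [:: u] [:: v]) // (@cyc_cat _ _ x [:: v] [:: w]) //.
rewrite (@cyc_cat _ _ x [:: u] [:: w]) // -mulgA [X in (_ * X)%g]mulgA cyc2_sq ?mul1g //.
by apply: pcycle_sub p2; rewrite /= !eqxx.
Qed.

(** For n odd, conjugation by (1, ..., k) gives all (j, j+1, j+2), and these carry (1, 2, i) to (1,
    2, i+1). For n even, conjugation by (2, ..., k) gives all (1, j, j+1), and (1, 2, i)(1, i, i+1)
    = (1, 2, i+1). Either way H contains Carmichael's generators. *)
Lemma common_sub (H : {group {perm point}}) :
  cyc [:: 1; 2; 3]%R \in H -> E (wc n p) \in H -> forall t, t \in alt_on P12 -> t \in H.
Proof.
rewrite eval_cw => H123 Hc.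
have pc (i j l : int) : 1 <= i <= K -> 1 <= j <= K -> 1 <= l <= K ->
    i != j -> i != l -> j != l -> pcycle [:: i; j; l].
  by move=> *; apply: pcycle3; arith.
have chain (i : nat) : (3 <= i <= k)%N -> cyc [:: 1; 2; i%:Z]%R \in H.
  have [n_odd | n_even] := boolP (odd n).
    rewrite n_odd in Hc.
    have tri (j : nat) : (1 <= j)%N -> (j + 2 <= k)%N ->
        cyc [:: j%:Z; j%:Z + 1; j%:Z + 2] \in H.
      elim: j => // j IHj _ j_le; have [-> | j0] := eqVneq j 0%N; first exact: H123.
      have /groupJ/(_ Hc) := IHj ltac:(arith) ltac:(arith).
      rewrite cycJ /=; last by apply: pc; arith.
      have -> : [:: j.+1%:Z; j.+1%:Z + 1; j.+1%:Z + 2] =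
          [:: j%:Z + 1; j%:Z + 1 + 1; j%:Z + 2 + 1] by congr [:: _; _; _]; arith.
      by rewrite !ev_irange; [rewrite !ifT //; arith | arith ..].
    elim: i => // i IHi i_in; have [-> | i3] := eqVneq i 2%N; first exact: H123.
    have Hi := IHi ltac:(arith).
    (* The conjugating cycle must fix 1 and 2, so l starts at 3; otherwise l = i - 1 keeps l + 2
       within k. *)
    have [l [l_ge l_le Hl]] : exists l : nat, [/\ (3 <= l)%N, (l + 2 <= k)%N &
        (i = l) \/ (i = l.+1)].
      by exists (if i == 3%N then 3 else i.-1); case: eqP => ?; split; arith.
    have tl := tri l ltac:(arith) l_le.
    have := groupJ Hi tl; rewrite cycJ; last by apply: pc; arith.
    have pl : pcycle [:: l%:Z; l%:Z + 1; l%:Z + 2] by apply: pc; arith.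
    have e1 : ev (cyc [:: l%:Z; l%:Z + 1; l%:Z + 2]) 1 = 1.
      by apply: ev_cyc_out => //; rewrite !inE; arith.
    have e2 : ev (cyc [:: l%:Z; l%:Z + 1; l%:Z + 2]) 2 = 2.
      by apply: ev_cyc_out => //; rewrite !inE; arith.
    rewrite /= e1 e2; suff -> : ev (cyc [:: l%:Z; l%:Z + 1; l%:Z + 2]) i%:Z = i.+1%:Z by [].
    rewrite (ev_cyc3 _ pl); case: Hl => ->; first by rewrite eqxx; arith.
    by rewrite ifF ?ifT; arith.
  rewrite (negPf n_even) in Hc.
  have tri (j : nat) : (2 <= j)%N -> (j + 1 <= k)%N -> cyc [:: 1; j%:Z; j%:Z + 1]%R \in H.
    elim: j => // j IHj j_ge j_le; have [-> | j0] := eqVneq j 1%N; first exact: H123.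
    have /groupJ/(_ Hc) := IHj ltac:(arith) ltac:(arith).
    rewrite cycJ /=; last by apply: pc; arith.
    have -> : [:: 1; j.+1%:Z; j.+1%:Z + 1] = [:: 1; j%:Z + 1; j%:Z + 1 + 1].
      by congr [:: _; _; _]; arith.
    have e1 : ev (cyc (irange 2 K)) 1 = 1.
      by apply: ev_cyc_out; [apply: pcycle_irange; arith | rewrite mem_irange; arith].
    by rewrite e1 !ev_irange; [rewrite !ifT //; arith | arith ..].
  elim: i => // i IHi i_in; have [-> | i3] := eqVneq i 2%N; first exact: H123.
  have Hi := IHi ltac:(arith); have ti := tri i ltac:(arith) ltac:(arith).
  have := groupM Hi ti; rewrite cyc3_prod; try by apply: pc; arith.
  by have -> : i%:Z + 1 = i.+1%:Z by arith.
move=> t; have P12E : P12 = [set pt 1; pt 2] :|: [set x : point | 3 <= val x <= K].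
  apply/setP=> x; rewrite !inE -!(inj_eq val_inj) !ptK; try arith.
  by move: (val x) => w; arith.
rewrite P12E; apply: alt_on_sub.
- by rewrite pt_eq; arith.
- by rewrite inE ptK; arith.
- by rewrite inE ptK; arith.
move=> x; rewrite inE => x_in; rewrite -[x]valK_pt -cyc3_pt ?val_range //; try arith.
have := chain (absz (val x)) ltac:(move: (val x) x_in; arith).
rewrite gez0_abs; last by move: (val x) x_in; arith.
have px : pcycle [:: 1; 2; val x] by apply: pc; move: (val x) x_in; arith.
by rewrite -(cyc_rot 2 px).
Qed.

(** * Gluing two alternating groups *)

Lemma pcycle_ew : pcycle (if odd n then 1 :: irange (K + 1) (q + 2)
                 else 1 :: 2 :: irange (K + 1) (q + 2)).
Proof.
have pall : pcycle (irange 1 K ++ irange (K + 1) (q + 2)).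
  by rewrite -irange_cat; [apply: pcycle_irange; arith | arith | arith].
apply: pcycle_sub pall; rewrite -if_neg; case: ifP => _.
  rewrite -[1 :: 2 :: _]/([:: 1; 2] ++ _) (@irange_cat 2 1 K); try arith.
  rewrite (irange2 1 : irange 1 2 = [:: 1; 2]) -catA.
  by apply: cat_subseq => //; apply: suffix_subseq.
rewrite -[1 :: _]/([:: 1] ++ _) (@irange_cat 1 1 K); try arith.
by rewrite irange1 -catA; apply: cat_subseq => //; apply: suffix_subseq.
Qed.

Let pe := pcycle_ew.

Section Glue.
Variables (G : groupType) (rho : 'I_3 -> G) (f : {perm point} -> G).
Local Notation R := (eval rho).
Local Notation y := (R wy).
Hypothesis fM : {in alt_on P1 &, {morph f : s t / (s * t)%g}}.
Hypothesis fe : forall e, yfree e -> f (E e) = R e.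
Hypothesis rel_h : R (watilde p) = R ((watilde p * wh p) ^ wy)%W.
Hypothesis rel_c : R (wc n p) = R (wc n p ^ wy)%W.
Hypothesis rel_d : R (Comm (wd p) (Conj (we n p) wy)) = 1%g.

Let yfree_c : yfree (wc n p).
Proof. by rewrite /wc; case: ifP => _; apply: yfree_wcij. Qed.

Let yfree_d : yfree (wd p).
Proof. exact: yfree_wcij. Qed.

Let yfree_e : yfree (we n p).
Proof. by rewrite /we; case: ifP => _ /=; rewrite yfree_wcij. Qed.

Let R_h : R (wh p) = 1%g.
Proof. by rewrite -fe // eval_h (pmorph1 fM). Qed.

Let P12_P1 t : t \in alt_on P12 -> t \in alt_on P1.
Proof. by apply: alt_onS; apply/subsetP=> x; rewrite !inE => /andP[]. Qed.

(** Since h = 1 in G, the relations say that y commutes with the images of (1, 2, 3) and c, which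
    generate by [common_sub]. *)
Lemma common_agree t : t \in alt_on P12 -> (f t ^ y = f t)%g.
Proof.
move=> t_on; pose H := equalizer (conj_morph fM y) fM.
suff /equalizerP[] : t \in H by [].
apply: common_sub t_on; apply/equalizerP.
  rewrite -eval_atilde; split; first exact: eval_P1.
  by rewrite fe // {2}rel_h evalJ -[R (_ * _)%W]/(R (watilde p) * R (wh p))%g R_h mulg1.
by split; [apply: eval_P1 | rewrite fe // {2}rel_c evalJ].
Qed.

Let in_range (x : int) : Prop := K - q - 1 <= x <= q + 2.

Let cyc_even (c : seq int) : pcycle c -> odd (size c) -> ~~ odd_perm (cyc c).
Proof. by move=> pc c_odd; rewrite odd_cyc // c_odd. Qed.

Lemma cyc_P12 (c : seq int) : pcycle c -> odd (size c) -> all (fun x => 1 <= x <= K) c ->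
  cyc c \in alt_on P12.
Proof.
move=> pc c_odd /allP c_in; rewrite alt_onE cyc_even // andbT.
apply: perm_on_fix => x; rewrite inE => x_out; apply: val_inj.
by rewrite -ev_val ev_cyc_out //; apply: contra x_out => /c_in.
Qed.

Lemma cyc2_P12 (c1 c2 : seq int) : pcycle c1 -> pcycle c2 -> size c1 = 2 -> size c2 = 2 ->
  all (fun x => 1 <= x <= K) c1 -> all (fun x => 1 <= x <= K) c2 ->
  (cyc c1 * cyc c2)%g \in alt_on P12.
Proof.
move=> p1 p2 s1 s2 /allP c1_in /allP c2_in; rewrite alt_onE odd_permM !odd_cyc // s1 s2 /=.
rewrite -!size_eq0 s1 s2 /= andbT.
apply: perm_on_fix => x; rewrite inE => x_out; apply: val_inj.
rewrite -ev_val evM (ev_cyc_out p1) ?(ev_cyc_out p2) //.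
  by apply: contra x_out => /c2_in.
by apply: contra x_out => /c1_in.
Qed.

Lemma cyc_P1 (c : seq int) : pcycle c -> odd (size c) -> all (fun x => 1 <= x) c ->
  cyc c \in alt_on P1.
Proof.
move=> pc c_odd /allP c_in; apply: alt_on_P1 => [|x x_lt]; first exact: cyc_even.
by apply: ev_cyc_out => //; apply: contraTN x_lt => /c_in; rewrite leNgt.
Qed.

Let ev_d (x : int) : 5 <= x -> x < q + 2 -> ev (E (wd p)) x = x + 1.
Proof. by move=> x5 xq; rewrite eval_dw ev_irange ?ifT //; arith. Qed.

Let ev_e_out (x : int) : 2 < x -> x <= K -> ev (E (we n p)) x = x.
Proof.
move=> x2 xK; rewrite eval_ew; apply: ev_cyc_out pe _.
by case: ifP => _; rewrite !inE !negb_or mem_irange; arith.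
Qed.

Let ev_e (x : int) : K + 1 <= x -> x < q + 2 -> ev (E (we n p)) x = x + 1.
Proof.
move=> x_ge x_lt; rewrite eval_ew.
have Ex : irange (K + 1) (q + 2) = irange (K + 1) (x - 1) ++ x :: x + 1 :: irange (x + 1 + 1) (q + 2).
  rewrite (@irange_cat (x - 1)) ?subrK; try arith.
  by rewrite (@irange_cons x) ?(@irange_cons (x + 1)) //; arith.
move: pe; case: ifP => _; rewrite Ex.
  by rewrite -cat_cons => px; apply: ev_cyc_mid.
by rewrite -!cat_cons => px; apply: ev_cyc_mid.
Qed.

Let ev_e_first : exists2 j : nat, (j <= 2)%N & ev (E (we n p) ^+ j)%g 1 = K + 1.
Proof.
rewrite eval_ew; have := pe; rewrite (@irange_cons (K + 1)); last arith.
case: ifP => _ px; [exists 1%N | exists 2%N] => //.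
  by rewrite expg1 -[1 :: _]/([::] ++ _) ev_cyc_mid.
rewrite expg2 evM -[1 :: _]/([::] ++ 1 :: 2 :: _) ev_cyc_mid //.
by rewrite -[[::] ++ _]/([:: 1] ++ 2 :: (K + 1) :: _) ev_cyc_mid.
Qed.

Let p3 (i j l : int) : 1 <= i <= q + 2 -> 1 <= j <= q + 2 -> 1 <= l <= q + 2 ->
  i != j -> i != l -> j != l -> pcycle [:: i; j; l].
Proof. by move=> *; apply: pcycle3; arith. Qed.

Let p2 (i j : int) : 1 <= i <= q + 2 -> 1 <= j <= q + 2 -> i != j -> pcycle [:: i; j].
Proof. by move=> *; apply: pcycle2; arith. Qed.

Let comm_de : commute (R (wd p)) (R (we n p) ^ y)%g.
Proof. by move: rel_d; rewrite evalR evalJ => /eqP/commgP. Qed.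

(** For i = 5 the 3-cycle is centralized by y and disjoint from e. Conjugation by d, which commutes
    with e^y by [rel_d], carries (i, 3, 4) to (i+1, 3, 4). *)
Let comm_34_e (i : int) : 5 <= i <= q + 2 ->
  commute (f (cyc [:: i; 3; 4])) (R (we n p) ^ y)%g.
Proof.
move=> i_in; have fyM := conj_morph fM (R (we n p) ^ y)%g.
suff /equalizerP[_ /commute_fix //] : cyc [:: i; 3; 4] \in equalizer fyM fM by [].
have dH : E (wd p) \in equalizer fyM fM.
  apply/equalizerP; split; first exact: eval_P1.
  by rewrite fe //; apply: commute_conj.
have [t Et] : exists t : nat, i = 5 + t%:Z by exists (absz (i - 5)); arith.
elim: t i Et i_in => [|t IHt] i -> i_in.
  have p534 : pcycle [:: 5; 3; 4] by apply: p3; arith.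
  have c534 : cyc [:: 5; 3; 4] \in alt_on P12.
    by apply: cyc_P12 => //=; arith.
  rewrite addr0; apply/equalizerP; split; first exact: P12_P1.
  rewrite -(common_agree c534) -(fe yfree_e); apply: commute_conj; apply: commuteJ.
  apply: (pmorph_commute fM); [exact: P12_P1 | exact: eval_P1 | ].
  rewrite eval_ew; apply: cyc_commute => //; apply/hasPn => x.
  by case: ifP => _; rewrite !inE mem_irange; arith.
have Et : 5 + t.+1%:Z = 5 + t%:Z + 1 by arith.
have := groupJ (IHt _ erefl ltac:(arith)) dH; rewrite cycJ /=; last by apply: p3; arith.
have [e3 e4] : ev (E (wd p)) 3 = 3 /\ ev (E (wd p)) 4 = 4.
  have pd : pcycle (irange 5 (q + 2)) by apply: pcycle_irange; arith.
  by rewrite eval_dw; split; apply: (ev_cyc_out pd); rewrite mem_irange; arith.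
by rewrite e3 e4 ev_d -?Et //; arith.
Qed.

(** The t with f(t)^y commuting with f of (i, 3, 4) form a group. It contains e by [comm_34_e], and
    (1, 5, 6), which is centralized by y and disjoint from (i, 3, 4). Conjugating by e, which fixes
    5 and 6, gives (l, 5, 6) for each l > k, and so (1, j)(5, 6). *)
Let comm_34_56 (i j : int) : K + 1 <= i <= q + 2 -> K + 1 <= j <= q + 2 ->
  commute (f (cyc [:: i; 3; 4])) (f (cyc [:: 1; j]%R * cyc [:: 5; 6]%R)%g ^ y)%g.
Proof.
move=> i_in j_in; have fyM := conj_morph fM y.
have fyzM := conj_morph fyM (f (cyc [:: i; 3; 4])).
set H := equalizer fyzM fyM.
have eH : E (we n p) \in H.
  apply/equalizerP; split; first exact: eval_P1.
  by apply/commute_fix/commute_sym; rewrite fe //; apply: comm_34_e; arith.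
have pi : pcycle [:: i; 3; 4] by apply: p3; arith.
have p1 : pcycle [:: 1; 5; 6] by apply: p3; arith.
have H1 : cyc [:: 1; 5; 6]%R \in H.
  have c156 : cyc [:: 1; 5; 6]%R \in alt_on P12 by apply: cyc_P12 => //=; arith.
  apply/equalizerP; split; first exact: P12_P1.
  apply/commute_fix; rewrite common_agree //; apply: (pmorph_commute fM).
  - exact: P12_P1.
  - by apply: cyc_P1 => //=; arith.
  by apply: cyc_commute => //; rewrite /= !inE; arith.
have [e5 e6] : ev (E (we n p)) 5 = 5 /\ ev (E (we n p)) 6 = 6.
  by split; apply: ev_e_out; arith.
have HK (l : int) : K + 1 <= l <= q + 2 -> cyc [:: l; 5; 6] \in H.
  move=> l_in; have [t Et] : exists t : nat, l = K + 1 + t%:Z.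
    by exists (absz (l - (K + 1))%R); arith.
  elim: t l Et l_in => [|t IHt] l -> l_in.
    have [t _ et] := ev_e_first.
    have := groupJ H1 (groupX t eH); rewrite cycJ // addr0 /= et.
    by rewrite !evX_fix.
  have := groupJ (IHt _ erefl ltac:(arith)) eH; rewrite cycJ /=; last by apply: p3; arith.
  have Et : K + 1 + t.+1%:Z = K + 1 + t%:Z + 1 by arith.
  by rewrite e5 e6 ev_e -?Et //; arith.
have c_on : (cyc [:: 1; j]%R * cyc [:: 5; 6]%R)%g \in alt_on ([set pt 5; pt 6] :|: [set pt 1; pt j]).
  have p1j : pcycle [:: 1; j] by apply: p2; arith.
  have p56 : pcycle [:: 5; 6] by apply: p2; arith.
  rewrite alt_onE odd_permM !odd_cyc //= andbT.
  apply: perm_on_fix => x; rewrite !inE -!(inj_eq val_inj) !ptK; try arith.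
  move=> x_out; apply: val_inj; rewrite -ev_val evM (ev_cyc_out p1j) ?(ev_cyc_out p56) //.
    by apply: contra x_out; rewrite !inE => ->.
  by apply: contra x_out; rewrite !inE => ->; rewrite orbT.
suff /equalizerP[_ /commute_fix/commute_sym //] : (cyc [:: 1; j]%R * cyc [:: 5; 6]%R)%g \in H by [].
apply: alt_on_sub c_on.
- by rewrite pt_eq; arith.
- by rewrite !inE !pt_eq; arith.
- by rewrite !inE !pt_eq; arith.
move=> x /set2P[] ->.
  by rewrite -cyc3_pt; [exact: H1 | arith ..].
by rewrite -cyc3_pt; [apply: HK | arith ..].
Qed.

(** Now the element conjugated by y is held fixed. Its centralizer contains the images of (i, 3, 4),
    by [comm_34_56], and of (2, 3, 4), by disjointness; these generate the alternating group on 2,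
    3, 4, i. *)
Let comm_2i_1j (i j : int) : K + 1 <= i <= q + 2 -> K + 1 <= j <= q + 2 ->
  commute (f (cyc [:: 2; i]%R * cyc [:: 3; 4]%R)%g)
          (f (cyc [:: 1; j]%R * cyc [:: 5; 6]%R)%g ^ y)%g.
Proof.
move=> i_in j_in; set d := (f _ ^ y)%g; have fdM := conj_morph fM d.
set H := equalizer fdM fM.
have p1j : pcycle [:: 1; j] by apply: p2; arith.
have p56 : pcycle [:: 5; 6] by apply: p2; arith.
have p2i : pcycle [:: 2; i] by apply: p2; arith.
have p34 : pcycle [:: 3; 4] by apply: p2; arith.
have pi : pcycle [:: i; 3; 4] by apply: p3; arith.
have p234 : pcycle [:: 2; 3; 4] by apply: p3; arith.
have H1 : cyc [:: i; 3; 4] \in H.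
  apply/equalizerP; split; first by apply: cyc_P1 => //=; arith.
  by apply/commute_fix/comm_34_56.
have H2 : cyc [:: 2; 3; 4] \in H.
  have c234 : cyc [:: 2; 3; 4] \in alt_on P12 by apply: cyc_P12 => //=; arith.
  apply/equalizerP; split; first exact: P12_P1.
  apply/commute_fix; rewrite -(common_agree c234); apply: commuteJ.
  apply: (pmorph_commute fM); first exact: P12_P1.
    apply: alt_on_P1; first by rewrite odd_permM !odd_cyc.
    by move=> x x_lt; rewrite evM (ev_cyc_out p1j) ?(ev_cyc_out p56) // !inE; arith.
  by apply: commuteM; apply: cyc_commute => //; rewrite /= !inE; arith.
have c_on : (cyc [:: 2; i]%R * cyc [:: 3; 4]%R)%g \in alt_on ([set pt 3; pt 4] :|: [set pt 2; pt i]).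
  rewrite alt_onE odd_permM !odd_cyc //= andbT.
  apply: perm_on_fix => x; rewrite !inE -!(inj_eq val_inj) !ptK; try arith.
  move=> x_out; apply: val_inj; rewrite -ev_val evM (ev_cyc_out p2i) ?(ev_cyc_out p34) //.
    by apply: contra x_out; rewrite !inE => ->.
  by apply: contra x_out; rewrite !inE => ->; rewrite orbT.
suff /equalizerP[_ /commute_fix //] : (cyc [:: 2; i]%R * cyc [:: 3; 4]%R)%g \in H by [].
apply: alt_on_sub c_on.
- by rewrite pt_eq; arith.
- by rewrite !inE !pt_eq; arith.
- by rewrite !inE !pt_eq; arith.
move=> x /set2P[] ->.
  by rewrite -cyc3_pt; [exact: H2 | arith ..].
by rewrite -cyc3_pt; [exact: H1 | arith ..].
Qed.

(* With x = (2 i)(3 4), w = (3 4)(5 6) and t = (5 6)(1 j), the product of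
   (1 2 i) and (1 2 j) is x w t, and x, w, t are commuting involutions. *)
Lemma glue_rel (i j : int) : K + 1 <= i <= q + 2 -> K + 1 <= j <= q + 2 ->
  ((f (cyc [:: i; 1; 2]%R) * f (cyc [:: j; 1; 2]%R) ^ y) ^+ 2 = 1)%g.
Proof.
move=> i_in j_in.
have p1j : pcycle [:: 1; j] by apply: p2; arith.
have p56 : pcycle [:: 5; 6] by apply: p2; arith.
have p2i : pcycle [:: 2; i] by apply: p2; arith.
have p34 : pcycle [:: 3; 4] by apply: p2; arith.
have p12 : pcycle [:: 1; 2] by apply: p2; arith.
have p21 : pcycle [:: 2; 1] by apply: p2; arith.
have p2i1 : pcycle [:: 2; i; 1] by apply: p3; arith.
have p12j : pcycle [:: 1; 2; j] by apply: p3; arith.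
have P1_2 (c1 c2 : seq int) : pcycle c1 -> pcycle c2 -> size c1 = 2 -> size c2 = 2 ->
    all (fun x => 1 <= x) c1 -> all (fun x => 1 <= x) c2 -> (cyc c1 * cyc c2)%g \in alt_on P1.
  move=> pc1 pc2 s1 s2 /allP c1_in /allP c2_in; apply: alt_on_P1.
    by rewrite odd_permM !odd_cyc // s1 s2 /= -!size_eq0 s1 s2.
  move=> x x_lt; rewrite evM (ev_cyc_out pc1) ?(ev_cyc_out pc2) //.
    by apply: contraTN x_lt => /c2_in; rewrite leNgt.
  by apply: contraTN x_lt => /c1_in; rewrite leNgt.
set A := (cyc [:: 2; i]%R * cyc [:: 3; 4]%R)%g.
set B := (cyc [:: 1; j]%R * cyc [:: 5; 6]%R)%g.
set C := (cyc [:: 3; 4]%R * cyc [:: 5; 6]%R)%g.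
have A_on : A \in alt_on P1 by apply: P1_2 => //=; arith.
have B_on : B \in alt_on P1 by apply: P1_2 => //=; arith.
have C_on : C \in alt_on P12 by apply: cyc2_P12 => //=; arith.
have C1_on : (cyc [:: 3; 4]%R * cyc [:: 2; 1]%R)%g \in alt_on P12.
  by apply: cyc2_P12 => //=; arith.
have C2_on : (cyc [:: 1; 2]%R * cyc [:: 5; 6]%R)%g \in alt_on P12.
  by apply: cyc2_P12 => //=; arith.
have cA : commute (cyc [:: 2; i]) (cyc [:: 3; 4]).
  by apply: cyc_commute => //; rewrite /= !inE; arith.
have cB : commute (cyc [:: 1; j]) (cyc [:: 5; 6]).
  by apply: cyc_commute => //; rewrite /= !inE; arith.
have cC : commute (cyc [:: 3; 4]) (cyc [:: 5; 6]).
  by apply: cyc_commute => //; rewrite /= !inE; arith.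
have sq2 (s t : {perm point}) : (s * s = 1)%g -> (t * t = 1)%g -> commute s t ->
    ((s * t) ^+ 2 = 1)%g.
  by move=> s2 t2 st; rewrite expgMn // !expg2 s2 t2 mulg1.
have -> : f (cyc [:: i; 1; 2]%R) = (f A * f (cyc [:: 3; 4]%R * cyc [:: 2; 1]%R))%g.
  rewrite -(fM A_on (P12_P1 C1_on)); congr (f _).
  rewrite (@cyc_rot3 i 1 2) -?(@cyc_rot3 2 i 1) //; last by apply: p3; arith.
  rewrite (@cyc_rot3 1 2 i); last by apply: p3; arith.
  rewrite (@cyc_cat _ _ 2 [:: i] [:: 1%R]) // /A -!mulgA; congr (_ * _)%g.
  by rewrite mulgA cyc2_sq // mul1g.
have -> : (f (cyc [:: j; 1; 2]%R) ^ y =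
    f (cyc [:: 1; 2]%R * cyc [:: 5; 6]%R) * f B ^ y)%g.
  rewrite -{1}(common_agree C2_on) -conjMg -(fM (P12_P1 C2_on) B_on); congr (f _ ^ _)%g.
  rewrite (@cyc_rot3 j 1 2); last by apply: p3; arith.
  rewrite (@cyc_cat _ _ 1 [:: 2%R] [:: j]) // /B cB -!mulgA; congr (_ * _)%g.
  by rewrite mulgA cyc2_sq // mul1g.
have -> : (f A * f (cyc [:: 3; 4]%R * cyc [:: 2; 1]%R) *
    (f (cyc [:: 1; 2]%R * cyc [:: 5; 6]%R) * f B ^ y) = f A * f C * f B ^ y)%g.
  rewrite mulgA -(mulgA (f A)) -(fM (P12_P1 C1_on) (P12_P1 C2_on)).
  have -> : (cyc [:: 3; 4]%R * cyc [:: 2; 1]%R * (cyc [:: 1; 2]%R * cyc [:: 5; 6]%R) = C)%g.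
    by rewrite -mulgA; congr (_ * _)%g; rewrite mulgA (cyc2C p21) cyc2_sq // mul1g.
  by [].
apply: sqg_commute3.
- by rewrite -(pmorphX fM) // sq2 ?(pmorph1 fM) ?cyc2_sq.
- by rewrite -(pmorphX fM) ?P12_P1 // sq2 ?(pmorph1 fM) ?cyc2_sq.
- by rewrite -conjXg -(pmorphX fM) // sq2 ?(pmorph1 fM) ?cyc2_sq ?conj1g.
- apply: (pmorph_commute fM) => //; first exact: P12_P1.
  apply: commuteM; apply/commute_sym/commuteM => //.
  by apply: cyc_commute => //; rewrite /= !inE; arith.
- exact: comm_2i_1j.
rewrite -(common_agree C_on); apply: commuteJ.
apply: (pmorph_commute fM) => //; first exact: P12_P1.
apply: commuteM; apply/commute_sym/commuteM => //.
by apply: cyc_commute => //; rewrite /= !inE; arith.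
Qed.

End Glue.

Lemma sy_common (j : point) : val j <= K -> 1 <= val j -> sy j = j.
Proof. by move=> jK j1; apply: val_inj; rewrite -ev_val ev_y_in // j1. Qed.

Lemma ev_y_high (x : int) : K + 1 <= x <= q + 2 -> ev sy x <= 0.
Proof.
move=> x_in; have [n_odd | n_even] := boolP (odd n).
  by rewrite ev_y_odd // ?mem_points; [case: ifP | ..]; arith.
by rewrite ev_y_even //; do !case: eqP => ?; do ?case: ifP; arith.
Qed.

Lemma ev_y_low (x : int) : K - q - 1 <= x <= 0 -> exists2 l, K + 1 <= l <= q + 2 & ev sy l = x.
Proof.
move=> x_in; have [n_odd | n_even] := boolP (odd n).
  exists (K + 1 - x); first by arith.
  by rewrite ev_y_odd // ?mem_points; [case: ifP | ..]; arith.
have [n1 n2] : (K < q) /\ K + 1 <= q by move: n_even p11; lia.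
exists (if x == - q - 1 + K then q + 1 else if x == - q + K then q + 2 else K + 1 - x).
  by do !case: eqP => ?; arith.
rewrite ev_y_even //; case: (x =P - q - 1 + K) => [->|x1].
  by do !(case: ifP => ?); arith.
case: (x =P - q + K) => [->|x2]; first by do !(case: ifP => ?); arith.
by do !(case: ifP => ?); arith.
Qed.

Lemma high_P1 (l : point) : K + 1 <= val l <= q + 2 -> l \in P1.
Proof. by rewrite inE; move: (val l) => w; arith. Qed.

Lemma sy_image (j : point) : j \notin P1 ->
  exists2 l : point, K + 1 <= val l <= q + 2 & j = sy l.
Proof.
rewrite inE => j1; have [|l l_in El] := @ev_y_low (val j).
  by have := val_range j; move: (val j) j1 => w; arith.
exists (pt l); first by rewrite ptK; arith.
by apply: val_inj; rewrite -ev_val ptK; arith.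
Qed.

Section Extension.
Variables (G : groupType) (rho : 'I_3 -> G) (f : {perm point} -> G).
Local Notation R := (eval rho).
Local Notation y := (R wy).
Hypothesis fM : {in alt_on P1 &, {morph f : s t / (s * t)%g}}.
Hypothesis fe : forall e, yfree e -> f (E e) = R e.
Hypothesis rel_h : R (watilde p) = R ((watilde p * wh p) ^ wy)%W.
Hypothesis rel_c : R (wc n p) = R (wc n p ^ wy)%W.
Hypothesis rel_d : R (Comm (wd p) (Conj (we n p) wy)) = 1%g.
Hypothesis rel_y : y = R (ww n p).

Local Notation u := (pt 1).
Local Notation v := (pt 2).

Let uv : u != v.
Proof. by rewrite pt_eq; arith. Qed.

Let sy_u : sy u = u.
Proof. by apply: sy_common; rewrite ptK; arith. Qed.

Let sy_v : sy v = v.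
Proof. by apply: sy_common; rewrite ptK; arith. Qed.

Let cycle3_high (x : point) : K + 1 <= val x <= q + 2 ->
  cycle3 u v x = cyc [:: val x; 1; 2].
Proof.
rewrite -[in cycle3 _ _ _](valK_pt x); move: (val x) => w w_in.
by rewrite cyc3_pt //; arith.
Qed.

(** Carmichael generators for all points. The base points 1 and 2 are fixed by y, so conjugation by
    y sends the 3-cycle of l to that of y(l). *)
Let X (j : point) : G :=
  if j \in P1 then f (cycle3 u v j) else (f (cycle3 u v (sy^-1%g j)) ^ y)%g.

Let c3_P1 (j : point) : j \in P1 -> j != u -> j != v -> cycle3 u v j \in alt_on P1.
Proof. by move=> j1 ju jv; apply: cycle3_on => //; rewrite inE ptK; arith. Qed.

Let X_P1 (j : point) : j \in P1 -> X j = f (cycle3 u v j).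
Proof. by rewrite /X => ->. Qed.

(** For l at most k the point y(l) = l is positive and X is defined by f; [common_agree] shows that
    conjugating by y gives the same value. *)
Let X_sy (l : point) : l \in P1 -> l != u -> l != v -> X (sy l) = (f (cycle3 u v l) ^ y)%g.
Proof.
move=> l1 lu lv; rewrite /X permK; case: ifP => // syl.
have lK : val l <= K.
  rewrite leNgt; apply/negP => Kl; have := @ev_y_high (val l).
  move: syl; rewrite inE -ev_val; have := val_range l; move: (val l) Kl (ev _ _) => w Kw w'.
  by arith.
rewrite inE in l1; rewrite sy_common // common_agree //.
apply: cycle3_on => //; rewrite inE ?ptK; try arith.
by rewrite l1.
Qed.

Let X_cases (j : point) : (K + 1 <= val j <= q + 2) \/
  exists2 l : point, l \in P1 & j = sy l.
Proof.
have [j1 | /sy_image[l l_in ->]] := boolP (j \in P1); last first.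
  by right; exists l => //; apply: high_P1.
have [jK | Kj] := leP (val j) K; last first.
  by left; have := val_range j; move: (val j) Kj => w; arith.
by right; exists j => //; rewrite sy_common //; rewrite inE in j1.
Qed.

Let X3 (j : point) : j != u -> j != v -> (X j ^+ 3 = 1)%g.
Proof.
have f3 (l : point) : l \in P1 -> l != u -> l != v -> (f (cycle3 u v l) ^+ 3 = 1)%g.
  by move=> l1 lu lv; rewrite -(pmorphX fM) ?c3_P1 // cycle3_cube ?(pmorph1 fM).
have [j1 | /sy_image[l l_in ->]] := boolP (j \in P1); first by rewrite X_P1 //; apply: f3.
rewrite -{1}sy_u -{1}sy_v !(inj_eq perm_inj) => lu lv.
have l1 : l \in P1 by apply: high_P1.
by rewrite X_sy // -conjXg f3 ?conj1g.
Qed.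

(** Two positive points, or two images of positive points under y, inherit the relation from f or
    its conjugate by y. Only a point above k paired with the image of a point above k requires
    [glue_rel]. *)
Let X2 (i j : point) : i != u -> i != v -> j != u -> j != v -> i != j ->
  ((X i * X j) ^+ 2 = 1)%g.
Proof.
have f2 (l l' : point) : l \in P1 -> l != u -> l != v -> l' \in P1 -> l' != u -> l' != v ->
    l != l' -> ((f (cycle3 u v l) * f (cycle3 u v l')) ^+ 2 = 1)%g.
  move=> l1 lu lv l1' lu' lv' ll'.
  rewrite -fM ?c3_P1 // -(pmorphX fM) ?groupM ?c3_P1 //.
  by rewrite cycle3_mul_sq ?(pmorph1 fM).
have syl (l : point) : sy l != u -> sy l != v -> l != u /\ l != v.
  by rewrite -{1}sy_u -{1}sy_v !(inj_eq perm_inj).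
have mixed (l l' : point) : K + 1 <= val l <= q + 2 -> l != u -> l != v ->
    l' \in P1 -> l' != u -> l' != v -> l != sy l' -> ((X l * X (sy l')) ^+ 2 = 1)%g.
  move=> l_in lu lv l1' lu' lv' ll'; have l1 : l \in P1 by apply: high_P1.
  rewrite X_P1 // X_sy //; have [l'K | Kl'] := leP (val l') K.
    have <- : X l' = (f (cycle3 u v l') ^ y)%g.
      by rewrite -X_sy // sy_common //; rewrite inE in l1'.
    rewrite X_P1 // f2 //; apply: contra ll' => /eqP->; rewrite sy_common //.
    by rewrite inE in l1'.
  have l'_in : K + 1 <= val l' <= q + 2 by have := val_range l'; move: (val l') Kl' => w; clear; arith.
  by rewrite !cycle3_high //; apply: glue_rel.
move=> iu iv ju jv ij.
have [i_in | [l l1 Ei]] := X_cases i; have [j_in | [l' l1' Ej]] := X_cases j.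
- by rewrite !X_P1 ?f2 ?high_P1.
- by move: ju jv ij; rewrite Ej => /syl H /H[lu' lv'] ij; apply: mixed.
- move: iu iv ij; rewrite Ei => /syl H /H[lu lv] ij.
  by apply: sqg_rot; apply: mixed => //; rewrite eq_sym.
move: iu iv ju jv ij; rewrite Ei Ej => /syl H /H[lu lv] /syl H' /H'[lu' lv'].
by rewrite (inj_eq perm_inj) => ll'; rewrite !X_sy // -conjMg -conjXg f2 ?conj1g.
Qed.

(** Carmichael's presentation on all points. Agreement with f, and compatibility with y, need only
    be tested on the 3-cycles (j, 1, 2). *)
Lemma extend_alt : exists F : {perm point} -> G,
  [/\ {in 'Alt_point &, {morph F : s t / (s * t)%g}},
      {in alt_on P1, F =1 f} & {in alt_on P1, forall t, F (t ^ sy)%g = (f t ^ y)%g}].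
Proof.
pose B : {set point} := ~: [set u; v].
have BE j : (j \in B) = (j != u) && (j != v) by rewrite !inE negb_or.
have uB : u \notin B by rewrite BE eqxx.
have vB : v \notin B by rewrite BE eqxx andbF.
have [||F [FM FX]] := @carmichael _ u v uv _ X B uB vB.
- by move=> j; rewrite BE => /andP[ju jv]; apply: X3.
- by move=> i j; rewrite !BE => /andP[iu iv] /andP[ju jv]; apply: X2.
rewrite setUCr in FM; have altT := alt_onT.
have FM' : {in 'Alt_point &, {morph F : s t / (s * t)%g}}.
  by move=> s t s_on t_on; rewrite FM // alt_onT.
have P1E : P1 = [set u; v] :|: (P1 :\: [set u; v]).
  apply/setP=> j; rewrite in_setU in_setD; case: (boolP (j \in [set u; v])) => //= /set2P[] ->;
  by rewrite inE ptK; arith.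
have on_alt t : t \in alt_on P1 -> t \in 'Alt_point.
  by rewrite -alt_onT; apply: alt_onS; apply: subsetT.
have uA : u \notin P1 :\: [set u; v] by rewrite !inE eqxx.
have vA : v \notin P1 :\: [set u; v] by rewrite !inE eqxx orbT.
exists F; split=> //.
  rewrite P1E; apply: (eq_alt_on_morph uv uA vA); rewrite -?P1E //.
    by move=> s t s_on t_on; rewrite FM' ?on_alt.
  move=> j; rewrite in_setD in_set2 negb_or => /andP[/andP[ju jv] j1].
  by rewrite FX ?BE ?ju // X_P1.
rewrite P1E; apply: (eq_alt_on_morph uv uA vA); rewrite -?P1E //.
- move=> s t s_on t_on; rewrite conjMg FM' //.
    by rewrite Alt_even odd_permJ -Alt_even on_alt.
  by rewrite Alt_even odd_permJ -Alt_even on_alt.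
- by move=> s t s_on t_on; rewrite /= fM // conjMg.
move=> j; rewrite in_setD in_set2 negb_or => /andP[/andP[ju jv] j1].
rewrite cycle3J sy_u sy_v FX ?X_sy // BE -{1}sy_u -{1}sy_v !(inj_eq perm_inj).
by rewrite ju.
Qed.

End Extension.

(** * The values of words are exactly the even permutations *)

Let env_in_alt (i : 'I_3) : i != 2 :> nat -> sigma_env i \in 'Alt_point.
Proof.
have on_alt t : t \in alt_on P1 -> t \in 'Alt_point.
  by rewrite -alt_onT; apply/alt_onS/subsetT.
case: i => [[|[|[|i]]] i_lt] //= _; apply: on_alt; first exact: sigma_a_P1.
exact: sigma_g_P1.
Qed.

Lemma sigma_env_alt (i : 'I_3) : sigma_env i \in 'Alt_point.
Proof.
case: (eqVneq (i : nat) 2) => [i2 | /env_in_alt //].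
(* Parity of y without counting transpositions: y is the value of w, a word in a, g and their
   conjugates by y, all of which are even. *)
have -> : sigma_env i = E (ww n p) by rewrite eval_w /sigma_env i2.
have [v ->] := in_y_conjugates_w n p; apply: (@eval_in _ 'Alt_point) => j.
have a_on := env_in_alt (i := Ordinal (isT : 0 < 3)%N) isT.
have g_on := env_in_alt (i := Ordinal (isT : 1 < 3)%N) isT.
case: j => [[|[|[|[|j]]]] j_lt] //; rewrite /y_conjugates [nth _ _ _]/= ?evalJ //.
  by rewrite Alt_even odd_permJ -Alt_even.
by rewrite Alt_even odd_permJ -Alt_even.
Qed.

Lemma eval_alt e : E e \in 'Alt_point.
Proof. by apply: (@eval_in _ 'Alt_point) => i; apply: sigma_env_alt. Qed.

Fact image_group_set : group_set [set t : {perm point} | `[< exists e, t = E e >]].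
Proof.
apply/group_setP; split; first by rewrite inE; apply/asboolP; exists One.
move=> s t; rewrite !inE => /asboolP[e1 ->] /asboolP[e2 ->].
by apply/asboolP; exists (Mul e1 e2).
Qed.

(** The z(i) generate the alternating group on 1, ..., p+2; conjugating by y adds the 3-cycles (j,
    1, 2) with j nonpositive, and these suffice. *)
Lemma alt_eval t : t \in 'Alt_point -> exists e, t = E e.
Proof.
pose H : {group {perm point}} := Group image_group_set.
have HE e : E e \in H by rewrite inE; apply/asboolP; exists e.
suff tH : t \in 'Alt_point -> t \in H by move=> /tH; rewrite inE => /asboolP.
have H_P1 t' : t' \in alt_on P1 -> t' \in H.
  have P1E : P1 = [set pt (q + 1); pt (q + 2)] :|: [set x : point | 1 <= val x <= q].
    apply/setP=> x; rewrite !inE -!(inj_eq val_inj) !ptK; try arith.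
    by have := val_range x; move: (val x) => w; arith.
  rewrite P1E; apply: alt_on_sub.
  - by rewrite pt_eq; arith.
  - by rewrite inE ptK; arith.
  - by rewrite inE ptK; arith.
  move=> x; rewrite inE => x_in; rewrite -[x]valK_pt; move: (val x) x_in => w w_in.
  by rewrite -cyc3_pt -?eval_zi //; arith.
rewrite -alt_onT -(setUCr [set pt 1; pt 2]); apply: alt_on_sub.
- by rewrite pt_eq; arith.
- by rewrite !inE eqxx.
- by rewrite !inE eqxx orbT.
move=> j; rewrite in_setC in_set2 negb_or => /andP[j1 j2].
have c3 (l : point) : l \in P1 -> l != pt 1 -> l != pt 2 -> cycle3 (pt 1) (pt 2) l \in H.
  move=> l1 lu lv; apply/H_P1/cycle3_on => //; rewrite ?inE ?ptK ?pt_eq //; arith.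
have [jP | jP] := boolP (j \in P1); first exact: c3.
have [l l_in jl] := sy_image jP; have l1 := high_P1 l_in.
have Hy : sy \in H by rewrite -[sy]/(E wy).
have <- : (cycle3 (pt 1) (pt 2) l ^ sy)%g = cycle3 (pt 1) (pt 2) j.
  by rewrite cycle3J -jl !sy_common // ptK; arith.
by rewrite groupJ // c3 //; apply: contraTN l_in => /eqP->; rewrite ptK; arith.
Qed.

Section Hom.
Variables (s : int) (G : groupType) (rho : 'I_3 -> G).
Hypothesis sr : s%:~R * (val r - 1) = -1 :> 'F_p.
Local Notation R := (eval rho).
Hypothesis rho_rel : @satisfies (Jbar n p s) G rho.

(** The extension has the right values on a, g and their conjugates by y, hence on w. As w evaluates
    to y both in the permutations and in G, its value on y is right as well. *)
Lemma alt_hom : exists F : {perm point} -> G,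
  {in 'Alt_point &, {morph F : s t / (s * t)%g}} /\ forall e, F (E e) = R e.
Proof.
have [rel_ab [rel_s [rel_z [rel_h [rel_c [rel_d [rel_y _]]]]]]] := rho_rel.
have [u Eu] : exists u : point, q + 1 = val u by apply: pointP; rewrite mem_points //; arith.
have [v Ev] : exists v : point, q + 2 = val v by apply: pointP; rewrite mem_points //; arith.
have [f [fM fz]] := hom_private1_zi (esym Eu) (esym Ev) sr rel_ab rel_s rel_z.
have fe := hom_private1_eval (esym Eu) (esym Ev) sr rel_ab rel_s rel_h fM fz.
have [F [FM Ff Fy]] := extend_alt fM fe rel_h rel_c rel_d.
exists F; split=> // e.
have FY (i : 'I_4) : F (E (y_conjugates i)) = R (y_conjugates i).
  case: i => [[|[|[|[|i]]]] i_lt] //; rewrite /y_conjugates [nth _ _ _]/=.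
  - by rewrite Ff ?fe ?eval_P1.
  - by rewrite Ff ?fe ?eval_P1.
  - by rewrite !evalJ [E wy]/(sy) Fy ?fe ?eval_P1.
  - by rewrite !evalJ [E wy]/(sy) Fy ?fe ?eval_P1.
have Fw : F (E (ww n p)) = R (ww n p).
  have [w Ew] := in_y_conjugates_w n p; rewrite !Ew (pmorph_eval FM) => [|i].
    exact: (@eval_ext _ _ (F \o _) (fun i => R (y_conjugates i)) FY w).
  exact: eval_alt.
rewrite (pmorph_eval FM) => [|i]; last exact: sigma_env_alt.
apply: (@eval_ext _ _ (F \o _) rho) => i /=; rewrite -[sigma_env i]/(E (Gen i)) -[rho i]/(R (Gen i)).
have [i2 | i2] := eqVneq (i : nat) 2; last by rewrite Ff ?fe ?eval_P1.
have -> : Gen i = wy by congr Gen; apply: val_inj.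
by rewrite rel_y -Fw eval_w.
Qed.

End Hom.

(** * The permutations satisfy the relations *)

Let pcycle_mapev (c : seq int) (t : {perm point}) : pcycle c -> pcycle (map (ev t) c).
Proof.
case/andP=> Uc /allP c_in; rewrite pcycleE (map_inj_uniq (@ev_inj _ _ t)) Uc /=.
by apply/allP=> _ /mapP[x /c_in x_in ->]; rewrite ev_in.
Qed.

Let irange_map_y (i : int) : 1 <= i -> [seq ev sy x | x <- irange i K] = irange i K.
Proof.
move=> i1; rewrite -[RHS]map_id; apply/eq_in_map => x; rewrite mem_irange => /andP[ix xK].
by rewrite ev_y_in // xK (le_trans i1).
Qed.

Lemma sigma_rel_ab : E (wa ^+ q)%W = E (wb ^+ m%:Z)%W.
Proof.
rewrite -[LHS]/(sa ^+ p)%g -[RHS]/(E wb ^+ m)%g eval_b sigma_aX -mulpermX.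
have -> : (r ^+ m = 1)%g.
  by rewrite -alpha3 -expgM mulnC expgM (expg_unit_half p_pr p11 alpha_sq) expg1n.
by rewrite mulperm1.
Qed.

Lemma sigma_rel_s (s : int) : s%:~R * (val r - 1) = -1 :> 'F_p ->
  E ((wa ^+ s) ^ wb)%W = E (wa ^+ (s - 1)%R)%W.
Proof.
move=> sr; rewrite evalJ eval_b [E (wa ^+ s)%W]/(expgz sa s) expgzJ sigma_ab.
rewrite -[RHS]/(expgz sa (s - 1)) -[(sa ^+ _)%g]/(expgz sa (val (val r))) -expgzM.
apply: (eq_expgz_mod sigma_aX); apply/(Fp_int_eq p_pr).
have -> : (s - 1)%:~R = s%:~R + s%:~R * (val r - 1) :> 'F_p by rewrite sr rmorphB.
by rewrite rmorphM /= Fp_valK; ring.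
Qed.

Lemma sigma_rel_z : E ((wz p * (wz p ^ wa)) ^+ 2)%W = 1%g.
Proof.
rewrite -[LHS]/((E (wz p) * E (wz p ^ wa)%W) ^+ 2)%g eval_z.
rewrite -[E (wz p ^ wa)%W]/(E (wzi p 1)) eval_zi; last by arith.
rewrite -[sz]/(cyc [:: q; q + 1; q + 2]) !cyc3_pt; try arith.
by rewrite cycle3_mul_sq // pt_eq; arith.
Qed.

Lemma sigma_rel_h : E (watilde p) = E ((watilde p * wh p) ^ wy)%W.
Proof.
rewrite evalJ -[E (_ * _)%W]/(E (watilde p) * E (wh p))%g eval_h mulg1 eval_atilde.
by rewrite [E wy]/sy cycJ /= ?ev_y_in //; try apply: pcycle3; arith.
Qed.

Lemma sigma_rel_c : E (wc n p) = E (wc n p ^ wy)%W.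
Proof.
have map_y i : 1 <= i -> [seq ev (E wy) x | x <- irange i K] = irange i K := @irange_map_y i.
rewrite evalJ eval_cw; case: ifP => _; rewrite cycJ ?map_y //;
  by apply: pcycle_irange; arith.
Qed.

(** The supports are disjoint: d moves only 5, ..., p+2, whereas e^y moves only 1, possibly 2, and
    nonpositive points. *)
Lemma sigma_rel_d : E (Comm (wd p) (Conj (we n p) wy)) = 1%g.
Proof.
rewrite evalR; apply/eqP/commgP; rewrite evalJ eval_dw eval_ew cycJ; last exact: pcycle_ew.
apply: cyc_commute; first by apply: pcycle_irange; arith.
  exact/pcycle_mapev/pcycle_ew.
apply/hasPn => _ /mapP[x x_in ->]; rewrite [_ \in _]mem_irange -[E wy]/sy.
have: [|| x == 1, x == 2 | K + 1 <= x <= q + 2].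
  by case: ifP x_in => _; rewrite !inE mem_irange; arith.
case/or3P=> [/eqP-> | /eqP-> | /ev_y_high]; [by rewrite ev_y_in; arith .. |].
by move: (ev sy x) => w; arith.
Qed.

Lemma sigma_satisfies (s : int) : s%:~R * (val r - 1) = -1 :> 'F_p ->
  @satisfies (Jbar n p s) {perm point} sigma_env.
Proof.
move=> sr; have rw : E wy = E (ww n p) by rewrite eval_w.
exact: (conj sigma_rel_ab (conj (sigma_rel_s sr) (conj sigma_rel_z (conj sigma_rel_h
  (conj sigma_rel_c (conj sigma_rel_d (conj rw I))))))).
Qed.

Lemma pelt_surj (P : presentation) (x : presented P) : exists e, x = pelt P e.
Proof.
elim/presented_ind: x => u.
pose letter (l : 'I_(ngens P) * bool) := if l.2 then Pow (Gen l.1) (- 1) else Gen l.1.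
exists (foldr (fun l => Mul (letter l)) One u); congr pclass.
by elim: u => //= -[x []] u <-.
Qed.

Section Isomorphism.
Variable s : int.
Hypothesis sr : s%:~R * (val r - 1) = -1 :> 'F_p.
Local Notation J := (Jbar n p s).

(** The map comes from [von_dyck]; [alt_hom], applied with the presented group as target, recovers
    an element from its image, which is injectivity. *)
Lemma presented_alt : exists phi : {multiplicative presented J -> {perm point}},
  [/\ injective phi, forall t, t \in 'Alt_point <-> exists x, phi x = t &
      forall e, phi (pelt J e) = E e].
Proof.
have [phi phiE] := von_dyck (sigma_satisfies sr); exists phi; split=> // [x1 x2|t].
  have [F [_ FE]] := alt_hom sr (@pelt_satisfies J).
  have [[e1 ->] [e2 ->]] := (pelt_surj x1, pelt_surj x2).
  by rewrite !phiE => E12; rewrite !pelt_eval -!FE E12.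
split=> [/alt_eval[e ->] | [x <-]]; first by exists (pelt J e).
by have [e ->] := pelt_surj x; rewrite phiE eval_alt.
Qed.

End Isomorphism.

End Images.

Lemma card_point n p : (kpar n p + n = 2 * p + 4)%N -> (kpar n p <= p)%N ->
  #|{: point n p}| = n.
Proof.
move=> kn kp; rewrite card_seq_sub ?irange_uniq // size_irange; lia.
Qed.

Theorem theorem67 :
  exists C : nat, forall n p : nat,
  [|| (15 <= n <= 20)%N, (27 <= n <= 44)%N | (51 <= n)%N] ->
  prime p -> p = 11 %[mod 12] -> (n + 2 <= 2 * p)%N -> (p <= n - 4)%N ->
  let k := kpar n p in
  [/\ (6 <= k <= p)%N, n = k %[mod 2], gcdn (p - 1) 3 = 1%N &
      #|{: point n p}| = n] /\
  forall (r : {unit 'F_p}) (s : int),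
  Fp_squares p = <[r]>%g ->
  s%:~R * (val r - 1) = -1 :> 'F_p ->
  (exists2 alpha, alpha \in Fp_squares p & (alpha ^+ 3)%g = r) /\
  forall alpha : {unit 'F_p},
  alpha \in Fp_squares p -> (alpha ^+ 3)%g = r ->
  let J := Jbar n p s in
  [/\ ngens J = 3%N,
      size (rels J) = 7%N,
      (absz s <= p)%N -> (bit_length J <= C * trunc_log 2 n)%N,
      exists v : expr 'I_4,
        word_eq [::] (expand (ww n p))
          (expand (esubst (fun i : 'I_4 =>
             nth One [:: wa; wg; Conj wa wy; Conj wg wy] i) v)) &
      exists phi : {multiplicative presented J -> {perm point n p}},
  (* isomorphism onto the alternating group *)
  [/\ injective phi,
      forall t, t \in Alt (point n p) <-> exists x, phi x = t,
      phi (pelt J wa) = sigma_a n p,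
      phi (pelt J wg) = sigma_g n alpha &
      phi (pelt J wy) = sigma_y n p] /\
  let T := cyc n p [:: p%:Z + 1; p%:Z + 2] in
  [/\ [/\ phi (pelt J wb) = mulperm n r,
          phi (pelt J (wz p)) = cyc n p [:: p%:Z; p%:Z + 1; p%:Z + 2] &
          phi (pelt J (wh p)) = 1%g],
      [/\ forall i : int, 1 <= i <= p%:Z ->
            phi (pelt J (wzi p i)) = cyc n p [:: i; p%:Z + 1; p%:Z + 2],
          forall i j : int, 1 <= i <= p%:Z -> 1 <= j <= p%:Z -> i != j ->
            phi (pelt J (wdij p i j)) = (cyc n p [:: i; j]%R * T)%g,
          forall i i' : int, (i = i' %[mod p%:Z])%Z ->
            pelt J (wzi p i) = pelt J (wzi p i') &
          forall i i' j j' : int,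
            (i = i' %[mod p%:Z])%Z -> (j = j' %[mod p%:Z])%Z ->
            pelt J (wdij p i j) = pelt J (wdij p i' j')],
      phi (pelt J (wx p)) = (cyc n p [:: 1; p%:Z]%R * T)%g /\
      forall i j : int,
        [\/ 1 <= i <= j /\ j <= p%:Z - 1,
            1 <= i <= p%:Z - 2 /\ j = p%:Z,
            1 <= i <= p%:Z - 1 /\ j = p%:Z + 1 |
            1 <= i <= p%:Z - 2 /\ j = p%:Z + 2] ->
        phi (pelt J (wcij p i j)) =
          (cyc n p (irange i j) * T ^+ absz (j - i)%R)%g,
      [/\ phi (pelt J (watilde p)) = cyc n p [:: 1; 2; 3],
          phi (pelt J (wc n p)) =
            cyc n p (if odd n then irange 1 k else irange 2 k),
          phi (pelt J (wd p)) = cyc n p (irange 5 (p%:Z + 2)) &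
          phi (pelt J (we n p)) =
            cyc n p (if odd n then 1 :: irange (k%:Z + 1) (p%:Z + 2)
                     else 1 :: 2 :: irange (k%:Z + 1) (p%:Z + 2))] &
      [/\ k = p ->
            phi (pelt J (ww n p)) =
              (cyc n p [:: -1; p%:Z + 2]%R * cyc n p [:: 0; p%:Z + 1]%R)%g,
          (k < p)%N ->
            phi (pelt J (wxtilde n p)) =
              (* d(1, k + 2) is d(1, p + 1) when k = p - 1 *)
              (cyc n p [:: -1; if (k + 2 <= p)%N then k%:Z + 2 else p%:Z + 2]%R
               *
               cyc n p [:: 0; k%:Z + 1]%R)%g,
          (k < p)%N ->
            phi (pelt J (wu p)) =
              (cyc n p (irange 1 (p%:Z + 2))%R *
               cyc n p (irange 1 k ++
                 (* y maps (p + 1, p + 2) to (- p + k, - p - 1 + k) if n is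
                    odd, and to (- p - 1 + k, - p + k) if n is even *)
                 if odd n then [seq - i%:Z | i <- iota 0 (p + 2 - k)]
                 else [seq - i%:Z | i <- iota 0 (p - k)] ++
                      [:: - p%:Z - 1 + k%:Z; - p%:Z + k%:Z])%R)%g &
          phi (pelt J (ww n p)) = sigma_y n p]]].
Proof.
exists (50 * 1000)%N => n p n_in p_pr p11 le_n le_p.
have kn : (kpar n p + n = 2 * p + 4)%N by rewrite /kpar; lia.
have k6 : (6 <= kpar n p)%N by lia.
have kp : (kpar n p <= p)%N by lia.
have n15 : (15 <= n)%N by lia.
split.
  split; [by rewrite k6 | rewrite /kpar; lia | | exact: card_point].
  have p3 : ((p - 1) %% 3 = 1)%N by lia.
  by rewrite -gcdn_modl p3.
move=> r s gen_r sr; split; first exact: exists_cube_root.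
move=> alpha alpha_sq alpha3; split=> //; first by move=> sp; apply: (bit_length_le n15 kn kp _ sp k6); lia.
  exact: w_word.
have [phi [phi_inj phi_im phiE]] := presented_alt kn k6 kp p_pr p11 gen_r alpha_sq alpha3 sr.
(* Independence of the residue is an equality in the presented group; it is read off from the
   permutations through injectivity of phi. *)
have zi_mod (i i' : int) : (i = i' %[mod p%:Z])%Z ->
    pelt (Jbar n p s) (wzi p i) = pelt (Jbar n p s) (wzi p i').
  by move=> ii'; apply: phi_inj; rewrite !phiE; apply: eq_wzi.
exists phi; split; first by split=> //; rewrite phiE.
split.
- split; rewrite phiE.
  + exact: eval_b.
  + exact: eval_z.
  exact: (eval_h kn k6 kp p_pr p11 gen_r alpha_sq alpha3).
- split=> // [i i_in|i j i_in j_in ij|i i' j j' ii' jj'].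
  + by rewrite phiE; apply: eval_zi.
  + by rewrite phiE; apply: eval_d.
  by apply: phi_inj; rewrite !phiE; apply: eq_wdij.
- split; first by rewrite phiE; apply: eval_x.
  by move=> i j ij; rewrite phiE; apply: eval_c.
- split; rewrite phiE.
  + exact: eval_atilde.
  + exact: eval_cw.
  + exact: eval_dw.
  exact: eval_ew.
split; rewrite phiE => *.
- exact: eval_w_eq.
- exact: eval_xt.
- exact: eval_u.
exact: eval_w.
Qed.
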